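(* Let $\{f_n\}_{n=0}^{\infty}\subset\mathcal{S}'_+$ be a sequence of distributions. The following are equivalent: (a) for every sequence $\{a_n\}_{n=0}^{\infty}$ of complex numbers there exists $\phi\in\mathcal{S}(0,\infty)$ with $\langle f_n,\phi\rangle=a_n$ for all $n\in\mathbb{N}$; (b) the sequence $\{f_n\}_{n=0}^{\infty}$ satisfies both properties (P1) and (P2).
   Context: $\mathbb{N}=\{0,1,2,\dots\}$. $\mathcal{S}(0,\infty)=\{\phi\in\mathcal{S}(\mathbb{R}):\operatorname{supp}\phi\subseteq[0,\infty)\}$, where $\mathcal{S}(\mathbb{R})$ is the Schwartz space. $\mathcal{S}'_+$ is the space of tempered distributions on $\mathbb{R}$ with support in $[0,\infty)$. $\mathcal{N}_0\subset\mathcal{S}'_+$ is the annihilator of $\mathcal{S}(0,\infty)$, i.e. the set of all finite linear combinations of the Dirac delta $\delta$ at the origin and its derivatives (including $0$). For $f\in\mathcal{S}'_+$ and $m\in\mathbb{N}$, $f^{(-m)}$ denotes the $m$-primitive of $f$ lying in $\mathcal{S}'_+$ (the unique element of $\mathcal{S}'_+$ whose $m$-th derivative is $f$). Cesàro order symbols: for $f\in\mathcal{S}'_+$, $m\in\mathbb{N}$ and $\alpha>0$, $\alpha\notin\mathbb{Z}$: - $f(x)=O(x^\alpha)$ $(\mathrm{C},m)$, $x\to\infty$, means that $f^{(-m)}$ is a regular distribution (locally Lebesgue integrable function) for large arguments and there is a polynomial $P$ of degree at most $m-1$ such that $f^{(-m)}(x)=P(x)+O(x^{\alpha+m})$ as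 $x\to\infty$; - $f(x)=O(x^{-\alpha})$ $(\mathrm{C},m)$, $x\to0^+$, means that $f^{(-m)}$ is a locally Lebesgue integrable function on some interval $(0,\delta)$ and there is a polynomial $P$ of degree at most $m-1$ such that $f^{(-m)}(x)=P(x)+O(x^{-\alpha+m})$ as $x\to0^+$. (P1): no element of $\mathcal{N}_0$ is a nontrivial linear combination of the $f_n$; that is, if $\sum_{n=0}^N b_nf_n\in\mathcal{N}_0$ with $b_n\in\mathbb{C}$, then $b_0=\dots=b_N=0$. (P2) (Cesàro admissibility): there is an increasing sequence $\{m_j\}_{j=0}^\infty$ of (non-negative) integers such that for every $j\in\mathbb{N}$ and every $\alpha>0$, $\alpha\notin\mathbb{Z}$, there exists $\nu=\nu_{j,\alpha}\in\mathbb{N}$ such that whenever $N\ge\nu$ and $b_0,\dots,b_N\in\mathbb{C}$ satisfy the three conditions: $\sum_{n=0}^N b_nf_n(x)=O(x^\alpha)$ $(\mathrm{C},m_j)$, $x\to\infty$; the restriction of $\sum_{n=0}^N b_nf_n^{(-m_j)}$ to $(0,\infty)$ is a continuous function; and $\sum_{n=0}^N b_nf_n(x)=O(x^{-\alpha})$ $(\mathrm{C},m_j)$, $x\to0^+$; then $b_\nu=b_{\nu+1}=\dots=b_N=0$. *)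

(* Defs.v *)
From HB Require Import structures.
From mathcomp Require Import all_boot all_order all_algebra.
From mathcomp Require Import all_classical all_reals all_analysis.

Set Implicit Arguments.
Unset Strict Implicit.
Unset Printing Implicit Defensive.

Import Order.TTheory GRing.Theory Num.Theory.
Import numFieldNormedType.Exports.
From mathcomp.real_closed Require Import complex.

Local Open Scope classical_set_scope.
Local Open Scope complex_scope.
Local Open Scope ring_scope.

(* The complex field R[i] is used through its regular module R[i]^o, which
   carries the topology of the modulus; the order on R[i] satisfies
   z <= M%:C iff z is real and at most M. *)

#[local] Arguments Re {R}.
#[local] Arguments Im {R}.

Section ComplexCalculus.
Context {R : realType}.
Implicit Types (phi psi : R -> R[i]^o) (n k : nat).

Definition cderivable phi (x : R) : Prop :=
  derivable (Re \o phi : R -> R) x 1 /\ derivable (Im \o phi : R -> R) x 1.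

Definition cderive phi : R -> R[i]^o :=
  fun x => derive1 (Re \o phi : R -> R) x +i* derive1 (Im \o phi : R -> R) x.

Definition csmooth phi : Prop := forall n x, cderivable (iter n cderive phi) x.

Definition jet k n phi : R -> R[i]^o :=
  fun x => (x ^+ k)%:C * iter n cderive phi x.

Definition is_schwartz phi : Prop :=
  csmooth phi /\
  forall k n, exists M : R, forall x, `|jet k n phi x| <= M%:C.

Definition tsupp phi : set R := closure [set x | phi x != 0].

Definition cintegral (U : set R) (h : R -> R[i]^o) : R[i]^o :=
  (\int[lebesgue_measure]_(x in U) Re (h x)) +i*
  (\int[lebesgue_measure]_(x in U) Im (h x)).

Definition clocally_integrable (U : set R) (h : R -> R[i]^o) : Prop :=
  locally_integrable U (Re \o h) /\ locally_integrable U (Im \o h).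

Lemma cderiv_lin (a : R[i]) phi psi x :
  cderivable phi x -> cderivable psi x ->
  cderivable (a *: phi + psi) x /\
  cderive (a *: phi + psi) x = a *: cderive phi x + cderive psi x.
Proof.
move=> [dRp dIp] [dRq dIq]; case: a => a b.
set p1 := Re \o phi : R -> R; set p2 := Im \o phi : R -> R.
set q1 := Re \o psi : R -> R; set q2 := Im \o psi : R -> R.
have reE : (Re \o ((a +i* b) *: phi + psi) : R -> R) = a *: p1 - b *: p2 + q1.
  by apply/funext => y; rewrite /p1 /p2 /q1 !fctE /= [LHS]/=;
     case: (phi y) (psi y) => [? ?] [? ?].
have imE : (Im \o ((a +i* b) *: phi + psi) : R -> R) = a *: p2 + b *: p1 + q2.
  by apply/funext => y; rewrite /p1 /p2 /q2 !fctE /= [LHS]/=;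
     case: (phi y) (psi y) => [? ?] [? ?].
have d1 : is_derive x 1 (a *: p1 - b *: p2 + q1)
    (a *: derive1 p1 x - b *: derive1 p2 x + derive1 q1 x).
  rewrite !derive1E; apply: is_deriveD; [apply: is_deriveB|];
    by [apply: is_deriveZ; apply/derivableP | apply/derivableP].
have d2 : is_derive x 1 (a *: p2 + b *: p1 + q2)
    (a *: derive1 p2 x + b *: derive1 p1 x + derive1 q2 x).
  rewrite !derive1E; apply: is_deriveD; [apply: is_deriveD|];
    by [apply: is_deriveZ; apply/derivableP | apply/derivableP].
split.
  by rewrite /cderivable reE imE; split; [case: d1|case: d2].
rewrite /cderive reE imE !(derive1E (_ + _)).
by rewrite (@derive_val _ _ _ _ _ _ _ d1) (@derive_val _ _ _ _ _ _ _ d2).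
Qed.

Lemma cderiven_lin n (a : R[i]) phi psi : csmooth phi -> csmooth psi ->
  iter n cderive (a *: phi + psi) =
  a *: iter n cderive phi + iter n cderive psi.
Proof.
move=> sp sq; elim: n => [//|n IHn] /=; rewrite IHn.
by apply/funext => x; have [_ ->] := cderiv_lin a (sp n x) (sq n x).
Qed.

Lemma is_schwartz0 : is_schwartz 0.
Proof.
have d0 x : cderivable 0 x.
  by split; [rewrite (_ : _ \o _ = cst 0)//|rewrite (_ : _ \o _ = cst 0)//].
have c0 : cderive 0 = 0.
  apply/funext => x; rewrite /cderive.
  rewrite (_ : Re \o _ = cst 0)// (_ : Im \o _ = cst 0)//.
  by rewrite !derive1_cst.
have cn n : iter n cderive 0 = 0 by elim: n => [//|n /= ->].
split=> [n x|k n]; first by rewrite cn.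
by exists 0 => x; rewrite /jet cn mulr0 normr0.
Qed.

Lemma is_schwartz_lin (a : R[i]) phi psi :
  is_schwartz phi -> is_schwartz psi -> is_schwartz (a *: phi + psi).
Proof.
move=> [sp bp] [sq bq]; split=> [n x|k n].
  by rewrite cderiven_lin//; have [] := cderiv_lin a (sp n x) (sq n x).
have [M hM] := bp k n; have [N hN] := bq k n.
exists (Re `|a| * M + N) => x.
have -> : jet k n (a *: phi + psi) x = a * jet k n phi x + jet k n psi x.
  by rewrite /jet cderiven_lin// mulrDr; congr (_ + _); rewrite mulrCA.
rewrite (le_trans (ler_normD _ _))// rmorphD /= lerD// normrM rmorphM /=.
have -> : (Re `|a|)%:C = `|a| by rewrite [RHS]complexE; case: a => u v /=; simpc.
by rewrite ler_wpM2l.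
Qed.

Lemma is_schwartz_derive phi : is_schwartz phi -> is_schwartz (cderive phi).
Proof.
move=> [sp bp]; split=> [n x|k n]; first by rewrite -iterSr; exact: sp.
by have [M hM] := bp k n.+1; exists M => x; rewrite /jet -iterSr; exact: hM.
Qed.

End ComplexCalculus.

Definition schwartz_pred {R : realType} : {pred R -> R[i]^o} :=
  [pred phi | `[< is_schwartz phi >]].

Record schwartz (R : realType) := Schwartz {
  schwartz_fun :> R -> R[i]^o;
  schwartz_funP : schwartz_fun \in schwartz_pred }.

HB.instance Definition _ (R : realType) := [isSub of schwartz R for @schwartz_fun R].
HB.instance Definition _ (R : realType) := [Choice of schwartz R by <:].

Lemma schwartz_submod_closed (R : realType) :
  submod_closed (@schwartz_pred R : {pred (R -> R[i]^o)}).
Proof.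
split=> [|a phi psi]; first exact/asboolP/is_schwartz0.
by move=> /asboolP ? /asboolP ?; apply/asboolP/is_schwartz_lin.
Qed.

HB.instance Definition _ (R : realType) :=
  GRing.isSubmodClosed.Build R[i] (R -> R[i]^o) (@schwartz_pred R)
    (@schwartz_submod_closed R).
HB.instance Definition _ (R : realType) :=
  [SubChoice_isSubLmodule of schwartz R by <:].

(* The topology of the Schwartz space, defined by the seminorms
   sup_x |x ^ k * phi^(n)(x)|: phi_i --> phi iff, for every k and n, the
   functions x ^ k * phi_i^(n)(x) converge uniformly on R to
   x ^ k * phi^(n)(x). *)
Definition schwartz_jets {R : realType} (phi : schwartz R) :
    {ptws (nat * nat)%type -> {uniform R -> R[i]^o}} :=
  fun kn => jet kn.1 kn.2 phi.

HB.instance Definition _ (R : realType) :=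
  Topological.copy (schwartz R) (initial_topology (@schwartz_jets R)).

Section Distributions.
Context {R : realType}.
Implicit Types (u : schwartz R -> R[i]^o) (phi : schwartz R) (U : set R).

Lemma schwartz_derive_subproof phi : cderive phi \in schwartz_pred.
Proof.
by have /asboolP sp := schwartz_funP phi; exact/asboolP/is_schwartz_derive.
Qed.

Definition schwartz_derive phi : schwartz R :=
  Schwartz (schwartz_derive_subproof phi).

Definition schwartz_half : set (schwartz R) :=
  [set phi | tsupp phi `<=` [set x | 0 <= x]].

Definition tempered u : Prop := linear u /\ continuous u.

Definition vanishes_on U u : Prop :=
  forall phi, compact (tsupp phi) -> tsupp phi `<=` U -> u phi = 0.

Definition dist_supp u : set R :=
  ~` \bigcup_(U in [set U | open U /\ vanishes_on U u]) U.

Definition tempered_half : set (schwartz R -> R[i]^o) :=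
  [set u | tempered u /\ dist_supp u `<=` [set x | 0 <= x]].

(* Equivalently, the linear span of the Dirac delta at 0 and its derivatives. *)
Definition null_half : set (schwartz R -> R[i]^o) :=
  [set u | tempered_half u /\ forall phi, schwartz_half phi -> u phi = 0].

Definition dist_derive u : schwartz R -> R[i]^o :=
  fun phi => - u (schwartz_derive phi).

(* The set below is a singleton whenever u belongs to tempered_half. *)
Definition primitive (m : nat) u : schwartz R -> R[i]^o :=
  get [set v | tempered_half v /\ iter m dist_derive v = u].

(* On the open set U, u is the regular distribution given by g. *)
Definition regular_on U (g : R -> R[i]^o) u : Prop :=
  clocally_integrable U g /\
  forall phi, compact (tsupp phi) -> tsupp phi `<=` U ->
    u phi = cintegral U (g * (phi : R -> R[i]^o)).

(* "Degree at most m - 1" reads size P <= m, so that P = 0 when m = 0.  The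
   function g is only determined up to a null set, hence is quantified
   together with the bound. *)
Definition cesaro_pinfty (alpha : R) (m : nat) u : Prop :=
  exists (A : R) (g : R -> R[i]^o) (P : {poly R[i]}) (M : R),
    [/\ regular_on `]A, +oo[ g (primitive m u), (size P <= m)%N &
        \forall x \near +oo,
          `|g x - P.[x%:C]| <= (M * x `^ (alpha + m%:R))%:C].

Definition cesaro_zero (alpha : R) (m : nat) u : Prop :=
  exists (delta : R) (g : R -> R[i]^o) (P : {poly R[i]}) (M : R),
    [/\ 0 < delta, regular_on `]0, delta[ g (primitive m u),
        (size P <= m)%N &
        \forall x \near 0^'+,
          `|g x - P.[x%:C]| <= (M * x `^ (- alpha + m%:R))%:C].

Definition continuous_on_pos u : Prop :=
  exists g : R -> R[i]^o,
    (forall x : R, 0 < x -> {for x, continuous g}) /\ regular_on `]0, +oo[ g u.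

Implicit Types (f : nat -> schwartz R -> R[i]^o).

Definition null_free f : Prop :=
  forall (N : nat) (b : nat -> R[i]),
    null_half (\sum_(n < N.+1) b n *: f n) ->
    forall n, (n <= N)%N -> b n = 0.

Definition cesaro_admissible f : Prop :=
  exists m : nat -> nat,
    (forall i j, (i < j)%N -> (m i < m j)%N) /\
    forall (j : nat) (alpha : R), 0 < alpha -> alpha \isn't a Num.int ->
      exists nu : nat, forall (N : nat) (b : nat -> R[i]), (nu <= N)%N ->
        cesaro_pinfty alpha (m j) (\sum_(n < N.+1) b n *: f n) ->
        continuous_on_pos (\sum_(n < N.+1) b n *: primitive (m j) (f n)) ->
        cesaro_zero alpha (m j) (\sum_(n < N.+1) b n *: f n) ->
        forall n, (nu <= n <= N)%N -> b n = 0.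

End Distributions.

(* Main.v *)
(* Call f_n a top for the K-th Schwartz seminorm p_K if, modulo f_0, ..., f_(n-1),
   it is dominated by p_K on S(0, oo).  By Eidelheit's argument the moment problem
   is solvable for all data iff the f_n are independent on S(0, oo), which is (P1),
   and for every K only finitely many n are tops.  So (P2) has to be compared with
   domination by seminorms.

   If a combination u satisfies the three Cesaro conditions for m and alpha, then
   its m-th primitive is a continuous density of controlled growth at 0 and at oo,
   up to polynomials, and integration by parts dominates u by a p_K depending only
   on m and alpha.  Hence (a) gives (P2) with m_j = j.

   Conversely, if u is dominated by p_K, then testing its K-th primitive against
   K-th derivatives, and correcting by multiples of a fixed bump to lower the order
   of differentiation one step at a time, shows that the K-th primitive has order
   0 with polynomial growth.  One more primitive is the derivative of a continuous
   function G with polynomial growth, namely its value on the half-line below s, so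
   the (K+2)-th primitive of u is continuous on (0, oo) with polynomial growth, and
   the Cesaro conditions hold for a large half-integer alpha with P = 0. *)
Require Import Defs.
From mathcomp Require Import all_boot all_order all_algebra.
From mathcomp Require Import all_classical all_reals all_analysis.
From mathcomp Require Import measurable_realfun ring lra.
Set Implicit Arguments.
Unset Strict Implicit.
Unset Printing Implicit Defensive.
Import Order.TTheory GRing.Theory Num.Theory.
Import numFieldNormedType.Exports.
From mathcomp.real_closed Require Import complex.
Local Open Scope complex_scope.
Local Open Scope ring_scope.
Local Open Scope classical_set_scope.
#[local] Arguments Re {R}.
#[local] Arguments Im {R}.
Local Notation D1 := (@derive1 _ _).
Local Notation Dn := (@derive1n _ _).

(** * Smooth functions of a real variable *)

Section SmoothFunctions.
Context {R : realType}.
Implicit Types (f g : R -> R) (n : nat) (x y z a b c d : R).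

(** The order of quantifiers in (P2) shapes the estimates: nu is fixed before the combination. So
    the index K obtained from m and alpha, and the growth exponent L obtained from K, must be
    uniform in the distribution u, while the constants C may depend on it; hence L and C are carried
    separately. The analysis is done on real functions and extended by complex linearity, and
    estimates on S(0, oo) are proved on test functions supported in some [a, b] with a > 0, which
    are dense there. A distribution of order 0 is a measure, not a function, and no representation
    of measures is used. One primitive turns the bound by sup |f| into a bound by M (b - a), just
    enough for the values on smooth cuts of a half-line to converge, with a rate, as the cuts
    sharpen. The limit G is locally Lipschitz, and a quadratic remainder estimate identifies its
    distributional derivative. G and the next primitive then differ by a constant, found by testing
    against a bump of integral 1. The half in alpha is there because (P2) speaks of non-integers
    only. *)

Record smooth f : Prop := Smooth {
  smooth_derivable :> forall n x, derivable (Dn n f) x 1 }.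

(** Peels off the first derivative rather than the last, so that stability under products follows by
    induction on n with the factors generalised, without a formula for higher derivatives. *)
Fixpoint ndiff n f : Prop :=
  if n is m.+1 then (forall x, derivable f x 1) /\ ndiff m ((D1 f)) else True.

Lemma smooth_ndiff f : smooth f <-> forall n, ndiff n f.
Proof.
split=> [sf n|h].
  elim: n f sf => //= n IHn f sf; split; first exact: (sf 0%N).
  by apply: IHn; split => m x; rewrite -derive1Sn; exact: sf.
split => n; elim: n f h => [|n IHn] f h x; first by have [] := h 1%N.
by rewrite derive1Sn; apply: IHn => m; have [] := h m.+1.
Qed.

Lemma ndiffW n f : ndiff n.+1 f -> ndiff n f.
Proof. by elim: n f => //= n IHn f [? ?]; split => //; exact: IHn. Qed.

Lemma derivable_is_derive1 f x : derivable f x 1 -> is_derive x 1 f ((D1 f) x).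
Proof. by rewrite derive1E; exact: derivableP. Qed.

Lemma is_derive1E f x (d : R) : is_derive x 1 f d -> (D1 f) x = d.
Proof. by move=> h; rewrite derive1E; exact: derive_val. Qed.

Lemma derive1_lin a f g : (forall x, derivable f x 1) ->
  (forall x, derivable g x 1) ->
  (forall x, derivable (fun y => a * f y + g y) x 1) /\
  (D1 (fun y => a * f y + g y)) = (fun y => a * (D1 f) y + (D1 g) y).
Proof.
move=> df dg.
have h x : is_derive x 1 (fun y => a * f y + g y) (a * (D1 f) x + (D1 g) x).
  have -> : (fun y => a * f y + g y) = a *: f + g by apply/funext.
  by apply: is_deriveD; [apply: is_deriveZ|]; exact: derivable_is_derive1.
by split => [x|]; [case: (h x)|apply/funext => x; exact: is_derive1E].
Qed.

Lemma ndiff_lin n a f g : ndiff n f -> ndiff n g ->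
  ndiff n (fun y => a * f y + g y).
Proof.
elim: n f g => //= n IHn f g [df nf] [dg ng].
by have [? ->] := derive1_lin a df dg; split => //; exact: IHn.
Qed.

Lemma smooth_lin a f g : smooth f -> smooth g ->
  smooth (fun y => a * f y + g y).
Proof.
by move=> /smooth_ndiff sf /smooth_ndiff sg; apply/smooth_ndiff => n; exact: ndiff_lin.
Qed.

Lemma derive1n_lin n a f g : smooth f -> smooth g ->
  (Dn n (fun y => a * f y + g y)) = (fun y => a * (Dn n f) y + (Dn n g) y).
Proof.
move=> sf sg; elim: n => // n IHn.
by rewrite derive1nS IHn; have [_ ->] := derive1_lin a (sf n) (sg n).
Qed.

(** The idle factor [1 *] gives the derivative the shape treated by [ndiff_lin] and
    [derive1n_lin]. *)
Lemma derive1_mul f g : (forall x, derivable f x 1) ->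
  (forall x, derivable g x 1) ->
  (forall x, derivable (fun y => f y * g y) x 1) /\
  (D1 (fun y => f y * g y)) = (fun y => 1 * (f y * (D1 g) y) + (D1 f) y * g y).
Proof.
move=> df dg.
have h x : is_derive x 1 (fun y => f y * g y) (f x * (D1 g) x + (D1 f) x * g x).
  rewrite [X in _ + X]mulrC.
  by apply: is_deriveM; exact: derivable_is_derive1.
split => [x|]; [by case: (h x)|apply/funext => x; rewrite mul1r; exact: is_derive1E].
Qed.

Lemma ndiff_mul n f g : ndiff n f -> ndiff n g -> ndiff n (fun y => f y * g y).
Proof.
elim: n f g => //= n IHn f g [df nf] [dg ng].
have [? ->] := derive1_mul df dg; split => //; apply: ndiff_lin; apply: IHn => //;
  by apply: ndiffW.
Qed.

Lemma smooth_mul f g : smooth f -> smooth g -> smooth (fun y => f y * g y).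
Proof.
by move=> /smooth_ndiff sf /smooth_ndiff sg; apply/smooth_ndiff => n; exact: ndiff_mul.
Qed.

Lemma derive1_affine a b f : (forall x, derivable f x 1) ->
  (forall x, derivable (fun y => f (a * y + b)) x 1) /\
  (D1 (fun y => f (a * y + b))) = (fun y => a * (D1 f) (a * y + b) + 0).
Proof.
move=> df.
have h x : is_derive x 1 (fun y => f (a * y + b)) (a * (D1 f) (a * x + b)).
  have h1 : is_derive x 1 (fun y => a * y + b : R) a.
    have -> : (fun y => a * y + b) = a *: id + cst b by apply/funext.
    by apply: is_derive_eq; rewrite addr0 /GRing.scale/= mulr1.
  have h2 := derivable_is_derive1 (df (a * x + b)).
  have := @is_derive1_comp _ f (fun y => a * y + b) x _ _ h2 h1.
  by rewrite /GRing.scale/= mulrC.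
by split => [x|]; [case: (h x)|apply/funext => x; rewrite addr0; exact: is_derive1E].
Qed.

Lemma ndiff_cst n c : ndiff n (fun=> c : R).
Proof.
elim: n c => //= n IHn c; split=> [x|]; first exact: derivable_cst.
have -> : (D1 (fun=> c : R)) = (fun=> 0) by apply/funext => x; rewrite derive1_cst.
exact: IHn.
Qed.

Lemma smooth_cst c : smooth (fun=> c).
Proof. by apply/smooth_ndiff => n; exact: ndiff_cst. Qed.

Lemma ndiff_affine n a b f : ndiff n f -> ndiff n (fun y => f (a * y + b)).
Proof.
elim: n f => //= n IHn f [df nf]; have [? ->] := derive1_affine a b df.
split => //; apply: (@ndiff_lin n a (fun y => (D1 f) (a * y + b)) (fun=> 0)).
  exact: IHn.
exact: ndiff_cst.
Qed.

Lemma smooth_affine a b f : smooth f -> smooth (fun y => f (a * y + b)).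
Proof.
by move=> /smooth_ndiff sf; apply/smooth_ndiff => n; exact: ndiff_affine.
Qed.

Lemma derive1n_affine n a b f : smooth f ->
  (Dn n (fun y => f (a * y + b))) = (fun y => a ^+ n * (Dn n f) (a * y + b)).
Proof.
elim: n f => [|n IHn] f sf; first by apply/funext => x; rewrite mul1r.
rewrite derive1Sn; have [_ ->] := derive1_affine a b (sf 0%N).
have sf' : smooth (D1 f) by split => m x; rewrite -derive1Sn; exact: sf.
rewrite (derive1n_lin n a (smooth_affine a b sf') (smooth_cst 0)) IHn//.
apply/funext => y; rewrite derive1Sn exprS mulrA.
suff -> : (Dn n (fun=> 0 : R)) = (fun=> 0) by rewrite addr0.
by elim: n {IHn} => // n IHn; rewrite derive1nS IHn; apply/funext => x; rewrite derive1_cst.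
Qed.

Lemma smooth_derive f : smooth f -> smooth (D1 f).
Proof. by move=> sf; split => m x; rewrite -derive1Sn; exact: sf. Qed.

Lemma smooth_deriven n f : smooth f -> smooth (Dn n f).
Proof. by move=> sf; elim: n => // n IHn; rewrite derive1nS; exact: smooth_derive. Qed.

Lemma smooth_antiderivative f F :
  (forall x, is_derive x 1 F (f x)) -> smooth f -> smooth F /\ (D1 F) = f.
Proof.
move=> dF sf.
have E : (D1 F) = f by apply/funext => x; exact: is_derive1E.
split=> //; apply/smooth_ndiff => -[|n] //=; split; first by move=> x; case: (dF x).
by rewrite E; exact: (smooth_ndiff f).1.
Qed.

Lemma smooth_continuous f : smooth f -> continuous f.
Proof.
by move=> sf x; apply: differentiable_continuous; apply/derivable1_diffP; exact: (sf 0%N).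
Qed.

Lemma smooth_is_derive f x : smooth f -> is_derive x 1 f ((D1 f) x).
Proof. by move=> sf; exact/derivable_is_derive1/(sf 0%N). Qed.

Lemma smooth_is_deriven n f x : smooth f -> is_derive x 1 (Dn n f) ((Dn n.+1 f) x).
Proof. by move=> sf; exact/derivable_is_derive1/sf. Qed.

Lemma derive1n_add n m f : (Dn m (Dn n f)) = (Dn (m + n) f).
Proof. by rewrite /derive1n iterD. Qed.

(** Each differentiation doubles the number of terms, so 2 ^ n replaces the binomial sum. The bounds
    concern the single point x, which lets a weight in x be absorbed in B later. *)
Lemma product_bound n f g (A B x : R) : smooth f -> smooth g -> 0 <= A ->
  (forall i, (i <= n)%N -> `|(Dn i f) x| <= A) ->
  (forall i, (i <= n)%N -> `|(Dn i g) x| <= B) ->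
  `|(Dn n (fun y => f y * g y)) x| <= 2 ^+ n * (A * B).
Proof.
elim: n f g => [|n IHn] f g sf sg A0 fA gB.
  by rewrite mul1r normrM ler_pM//; [exact: (fA 0%N)|exact: (gB 0%N)].
rewrite derive1Sn; have [_ ->] := derive1_mul (sf 0%N) (sg 0%N).
have sf' := smooth_derive sf; have sg' := smooth_derive sg.
rewrite (derive1n_lin n 1 (smooth_mul sf sg') (smooth_mul sf' sg)) mul1r.
rewrite (le_trans (ler_normD _ _))// exprS mulr_natl mulr2n mulrDl lerD//.
  apply: IHn => // i lin; first by apply: fA; rewrite ltnW.
  by rewrite -derive1Sn; apply: gB.
apply: IHn => // i lin; last by apply: gB; rewrite ltnW.
by rewrite -derive1Sn; apply: fA.
Qed.

Lemma mvt_bound f (df : R -> R) (a b M : R) : a <= b ->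
  (forall x, a <= x <= b -> is_derive x 1 f (df x)) ->
  (forall x, a <= x <= b -> `|df x| <= M) -> `|f b - f a| <= M * (b - a).
Proof.
rewrite le_eqVlt => /predU1P[<- _ _|ab dfd M1]; first by rewrite !subrr mulr0 normr0.
have [||c cab ->] := @MVT R f df a b ab.
- by move=> c; rewrite in_itv/= => /andP[? ?]; apply: dfd; rewrite !ltW.
- apply: derivable_within_continuous => x; rewrite in_itv/= => xab.
  by have [] := dfd x xab.
- rewrite normrM (ger0_norm (_ : 0 <= b - a)) ?subr_ge0 ?(ltW ab)//.
  rewrite ler_wpM2r ?subr_ge0 ?(ltW ab)// M1//.
  by move: cab; rewrite in_itv/= => /andP[? ?]; rewrite !ltW.
Qed.

(** The mean value inequality on [0, x], iterated a times: each extra derivative buys one factor x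
    because all derivatives vanish at 0. *)
Lemma taylor_vanish (a n : nat) f (x M : R) : smooth f -> 0 <= x -> (Dn n f) 0 = 0 ->
  (forall i, (Dn i f) 0 = 0) -> (forall y, 0 <= y <= x -> `|(Dn (n + a) f) y| <= M) ->
  `|(Dn n f) x| <= x ^+ a * M.
Proof.
move=> sf x0 _ f0; elim: a n x x0 => [|a IHa] n x x0 fM.
  by rewrite mul1r -[n]addn0 fM// x0 lexx.
have := @mvt_bound (Dn n f) (Dn n.+1 f) 0 x (x ^+ a * M) x0.
rewrite f0 !subr0 exprSr mulrAC; apply.
  by move=> y _; exact: smooth_is_deriven.
move=> y /andP[y0 yx]; rewrite (le_trans (IHa n.+1 y y0 _))//.
  move=> z /andP[z0 zy]; rewrite addSnnS fM// z0/=; exact: le_trans zy yx.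
rewrite ler_wpM2r//; first by rewrite (le_trans _ (fM 0 _))// lexx x0.
by rewrite lerXn2r ?nnegrE.
Qed.

Lemma second_order_bound f (x h M : R) : smooth f ->
  (forall y, `|(Dn 2 f) y| <= M) -> `|f (x + h) - f x - h * (D1 f) x| <= M * h ^+ 2.
Proof.
move=> sf fM.
pose g y := f y - ((D1 f) x) * y.
have dg y : is_derive y 1 g ((D1 f) y - (D1 f) x).
  apply: is_deriveB; first exact: smooth_is_derive.
  have -> : (D1 f) x = (D1 f) x *: (1 : R) by rewrite /GRing.scale/= mulr1.
  rewrite [X in is_derive _ _ X](_ : _ = ((D1 f) x) *: id); first exact: is_deriveZ.
  by apply/funext => z; rewrite /GRing.scale/= mulr1.
have d1 y z : y <= z -> `|(D1 f) z - (D1 f) y| <= M * (z - y).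
  move=> yz; apply: (@mvt_bound (D1 f) (Dn 2 f) _ _ _ yz) => u _; last exact: fM.
  exact: (@smooth_is_deriven 1%N).
have M0 : 0 <= M by rewrite (le_trans _ (fM 0)).
have E : f (x + h) - f x - h * (D1 f) x = g (x + h) - g x by rewrite /g; ring.
rewrite E; have [h0|h0] := leP 0 h.
  have := @mvt_bound g _ x (x + h) (M * h) _ (fun y _ => dg y).
  rewrite [x + h - x]addrAC subrr add0r -mulrA; apply; first by rewrite lerDl.
  move=> y /andP[xy yh]; rewrite (le_trans (d1 _ _ xy))// ler_wpM2l//.
  by rewrite lerBlDl.
rewrite distrC; have := @mvt_bound g _ (x + h) x (M * - h) _ (fun y _ => dg y).
have -> : M * - h * (x - (x + h)) = M * h ^+ 2 by ring.
apply; first by rewrite gerDl ltW.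
move=> y /andP[xy yh]; rewrite distrC (le_trans (d1 _ _ yh))// ler_wpM2l//; lra.
Qed.

(** A quadratic remainder bound passes to pointwise limits, which a difference quotient does not. It
    serves for [flat] at 0, for limits of smooth functions and for functions built from a
    distribution. *)
Lemma is_derive_quadratic f (x d M eta : R) : 0 < eta ->
  (forall h, `|h| < eta -> `|f (x + h) - f x - h * d| <= M * h ^+ 2) ->
  is_derive x 1 f d.
Proof.
move=> eta0 hM.
have M0 : 0 <= M.
  have e2 : 0 < eta / 2 by rewrite divr_gt0.
  have e1 : `|eta / 2| < eta.
    by rewrite gtr0_norm// ltr_pdivrMr// ltr_pMr// ltr1n.
  by rewrite -(@pmulr_lge0 _ ((eta / 2) ^+ 2)) ?exprn_gt0// (le_trans _ (hM _ e1)).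
have h1 : (fun h : R => h^-1 *: ((f \o shift x) (h *: (1 : R)) - f x)) @ 0^' --> d.
  apply/cvgrPdist_le => e e0; near=> h.
  have hn0 : h != 0 by near: h; exact: nbhs_dnbhs_neq.
  rewrite /= /GRing.scale/= mulr1 (addrC h) distrC.
  have -> : h^-1 * (f (x + h) - f x) - d = h^-1 * (f (x + h) - f x - h * d).
    by rewrite [RHS]mulrBr mulrA mulVf// mul1r.
  have he : `|h| < eta by near: h; exact: dnbhs0_lt.
  rewrite normrM normfV mulrC ler_pdivrMr ?normr_gt0// (le_trans (hM h he))//.
  rewrite -real_normK ?num_real// expr2 mulrA ler_wpM2r//.
  rewrite (le_trans (ler_wpM2r _ (_ : M <= M + 1)))//; first by rewrite lerDl.
  rewrite mulrC -ler_pdivlMr ?ltr_wpDl//.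
  by near: h; apply: dnbhs0_le; rewrite divr_gt0// ltr_wpDl.
by split; [apply/cvg_ex; exists d|apply/cvg_lim].
Unshelve. all: by end_near. Qed.

(** The bound on the derivatives of order n + 2 gives a quadratic remainder uniform in N, which
    survives the limit; pointwise convergence of all derivatives is then enough. *)
Lemma smooth_limit (F : nat -> R -> R) (G : nat -> R -> R) (M : nat -> R) :
  (forall N, smooth (F N)) ->
  (forall n, exists N0, forall N x, (N0 <= N)%N -> `|(Dn n (F N)) x| <= M n) ->
  (forall n x, (Dn n (F N)) x @[N --> \oo] --> G n x) ->
  smooth (G 0%N) /\ forall n, (Dn n (G 0%N)) = G n.
Proof.
move=> sF bF cF.
have dG n x : is_derive x 1 (G n) (G n.+1 x).
  apply: (@is_derive_quadratic _ _ _ (M n.+2) 1 ltr01) => h _.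
  have cE : `|(Dn n (F N)) (x + h) - (Dn n (F N)) x - h * (Dn n.+1 (F N)) x|
      @[N --> \oo] --> `|G n (x + h) - G n x - h * G n.+1 x|.
    apply: cvg_norm; apply: cvgB; [apply: cvgB; exact: cF|].
    by apply: cvgMl_tmp; exact: cF.
  rewrite -(cvg_lim _ cE)//; apply: limr_le; first by apply/cvg_ex; eexists; exact: cE.
  have [N0 hN0] := bF n.+2; exists N0 => // N N0N.
  apply: (@second_order_bound (Dn n (F N))); first exact: smooth_deriven.
  by move=> y; rewrite derive1n_add; exact: hN0.
have E n : (Dn n (G 0%N)) = G n.
  elim: n => // n IHn; rewrite derive1nS IHn; apply/funext => x.
  exact: is_derive1E.
by split=> //; split => n x; rewrite E; have [] := dG n x.
Qed.

End SmoothFunctions.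

(** * Functions that are flat at the origin *)

Section Bump.
Context {R : realType}.
Implicit Types (f g : R -> R) (x y z a b c d : R).

(** The classical exp (-1/x) is the case n = 0; the powers of 1/x make the family stable under
    differentiation up to linear combinations, so that smoothness is a single induction. *)
Definition flat (n : nat) x : R :=
  if 0 < x then (x^-1) ^+ n * expR (- x^-1) else 0.

Lemma expn_le_expR n y : 0 <= y -> y ^+ n <= n`!%:R * expR y.
Proof.
case: n => [|n] y0.
  by rewrite expr0 mul1r (le_trans _ (expR_ge1Dx _))// lerDl.
rewrite mulrC -ler_pdivrMr ?ltr0n ?fact_gt0// (le_trans _ (expR_ge1Dxn n y0))//.
by rewrite lerDr.
Qed.

Lemma flat_quadratic n x : `|flat n x| <= n.+2`!%:R * x ^+ 2.
Proof.
rewrite /flat; case: ifPn => [x0|_]; last first.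
  by rewrite normr0 mulr_ge0 ?sqr_ge0.
have x1 : 0 < x^-1 by rewrite invr_gt0.
rewrite ger0_norm; last by rewrite mulr_ge0 ?expR_ge0// exprn_ge0// ltW.
have -> : x ^+ 2 = (x^-1 ^+ 2)^-1 by rewrite exprVn invrK.
rewrite ler_pdivlMr ?exprn_gt0// expRN mulrAC -exprD addn2.
by rewrite ler_pdivrMr ?expR_gt0// expn_le_expR// ltW.
Qed.

Lemma is_derive_flat n x :
  is_derive x 1 (flat n) (- n%:R * flat n.+1 x + flat n.+2 x).
Proof.
have [x0|x0|x0] := ltgtP x 0.
- have -> : - n%:R * flat n.+1 x + flat n.+2 x = 0.
    by rewrite /flat ltNge (ltW x0)/= mulr0 addr0.
  apply: (@near_eq_is_derive _ _ _ (cst 0)) => //.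
  near=> y; rewrite /flat ltNge; suff -> : y <= 0 by [].
  by near: y; exact: lt_le_nbhsl.
- have F : is_derive x 1 (fun y : R => (y^-1) ^+ n * expR (- y^-1))
      (- n%:R * flat n.+1 x + flat n.+2 x).
    have dV : is_derive x 1 (fun y : R => y^-1) (- x ^- 2).
      have := @is_deriveV _ id x 1 1 (lt0r_neq0 x0) _.
      by rewrite /GRing.scale/= mulr1; apply; exact: is_derive_id.
    have d1 := @is_deriveX _ _ _ n x _ _ dV.
    have d2 : is_derive x 1 (fun y : R => expR (- y^-1)) (x ^- 2 * expR (- x^-1)).
      have d3 := is_deriveN dV; rewrite opprK in d3.
      have := @is_derive1_comp _ expR (fun y : R => - y^-1) x _ _ (is_derive_expR _) d3.
      by rewrite /GRing.scale/= mulrC.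
    have -> : (fun y : R => (y^-1) ^+ n * expR (- y^-1)) =
        (fun y => y^-1) ^+ n * (fun y => expR (- y^-1)).
      by apply/funext => y; rewrite !fctE.
    apply: (@is_derive_eq _ _ _ _ _ _ _ _ (is_deriveM d1 d2)).
    rewrite /flat x0 /GRing.scale/=; case: n {d1} => [|n].
      by rewrite mulr0n !(mul0r, mulr0) expr0 !mul1r oppr0 mul0r addr0 add0r -exprVn.
    rewrite !fctE -!exprVn /=; set y := x^-1; set e := expR _.
    by rewrite -mulr_natl !exprS expr0; ring.
  apply: (@near_eq_is_derive _ _ _ (fun y : R => (y^-1) ^+ n * expR (- y^-1))) => //.
  near=> y; rewrite /flat; suff -> : 0 < y by [].
  by near: y; exact: lt_nbhsr.
- have -> : - n%:R * flat n.+1 x + flat n.+2 x = 0.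
    by rewrite /flat x0 ltxx mulr0 addr0.
  apply: (@is_derive_quadratic _ _ _ _ n.+2`!%:R 1 ltr01) => h _.
  by rewrite x0 add0r mulr0 subr0 [X in _ - X]/flat ltxx subr0 flat_quadratic.
Unshelve. all: by end_near. Qed.

Lemma smooth_flat n : smooth (flat n).
Proof.
apply/smooth_ndiff => k; elim: k n => //= k IHk n; split => [x|].
  by have [] := is_derive_flat n x.
have -> : D1 (flat n) = (fun x => - n%:R * flat n.+1 x + flat n.+2 x).
  by apply/funext => x; apply: is_derive1E; exact: is_derive_flat.
exact: ndiff_lin.
Qed.

Lemma flat_ge0 n x : 0 <= flat n x.
Proof.
by rewrite /flat; case: ifPn => // x0; rewrite mulr_ge0 ?expR_ge0// exprn_ge0// invr_ge0 ltW.
Qed.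

Lemma flat_gt0 n x : 0 < x -> 0 < flat n x.
Proof. by move=> x0; rewrite /flat x0 mulr_gt0 ?expR_gt0// exprn_gt0// invr_gt0. Qed.

Lemma flat_eq0 n x : x <= 0 -> flat n x = 0.
Proof. by move=> x0; rewrite /flat ltNge x0. Qed.

End Bump.

(** * Integrals dominated by the weight 1 / (1 + x^2) *)

Section Integration.
Context {R : realType}.
Implicit Types (f g : R -> R) (x y z t a b c d Q : R) (U : set R).
Local Notation mu := (@lebesgue_measure R).

Lemma integral_oneDsqr :
  (\int[mu]_x ((oneDsqr x)^-1)%:E = (pi : R)%:E)%E.
Proof.
rewrite (@ge0_symfun_integralT _ (fun x => (oneDsqr x)^-1))//=.
- have -> : [set x : R | 0 <= x] = `[0, +oo[%classic.
    by apply/seteqP; split => x /=; rewrite in_itv/= ?andbT.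
  by rewrite integral0y_oneDsqr -EFinM; congr (_%:E); field.
- exact: continuous_oneDsqrV.
- by move=> x; rewrite /= /oneDsqr sqrrN.
Qed.

Lemma integrable_oneDsqr U : measurable U ->
  mu.-integrable U (EFin \o (fun x => (oneDsqr x)^-1)).
Proof.
move=> mU; apply: (@integrableS _ _ _ mu setT) => //.
apply/integrableP; split.
  apply/measurable_EFinP; apply: continuous_measurable_fun.
  exact: continuous_oneDsqrV.
under eq_integral => x _.
  rewrite /= ger0_norm ?invr_ge0//; over.
by rewrite integral_oneDsqr ltry.
Qed.

(** The weight 1 / (1 + x^2) is the integrable majorant used everywhere below; its total mass is the
    [pi] of the later bounds. *)
Lemma decay_integral U f Q : measurable U -> measurable_fun U f ->
  (forall x, U x -> `|f x| <= Q * (oneDsqr x)^-1) ->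
  mu.-integrable U (EFin \o f) /\ `|\int[mu]_(x in U) f x| <= `|Q| * pi.
Proof.
move=> mU mf fQ.
have fQ' x : U x -> `|f x| <= `|Q| * (oneDsqr x)^-1.
  move=> Ux; rewrite (le_trans (fQ x Ux))// ler_wpM2r ?invr_ge0//.
  exact: ler_norm.
have iQ V : measurable V ->
    mu.-integrable V (EFin \o (fun x => `|Q| * (oneDsqr x)^-1)).
  move=> mV; have := integrableZl mV `|Q| (integrable_oneDsqr mV).
  by apply: eq_integrable.
have fi : mu.-integrable U (EFin \o f).
  apply: (@le_integrable _ _ _ mu U _ _ _ _ _ (iQ U mU)) => //; first exact/measurable_EFinP.
  by move=> x Ux; rewrite /= lee_fin (le_trans (fQ' x Ux))// ler_norm.
split=> //; apply: (@le_trans _ _ (\int[mu]_(x in U) `|f x|)).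
  exact: le_normr_Rintegral.
rewrite (@le_trans _ _ (\int[mu]_(x in U) (`|Q| * (oneDsqr x)^-1)))//.
  apply: le_Rintegral => //; first exact: integrable_norm.
  exact: iQ.
rewrite RintegralZl//; last exact: integrable_oneDsqr.
rewrite ler_wpM2l//.
have -> : pi = \int[mu]_(x in setT) (oneDsqr x)^-1 :> R.
  by rewrite /Rintegral integral_oneDsqr.
apply: fine_le; rewrite ?integral_oneDsqr//.
  exact: integrable_fin_num (integrable_oneDsqr mU).
rewrite -integral_oneDsqr; apply: ge0_subset_integral => //.
apply/measurable_EFinP; apply: continuous_measurable_fun.
exact: continuous_oneDsqrV.
Qed.

Definition lprim f x : R := \int[mu]_(t in `]-oo, x]) f t.

Lemma is_derive_lprim f Q x : continuous f ->
  (forall t, `|f t| <= Q * (oneDsqr t)^-1) -> is_derive x 1 (lprim f) (f x).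
Proof.
move=> cf fQ.
have mf : measurable_fun setT f by exact: continuous_measurable_fun.
have fi : mu.-integrable `]-oo, x + 1] (EFin \o f).
  apply: (@integrableS _ _ _ mu setT) => //.
  by have [] := @decay_integral setT f Q measurableT mf (fun t _ => fQ t).
have x1 : x < x + 1 by rewrite ltrDl.
have [dF <-] := continuous_FTC1 x1 fi (ltNyr _) (cf x).
exact: derivable_is_derive1.
Qed.

Lemma smooth_lprim f Q : smooth f ->
  (forall t, `|f t| <= Q * (oneDsqr t)^-1) ->
  smooth (lprim f) /\ D1 (lprim f) = f.
Proof.
move=> sf fQ; apply: smooth_antiderivative => // x.
by apply: is_derive_lprim fQ; exact: smooth_continuous.
Qed.

(** For t <= x <= 0 one has |x| <= |t|, so the weight x ^ k can be moved under the integral and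
    replaced by t ^ k. *)
Lemma lprim_weight f Q k x : continuous f -> x <= 0 ->
  (forall t, t <= 0 -> `|t ^+ k * f t| <= Q * (oneDsqr t)^-1) ->
  `|x ^+ k * lprim f x| <= `|Q| * pi.
Proof.
move=> cf x0 fQ.
have mf U : measurable U -> measurable_fun U f.
  by move=> mU; apply: measurable_funTS; exact: continuous_measurable_fun.
have [fi fib] : mu.-integrable `]-oo, x] (EFin \o (fun t => x ^+ k * f t)) /\
    `|\int[mu]_(t in `]-oo, x]) (x ^+ k * f t)| <= `|Q| * pi.
  apply: decay_integral => //.
    by apply: measurable_funM => //; exact: mf.
  move=> t /=; rewrite in_itv/= => tx.
  have t0 : t <= 0 by exact: le_trans x0.
  apply: le_trans (fQ t t0).
  rewrite !normrM ler_wpM2r// !normrX lerXn2r ?nnegrE//.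
  by rewrite !ler0_norm// lerN2.
move: fib; have [->|xn0] := eqVneq (x ^+ k) 0.
  by rewrite mul0r normr0 => _; rewrite mulr_ge0 ?pi_ge0.
rewrite RintegralZl//.
have := @integrableZl _ _ _ mu _ (measurable_itv `]-oo, x]%R) (x ^- k) _ fi.
apply: eq_integrable => // t _ /=.
by rewrite -EFinM mulrA mulVf// mul1r.
Qed.

Lemma lprim_eq0 f x : (forall t, t <= x -> f t = 0) -> lprim f x = 0.
Proof.
move=> f0; rewrite /lprim (@eq_Rintegral _ _ _ mu _ (cst 0)) ?Rintegral_cst ?mul0r//.
by move=> t; rewrite inE/= in_itv/= => /f0.
Qed.

Lemma cpt_decay f a b : continuous f -> (forall t, ~~ (a <= t <= b) -> f t = 0) ->
  exists2 Q, 0 <= Q & forall t, `|f t| <= Q * (oneDsqr t)^-1.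
Proof.
move=> cf f0; have [ab|ba] := leP a b; last first.
  exists 0 => // t; rewrite mul0r f0 ?normr0//.
  by apply/negP => /andP[at_ tb]; move: (le_trans at_ tb); rewrite leNgt ba.
pose g t := `|f t| * oneDsqr t.
have cg : {within `[a, b], continuous g}.
  apply: continuous_subspaceT => t; apply: cvgM; last exact: continuous_oneDsqr.
  by apply: cvg_norm; exact: cf.
have [c _ gc] := EVT_max ab cg.
exists (g c) => [|t]; first by rewrite mulr_ge0// (le_trans _ (oneDsqr_ge1 _)).
rewrite ler_pdivlMr ?(lt_le_trans _ (oneDsqr_ge1 _))//.
have [tab|tab] := boolP (a <= t <= b); first by apply: gc; rewrite in_itv.
by rewrite f0// normr0 mul0r mulr_ge0// (le_trans _ (oneDsqr_ge1 _)).
Qed.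

Lemma is_derive0_const f a b : (forall x, a <= x <= b -> is_derive x 1 f 0) ->
  a <= b -> f b = f a.
Proof.
move=> df ab; apply/eqP; rewrite -subr_eq0 -normr_le0.
have := @mvt_bound R f (fun=> 0) a b 0 ab df.
by rewrite mul0r; apply => x _; rewrite normr0.
Qed.

End Integration.

(** * A smooth step from 0 to 1 *)

Section SmoothStep.
Context {R : realType}.
Implicit Types (x y z a b c d e : R).

Let b0 (x : R) : R := flat 0 x * flat 0 (-1 * x + 1).

Let sb0 : smooth b0.
Proof. by apply: smooth_mul; [exact: smooth_flat|apply: smooth_affine; exact: smooth_flat]. Qed.

Let b0_ge0 x : 0 <= b0 x. Proof. by rewrite mulr_ge0 ?flat_ge0. Qed.

Let b0_out x : ~~ (0 <= x <= 1) -> b0 x = 0.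
Proof.
rewrite /b0 negb_and -!ltNge => /orP[x0|x1]; first by rewrite flat_eq0 ?mul0r// ltW.
by rewrite [X in _ * X]flat_eq0 ?mulr0//; lra.
Qed.

Let B x := lprim b0 x.

Let BP : smooth B /\ D1 B = b0.
Proof.
have [Q _ bQ] := cpt_decay (smooth_continuous sb0) b0_out.
exact: smooth_lprim bQ.
Qed.

Let dB x : is_derive x 1 B (b0 x).
Proof. by have [sB <-] := BP; exact: smooth_is_derive. Qed.

Let B_le x y : x <= y -> B x <= B y.
Proof.
move=> xy; have [sB E] := BP.
apply: (@ger0_derive1_ndecr _ B x y) => //; last first.
- by apply: continuous_subspaceT; exact: smooth_continuous.
- by move=> z _; rewrite E b0_ge0.
- by move=> z _; exact: (sB 0%N).
Qed.

Let B0 x : x <= 0 -> B x = 0.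
Proof.
move=> x0; apply: lprim_eq0 => t tx; rewrite /b0 flat_eq0 ?mul0r//.
exact: le_trans x0.
Qed.

Let B1 x : 1 <= x -> B x = B 1.
Proof.
apply: is_derive0_const => z /andP[z1 _]; have := dB z.
rewrite /b0 [X in _ * X]flat_eq0 ?mulr0//; lra.
Qed.

(** Otherwise the monotone [B] would vanish on all of [0, 1], hence so would its derivative [b0] at
    1/2, where both flat factors are positive. *)
Let B1_gt0 : 0 < B 1.
Proof.
have [sB E] := BP.
rewrite lt_neqAle -{2}(B0 (lexx 0)) B_le// andbT; apply/eqP => B10.
have Bc x : 0 <= x <= 1 -> B x = 0.
  move=> /andP[x0 x1]; apply/eqP; rewrite eq_le; apply/andP; split.
    by rewrite [leRHS]B10 B_le.
  by rewrite -[leLHS](B0 (lexx 0)) B_le.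
have h : is_derive (2^-1 : R) 1 B 0.
  apply: (@near_eq_is_derive _ _ _ (cst 0)) => //.
  near=> y; rewrite Bc//; apply/andP; split; near: y.
    by apply: lt_le_nbhsr; rewrite invr_gt0.
  by apply: lt_le_nbhsl; rewrite invf_lt1// ltr1n.
have := is_derive1E h; rewrite E => /eqP.
by rewrite gt_eqF// mulr_gt0// flat_gt0//; lra.
Unshelve. all: by end_near. Qed.

(* The trailing + 0 puts step in the shape c * f x + d of smooth_lin; likewise
   affine arguments are written a * x + b throughout, even when a or b is
   trivial. *)
Definition step x := (B 1)^-1 * B x + 0.

Lemma smooth_step : smooth step.
Proof. by apply: smooth_lin; [case: BP|exact: smooth_cst]. Qed.

Lemma step_eq0 x : x <= 0 -> step x = 0.
Proof. by move=> x0; rewrite /step (B0 x0) mulr0 addr0. Qed.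

Lemma step_eq1 x : 1 <= x -> step x = 1.
Proof. by move=> x1; rewrite /step (B1 x1) mulVf ?addr0// gt_eqF. Qed.

Lemma step_bound x : 0 <= step x <= 1.
Proof.
rewrite /step addr0 mulr_ge0 ?invr_ge0 ?(ltW B1_gt0)//=; last first.
  by have [x0|x0] := leP x 0; [rewrite (B0 x0)|rewrite -(B0 (lexx 0)) B_le// ltW].
rewrite mulrC ler_pdivrMr// mul1r.
by have [x1|x1] := leP x 1; [exact: B_le|rewrite B1// ltW].
Qed.

Lemma derive_step_out n x : ~~ (0 <= x <= 1) -> Dn n.+1 step x = 0.
Proof.
elim: n x => [|n IHn] x xo.
  apply: is_derive1E; move: xo; rewrite negb_and -!ltNge => /orP[x0|x1].
    apply: (@near_eq_is_derive _ _ _ (cst 0)) => //.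
    by near=> y; rewrite step_eq0//; near: y; exact: lt_le_nbhsl.
  apply: (@near_eq_is_derive _ _ _ (cst (1 : R))) => //.
  by near=> y; rewrite step_eq1//; near: y; exact: lt_le_nbhsr.
apply: is_derive1E; apply: (@near_eq_is_derive _ _ _ (cst 0)) => //.
move: xo; rewrite negb_and -!ltNge => /orP[x0|x1].
  near=> y; apply/esym/IHn; rewrite negb_and -!ltNge; apply/orP; left.
  by near: y; exact: lt_nbhsl.
near=> y; apply/esym/IHn; rewrite negb_and -!ltNge; apply/orP; right.
by near: y; exact: lt_nbhsr.
Unshelve. all: by end_near. Qed.

Lemma derive_step_bound n : exists2 C, 0 <= C & forall i x, (i <= n)%N ->
  `|Dn i step x| <= C.
Proof.
elim: n => [|n [C C0 hC]].
  exists 1 => // i x; rewrite leqn0 => /eqP ->.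
  by rewrite /= ger0_norm; have /andP[] := step_bound x.
have [Q Q0 hQ] := @cpt_decay R (Dn n.+1 step) 0 1
  (smooth_continuous (smooth_deriven _ smooth_step)) (@derive_step_out n).
exists (C + Q) => [|i x]; first exact: addr_ge0.
rewrite leq_eqVlt => /predU1P[->|/hC h]; last by rewrite (le_trans (h x))// lerDl.
rewrite (le_trans (hQ x))// -[leLHS]add0r lerD//.
by rewrite ler_piMr// oneDsqrV_le1.
Qed.

End SmoothStep.

(** * Schwartz functions and test functions *)

Section RealSchwartz.
Context {R : realType}.
Implicit Types (f g h : R -> R) (x y z t a b c d e r s M : R) (K k n : nat).
Local Notation mu := (@lebesgue_measure R).

Definition rbound K f r : Prop :=
  forall k n x, (k <= K)%N -> (n <= K)%N -> `|x ^+ k * Dn n f x| <= r.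

Record rschwartz f : Prop := RSchwartz {
  rschwartz_smooth : smooth f;
  rschwartz_bound : forall K, exists M, rbound K f M }.

Record testfun a b f : Prop := Testfun {
  testfun_smooth : smooth f;
  testfun_out : forall x, ~~ (a <= x <= b) -> f x = 0 }.

Lemma rbound_ge0 K f r : rbound K f r -> 0 <= r.
Proof. by move=> /(_ 0%N 0%N 0 isT isT); exact: le_trans. Qed.

Lemma rboundW K K' f r r' : (K' <= K)%N -> r <= r' -> rbound K f r -> rbound K' f r'.
Proof.
move=> KK rr fr k n x kK nK; apply: le_trans rr.
by apply: fr; [exact: leq_trans KK|exact: leq_trans KK].
Qed.

Lemma rbound_lin K a f g r s : smooth f -> smooth g -> rbound K f r ->
  rbound K g s -> rbound K (fun x => a * f x + g x) (`|a| * r + s).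
Proof.
move=> sf sg fr gs k n x kK nK; rewrite derive1n_lin// mulrDr.
rewrite (le_trans (ler_normD _ _))// lerD//; last exact: gs.
by rewrite mulrCA normrM ler_wpM2l//; exact: fr.
Qed.

Lemma rbound_derive K f r : rbound K.+1 f r -> rbound K (D1 f) r.
Proof.
by move=> fr k n x kK nK; rewrite -derive1Sn; apply: fr => //; exact: leqW.
Qed.

Lemma rschwartz_lin a f g : rschwartz f -> rschwartz g ->
  rschwartz (fun x => a * f x + g x).
Proof.
move=> [sf bf] [sg bg]; split=> [|K]; first exact: smooth_lin.
have [M fM] := bf K; have [N gN] := bg K.
by exists (`|a| * M + N); exact: rbound_lin.
Qed.

Lemma rschwartz_derive f : rschwartz f -> rschwartz (D1 f).
Proof.
move=> [sf bf]; split=> [|K]; first exact: smooth_derive.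
by have [M fM] := bf K.+1; exists M; exact: rbound_derive.
Qed.

Lemma rschwartz_pointwise f : smooth f ->
  (forall k n, exists M, forall x, `|x ^+ k * Dn n f x| <= M) -> rschwartz f.
Proof.
move=> sf H; split=> // K.
have /choice[m hm] : forall p : nat * nat,
    exists M, forall x, `|x ^+ p.1 * Dn p.2 f x| <= M by move=> [k n]; exact: H.
exists (\sum_(k < K.+1) \sum_(n < K.+1) m (nat_of_ord k, nat_of_ord n)) => k n x kK nK.
have m0 p : 0 <= m p by rewrite (le_trans _ (hm p 0)).
rewrite (bigD1 (Ordinal (kK : (k < K.+1)%N)))//= (bigD1 (Ordinal (nK : (n < K.+1)%N)))//=.
rewrite -addrA (le_trans (hm (k, n) x))// lerDl addr_ge0//.
  by rewrite sumr_ge0.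
by rewrite sumr_ge0// => i _; rewrite sumr_ge0.
Qed.

Lemma near_eq_derive1n f g x n : (\forall y \near x, f y = g y) ->
  \forall y \near x, Dn n f y = Dn n g y.
Proof.
elim: n => // n IHn fg; have := near_join (IHn fg); apply: filterS => y Hy.
rewrite !derive1nS !derive1E; exact: near_eq_derive.
Qed.

Lemma derive1n_near_eq f g x n : (\forall y \near x, f y = g y) ->
  Dn n f x = Dn n g x.
Proof. by move=> /(near_eq_derive1n n) /nbhs_singleton. Qed.

Lemma derive1n_cst0 n : Dn n (fun=> 0 : R) = (fun=> 0).
Proof.
by elim: n => // n IHn; rewrite derive1nS IHn; apply/funext => x; rewrite derive1_cst.
Qed.

Lemma derive1n_eq0 f x n : (\forall y \near x, f y = 0) -> Dn n f x = 0.
Proof. by move=> /(@derive1n_near_eq f (fun=> 0) x n) ->; rewrite derive1n_cst0. Qed.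

Lemma derive1n_lt0 f x b n : (forall y, y < b -> f y = 0) -> x < b -> Dn n f x = 0.
Proof.
move=> f0 xb; apply: derive1n_eq0; near=> y; apply: f0.
by near: y; exact: lt_nbhsl.
Unshelve. all: by end_near. Qed.

Lemma derive1n_gt0 f x b n : (forall y, b < y -> f y = 0) -> b < x -> Dn n f x = 0.
Proof.
move=> f0 xb; apply: derive1n_eq0; near=> y; apply: f0.
by near: y; exact: lt_nbhsr.
Unshelve. all: by end_near. Qed.

Lemma smooth_vanish_left f b : smooth f -> (forall y, y < b -> f y = 0) ->
  forall n, Dn n f b = 0.
Proof.
move=> sf f0 n.
have cf := smooth_continuous (smooth_deriven n sf).
have h : Dn n f x @[x --> b^'-] --> Dn n f b by apply: cvg_at_left_filter; exact: cf.
apply: (cvg_unique _ h) => //; apply: cvg_near_cst.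
by near=> y; rewrite (@derive1n_lt0 f y b).
Unshelve. all: by end_near. Qed.

Lemma testfun_derive a b f : testfun a b f -> testfun a b (D1 f).
Proof.
move=> [sf f0]; split=> [|x]; first exact: smooth_derive.
rewrite negb_and -!ltNge => /orP[xa|bx].
- apply: (@derive1n_lt0 f x a 1) => // y ya.
  by rewrite f0// negb_and -!ltNge ya.
- apply: (@derive1n_gt0 f x b 1) => // y ya.
  by rewrite f0// negb_and -!ltNge ya orbT.
Qed.

Lemma testfun_deriven n a b f : testfun a b f -> testfun a b (Dn n f).
Proof. by move=> tf; elim: n => // n IHn; rewrite derive1nS; exact: testfun_derive. Qed.

Lemma testfunW a b a' b' f : a' <= a -> b <= b' -> testfun a b f -> testfun a' b' f.
Proof.
move=> aa bb [sf f0]; split=> // x xo; apply: f0; apply: contra xo.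
by move=> /andP[? ?]; rewrite (le_trans aa)//= (le_trans _ bb).
Qed.

Lemma testfun_mull a b f g : smooth g -> testfun a b f ->
  testfun a b (fun x => g x * f x).
Proof.
move=> sg [sf f0]; split=> [|x xab]; first exact: smooth_mul.
by rewrite f0// mulr0.
Qed.

Lemma testfun_rschwartz a b f : testfun a b f -> rschwartz f.
Proof.
move=> tf; apply: rschwartz_pointwise => [|k n]; first by case: tf.
have [sg g0] := testfun_deriven n tf.
have [|x xo|Q Q0 hQ] := @cpt_decay R (fun x => x ^+ k * Dn n f x) a b.
- move=> x; apply: cvgM; last exact: smooth_continuous.
  by apply: exprn_continuous.
- by rewrite g0// mulr0.
by exists Q => x; rewrite (le_trans (hQ x))// ler_piMr// oneDsqrV_le1.
Qed.

Lemma testfun_bound a b f : testfun a b f -> exists2 M, 0 <= M & forall x, `|f x| <= M.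
Proof.
move=> tf; have [_ /(_ 0%N)[M fM]] := testfun_rschwartz tf.
exists M; first exact: rbound_ge0 fM.
by move=> x; have := fM 0%N 0%N x isT isT; rewrite mul1r.
Qed.

(** At a fixed x the weight is a constant: if it is not 0, it is divided out of the bound on f and
    [product_bound] applies at x. *)
Lemma weighted_product_bound K k n g f x A r : smooth g -> smooth f ->
  (n <= K)%N -> 0 <= A -> 0 <= r ->
  (forall i, (i <= K)%N -> `|Dn i g x| <= A) ->
  (forall i, (i <= K)%N -> `|x ^+ k * Dn i f x| <= r) ->
  `|x ^+ k * Dn n (fun y => g y * f y) x| <= 2 ^+ K * (A * r).
Proof.
move=> sg sf nK A0 r0 gA fr.
have [->|xk] := eqVneq (x ^+ k) 0.
  by rewrite mul0r normr0 !mulr_ge0// exprn_ge0.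
have xk0 : 0 < `|x ^+ k| by rewrite normr_gt0.
rewrite normrM mulrC -ler_pdivlMr// (le_trans (@product_bound _ n g f A (r / `|x ^+ k|) x _ _ _ _ _))//.
- by move=> i iln; apply: gA; exact: leq_trans nK.
- move=> i iln; rewrite ler_pdivlMr// mulrC -normrM.
  by apply: fr; exact: leq_trans nK.
- rewrite -!mulrA ler_pM// ?mulr_ge0 ?divr_ge0 ?exprn_ge0//.
  by rewrite ler_eXn2l// ltr1n.
Qed.

Lemma rbound_mul K g f A r : smooth g -> smooth f -> 0 <= A ->
  (forall i x, (i <= K)%N -> `|Dn i g x| <= A) -> rbound K f r ->
  rbound K (fun y => g y * f y) (2 ^+ K * (A * r)).
Proof.
move=> sg sf A0 gA fr k n x kK nK.
apply: weighted_product_bound => //; first exact: rbound_ge0 fr.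
  by move=> i iK; exact: gA.
by move=> i iK; exact: fr.
Qed.

Definition plateau c d x : R := step (1 * x - c) * step (-1 * x + d).

Lemma smooth_plateau c d : smooth (plateau c d).
Proof. by apply: smooth_mul; apply: smooth_affine; exact: smooth_step. Qed.

Lemma plateau_out c d x : ~~ (c <= x <= d) -> plateau c d x = 0.
Proof.
rewrite /plateau negb_and -!ltNge => /orP[xc|xd].
  by rewrite step_eq0 ?mul0r//; lra.
by rewrite [X in _ * X]step_eq0 ?mulr0//; lra.
Qed.

Lemma plateau_eq1 c d x : c + 1 <= x <= d - 1 -> plateau c d x = 1.
Proof. by move=> /andP[? ?]; rewrite /plateau !step_eq1 ?mulr1//; lra. Qed.

Lemma affine_step_bound n : exists2 C, 0 <= C &
  forall a b i x, `|a| <= 1 -> (i <= n)%N ->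
  `|Dn i (fun y => step (a * y + b)) x| <= C.
Proof.
have [C C0 hC] := @derive_step_bound R n; exists C => // a b i x a1 lin.
rewrite derive1n_affine; last exact: smooth_step.
rewrite normrM normrX (le_trans _ (hC i (a * x + b) lin))//.
by rewrite ler_piMl// exprn_ile1.
Qed.

(** The parameters c and d only translate the two steps, so the bound is uniform in them; the
    cut-offs below need this as their plateau widens. *)
Lemma plateau_bound n : exists2 C, 0 <= C & forall c d i x, (i <= n)%N ->
  `|Dn i (plateau c d) x| <= C.
Proof.
have [C C0 hC] := affine_step_bound n.
exists (2 ^+ n * (C * C)) => [|c d i x lin]; first by rewrite !mulr_ge0// exprn_ge0.
rewrite (le_trans (@product_bound _ i _ _ C C x _ _ _ _ _))//.
- by apply: smooth_affine; exact: smooth_step.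
- by apply: smooth_affine; exact: smooth_step.
- by move=> j ji; apply: hC; [rewrite normr1|exact: leq_trans lin].
- by move=> j ji; apply: hC; [rewrite normrN normr1|exact: leq_trans lin].
- by rewrite ler_wpM2r ?mulr_ge0// ler_eXn2l// ltr1n.
Qed.

Definition cutoff rho f x : R := plateau (- rho - 1) (rho + 1) x * f x.

Lemma testfun_cutoff rho f : smooth f -> testfun (- rho - 1) (rho + 1) (cutoff rho f).
Proof.
move=> sf; split=> [|x xo]; first by apply: smooth_mul => //; exact: smooth_plateau.
by rewrite /cutoff plateau_out ?mul0r.
Qed.

(** The error lives on |x| >= rho, where one spare power of x, paid for by the seminorm of index K +
    1, gains a factor 1 / rho. *)
Lemma cutoff_approx K f : rschwartz f -> forall e, 0 < e -> exists2 rho, 0 < rho &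
  rbound K (fun x => (-1) * cutoff rho f x + f x) e.
Proof.
move=> [sf bf] e e0; have [M fM] := bf K.+1.
have [C C0 hC] := plateau_bound K.
pose Q := 2 ^+ K * ((1 + C) * M).
have M0 := rbound_ge0 fM.
have Q0 : 0 <= Q by rewrite !mulr_ge0 ?exprn_ge0// addr_ge0.
exists (Q / e + 1) => [|k n x kK nK]; first by rewrite ltr_wpDl// divr_ge0// ltW.
set rho := Q / e + 1.
have rho0 : 0 < rho by rewrite ltr_wpDl// divr_ge0// ltW.
pose g y := (-1) * plateau (- rho - 1) (rho + 1) y + 1.
have sg : smooth g by apply: smooth_lin; [exact: smooth_plateau|exact: smooth_cst].
have -> : (fun y => (-1) * cutoff rho f y + f y) = (fun y => g y * f y).
  by apply/funext => y; rewrite /cutoff /g; ring.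
have [xr|rx] := ltP `|x| rho.
  rewrite derive1n_eq0 ?mulr0 ?normr0 ?(ltW e0)//.
  move: xr; rewrite ltr_norml => /andP[x1 x2].
  near=> y; rewrite /g plateau_eq1 ?mulr1 ?addNr ?mul0r//.
  apply/andP; split.
    by rewrite addrNK; near: y; exact: lt_le_nbhsr.
  by rewrite addrK; near: y; exact: lt_le_nbhsl.
have x0 : 0 < `|x| by exact: lt_le_trans rx.
have -> : `|x ^+ k * Dn n (fun y => g y * f y) x| =
    `|x ^+ k.+1 * Dn n (fun y => g y * f y) x| / `|x|.
  by rewrite exprS -mulrA [in RHS]normrM [RHS]mulrC mulKf// gt_eqF.
rewrite ler_pdivrMr//.
apply: (@le_trans _ _ Q); last first.
  by rewrite mulrC -ler_pdivrMr// (le_trans _ rx)// lerDl.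
apply: weighted_product_bound => //; first by rewrite addr_ge0.
- move=> i iK; rewrite derive1n_lin; [|exact: smooth_plateau|exact: smooth_cst].
  rewrite (le_trans (ler_normD _ _))// addrC lerD//; last first.
    by rewrite normrM normrN normr1 mul1r hC.
  case: i {iK} => [|i]; first by rewrite /= normr1.
  by rewrite derive1Sn (_ : D1 _ = fun=> 0) ?derive1n_cst0 ?normr0//;
     apply/funext => y; rewrite derive1_cst.
- by move=> i iK; apply: fM => //; exact: leqW.
Unshelve. all: by end_near. Qed.

(** A cut at scale d costs d ^ (-K), but f is flat at 0, so on [0, 2d] Taylor's formula gains (2d) ^
    (K + 1); a factor d is left over. *)
Lemma origin_approx K f : rschwartz f -> (forall x, x <= 0 -> f x = 0) ->
  forall e, 0 < e -> exists2 d, 0 < d & exists g, [/\ rschwartz g,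
    (forall x, x <= d -> g x = 0) & rbound K (fun x => (-1) * g x + f x) e].
Proof.
move=> rf f0 e e0; have [sf bf] := rf.
(* Up to K derivatives from the seminorm, and K + 1 more spent on [taylor_vanish]. *)
have [M fM] := bf (K + K.+1)%N; have M0 := rbound_ge0 fM.
have [C C0 hC] := @derive_step_bound R K.
pose Q := 2 ^+ K * ((1 + C) * M) * 2 ^+ K.+1.
have Q0 : 0 <= Q by rewrite !mulr_ge0 ?exprn_ge0// addr_ge0.
(* The bound 1/2 gives x ^ k <= 1 on [0, 2d] and lets d ^ (-K) dominate the lower powers; the other
   one gives Q d <= e. *)
pose d := Num.min (2^-1) (e / (Q + 1)).
have d0 : 0 < d by rewrite lt_min invr_gt0 ltr0n divr_gt0// ltr_wpDl.
have d1 : d <= 2^-1 by rewrite ge_min lexx.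
have d2 : Q * d <= e.
  rewrite (@le_trans _ _ (Q * (e / (Q + 1))))//.
    by rewrite ler_wpM2l// ge_min lexx orbT.
  by rewrite mulrCA ler_piMr ?(ltW e0)// ler_pdivrMr ?mul1r ?lerDl// ltr_wpDl.
pose h y := step (d^-1 * y + -1).
have sh : smooth h by apply: smooth_affine; exact: smooth_step.
have dn0 : d != 0 by rewrite gt_eqF.
have hh i x : (i <= K)%N -> `|Dn i h x| <= d ^- K * C.
  move=> iK; rewrite derive1n_affine; last exact: smooth_step.
  rewrite normrM ler_pM// ?hC// -exprVn normrX.
  rewrite ger0_norm ?invr_ge0 ?(ltW d0)// ler_weXn2l//.
  by rewrite invf_ge1// (le_trans d1)// invf_le1// ler1n.
exists d => //; exists (fun x => h x * f x); split.
- split=> [|K']; first exact: smooth_mul.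
  have [C' C'0 hC'] := @derive_step_bound R K'.
  have [M' fM'] := bf K'.
  exists (2 ^+ K' * ((d ^- K' * C') * M')); apply: rbound_mul => //.
    by rewrite mulr_ge0// invr_ge0 exprn_ge0// ltW.
  move=> i x iK; rewrite derive1n_affine; last exact: smooth_step.
  rewrite normrM ler_pM// ?hC'// -exprVn normrX.
  rewrite ger0_norm ?invr_ge0 ?(ltW d0)// ler_weXn2l//.
  by rewrite invf_ge1// (le_trans d1)// invf_le1// ler1n.
- move=> x xd; rewrite /h step_eq0 ?mul0r// subr_le0.
  by rewrite mulrC ler_pdivrMr// mul1r.
move=> k n x kK nK.
pose g y := (-1) * h y + 1.
have sg : smooth g by apply: smooth_lin => //; exact: smooth_cst.
have -> : (fun y => (-1) * (h y * f y) + f y) = (fun y => g y * f y).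
  by apply/funext => y; rewrite /g; ring.
have [x0|x0] := ltP x 0.
  rewrite (@derive1n_lt0 _ x 0) ?mulr0 ?normr0 ?(ltW e0)//.
  by move=> y /ltW y0; rewrite f0// mulr0.
have [xd|xd] := ltP (d *+ 2) x.
  rewrite (@derive1n_gt0 _ x (d *+ 2)) ?mulr0 ?normr0 ?(ltW e0)//.
  move=> y yd; rewrite /g /h step_eq1 ?mulr1 ?addNr ?mul0r//.
  by rewrite lerBrDr mulrC ler_pdivlMr// mulrDl mul1r -mulr2n ltW.
have D0 i : Dn i f 0 = 0.
  by apply: smooth_vanish_left => // y /ltW; exact: f0.
have xk : `|x ^+ k| <= 1.
  rewrite normrX ger0_norm// exprn_ile1// (le_trans xd)//.
  by rewrite -mulr_natr -ler_pdivlMr ?ltr0n// div1r.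
rewrite normrM -[leRHS]mul1r ler_pM// (le_trans _ d2)//.
rewrite (le_trans (@product_bound _ n g f ((1 + C) * d ^- K) ((d *+ 2) ^+ K.+1 * M) x _ _ _ _ _))//.
- by rewrite mulr_ge0 ?addr_ge0// invr_ge0 exprn_ge0// ltW.
- move=> i lin; have iK := leq_trans lin nK.
  rewrite derive1n_lin; [|exact: sh|exact: smooth_cst].
  rewrite (le_trans (ler_normD _ _))// addrC mulrDl lerD//; last first.
    by rewrite normrM normrN normr1 mul1r mulrC hh.
  case: i {lin iK} => [|i].
    rewrite /= normr1 mul1r invf_ge1 ?exprn_gt0// exprn_ile1// ?(ltW d0)//.
    by rewrite (le_trans d1)// invf_le1// ler1n.
  rewrite derive1Sn (_ : D1 _ = fun=> 0).
    by rewrite derive1n_cst0 normr0 mulr_ge0// invr_ge0 exprn_ge0// ltW.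
  by apply/funext => y; rewrite derive1_cst.
- move=> i lin; have iK := leq_trans lin nK.
  rewrite (@le_trans _ _ (x ^+ K.+1 * M))//.
    apply: taylor_vanish => // y _.
    have := fM 0%N (i + K.+1)%N y isT; rewrite mul1r; apply.
    by rewrite leq_add2r.
  by rewrite ler_wpM2r// lerXn2r ?nnegrE// mulrn_wge0// ltW.
have -> : Q * d = 2 ^+ K * ((1 + C) * d ^- K * ((d *+ 2) ^+ K.+1 * M)).
  rewrite /Q -[d *+ 2]mulr_natr exprMn (exprS d) ; field.
  by rewrite expf_neq0.
rewrite ler_wpM2r//; last by rewrite ler_eXn2l// ltr1n.
rewrite !mulr_ge0 ?addr_ge0// ?invr_ge0 ?exprn_ge0 ?mulrn_wge0 ?(ltW d0)//.
Qed.

Lemma positive_approx K f : rschwartz f -> (forall x, x <= 0 -> f x = 0) ->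
  forall e, 0 < e -> exists a b g, [/\ 0 < a, a < b, testfun a b g &
    rbound K (fun x => (-1) * g x + f x) e].
Proof.
move=> rf f0 e e0; have e2 : 0 < e / 2 by rewrite divr_gt0.
have [d d0 [g [rg g0 gf]]] := origin_approx K rf f0 e2.
have [rho rho0 hg] := cutoff_approx K rg e2.
have sg := rschwartz_smooth rg; have sf := rschwartz_smooth rf.
have [sc c0] := testfun_cutoff rho sg.
(* The constants 1 and 2 only secure a < b. *)
exists (Num.min d 1), (Num.max (rho + 1) 2), (cutoff rho g); split.
- by rewrite lt_min d0 ltr01.
- by rewrite (@le_lt_trans _ _ 1) ?ge_min ?lexx ?orbT// lt_max ltr1n orbT.
- split=> // x; rewrite negb_and -!ltNge => /orP[xd|xr].
    rewrite /cutoff g0 ?mulr0// ltW// (lt_le_trans xd)//.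
    by rewrite ge_min lexx.
  rewrite c0// negb_and -!ltNge; apply/orP; right.
  by rewrite (le_lt_trans _ xr)// le_max lexx.
- have := rbound_lin 1 (smooth_lin (-1) sc sg) (smooth_lin (-1) sg sf) hg gf.
  rewrite normr1 mul1r -splitr.
  by congr rbound; apply/funext => x; ring.
Qed.

End RealSchwartz.

(** * Decaying antiderivatives of Schwartz functions *)

Section Antiderivatives.
Context {R : realType}.
Implicit Types (f g h F G : R -> R) (x y z t a b c d e r s M : R) (K k n : nat).

(** Two spare powers of t buy the factor 1 + t^2, at the price of two terms bounded by r. *)
Lemma rbound_decay K k f r t : (k <= K)%N -> rbound K.+2 f r ->
  `|t ^+ k * f t| <= (2 * r) * (oneDsqr t)^-1.
Proof.
move=> kK fr; rewrite ler_pdivlMr ?(lt_le_trans _ (oneDsqr_ge1 _))//.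
rewrite /oneDsqr mulrDr mulr1 mulr_natl mulr2n lerD//.
  by apply: (fr k 0%N t) => //; rewrite ltnW// ltnS leqW.
rewrite -[t ^+ 2]ger0_norm ?sqr_ge0// -normrM mulrAC -exprD addn2.
exact: (fr k.+2 0%N t).
Qed.

(** The integral of f over [x, oo[, written as a reflection so that the facts on [lprim] carry
    over. *)
Definition tailint f x : R := lprim (fun t => f (-1 * t + 0)) (-1 * x + 0).

Lemma oneDsqrN t : oneDsqr (-1 * t + 0) = oneDsqr t :> R.
Proof. by rewrite /oneDsqr addr0 mulN1r sqrrN. Qed.

Lemma reflect_decay f r t : rbound 2 f r ->
  `|f (-1 * t + 0)| <= (2 * r) * (oneDsqr t)^-1.
Proof.
move=> fr; rewrite -oneDsqrN.
by have := @rbound_decay 0 0 f r (-1 * t + 0) isT fr; rewrite mul1r.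
Qed.

Lemma smooth_tailint f : rschwartz f -> smooth (tailint f) /\
  D1 (tailint f) = (fun x => - f x).
Proof.
move=> [sf bf]; have [r fr] := bf 2%N.
have [sF dF] := smooth_lprim (smooth_affine (-1) 0 sf) (fun t => reflect_decay t fr).
split; first exact: smooth_affine.
have [_ ->] := derive1_affine (-1) 0 (sF 0%N).
by apply/funext => x; rewrite dF addr0 mulN1r; congr (- f _); ring.
Qed.

Lemma tailint_bound f r x : rschwartz f -> rbound 2 f r ->
  `|tailint f x| <= 2 * r * pi.
Proof.
move=> [sf _] fr; have r0 := rbound_ge0 fr.
have [] := @decay_integral R `]-oo, (-1 * x + 0)] (fun t => f (-1 * t + 0)) (2 * r).
- exact: measurable_itv.
- apply: measurable_funTS; apply: continuous_measurable_fun.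
  by apply: smooth_continuous; exact: smooth_affine.
- by move=> t _; exact: reflect_decay.
by move=> _; rewrite [`|2 * r|]ger0_norm ?mulr_ge0.
Qed.

Lemma tailint_weight f r k x : rschwartz f -> 0 <= x -> rbound k.+2 f r ->
  `|x ^+ k * tailint f x| <= 2 * r * pi.
Proof.
move=> [sf _] x0 fr; have r0 := rbound_ge0 fr.
have -> : `|x ^+ k * tailint f x| = `|(-1 * x + 0) ^+ k * tailint f x|.
  by rewrite addr0 mulN1r !normrM !normrX normrN.
rewrite -[2 * r]ger0_norm ?mulr_ge0//; apply: lprim_weight; last 2 first.
- by rewrite addr0 mulN1r oppr_le0.
- move=> t t0; rewrite -oneDsqrN.
  have -> : `|t ^+ k * f (-1 * t + 0)| = `|(-1 * t + 0) ^+ k * f (-1 * t + 0)|.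
    by rewrite !normrM !normrX addr0 mulN1r normrN.
  exact: rbound_decay fr.
- by apply: smooth_continuous; exact: smooth_affine.
Qed.

(** F - G is constant, and x (F - G) stays bounded as x grows only if that constant is 0. Linearity
    of [tailint] and its effect on derivatives follow from this without computing integrals. *)
Lemma tail_unique F G M N : smooth F -> smooth G -> D1 F = D1 G ->
  (forall x, 0 <= x -> `|x * F x| <= M) -> (forall x, 0 <= x -> `|x * G x| <= N) ->
  F = G.
Proof.
move=> sF sG FG FM GN.
pose H x := (-1) * G x + F x.
have sH : smooth H by exact: smooth_lin.
have dH x : is_derive x 1 H 0.
  have := smooth_is_derive x sH; rewrite /H.
  have [_ ->] := derive1_lin (-1) (sG 0%N) (sF 0%N).
  by rewrite FG mulN1r addNr.
have cH x y : H x = H y.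
  wlog xy : x y / x <= y.
    by have [xy|/ltW xy] := leP x y => hw; [exact: hw|apply/esym/hw].
  by apply/esym; apply: is_derive0_const xy => z _.
have H0 : H 0 = 0.
  apply/eqP; rewrite -normr_le0 leNgt; apply/negP => h0.
  have MN : 0 <= M + N.
    rewrite addr_ge0//.
      by apply: le_trans (FM 0 (lexx 0)).
    by apply: le_trans (GN 0 (lexx 0)).
  (* The point where |x H| would equal M + N + 1, beyond the bound M + N. *)
  pose x := (M + N + 1) / `|H 0|.
  have x0 : 0 <= x by rewrite divr_ge0// addr_ge0.
  have : `|x * H x| <= M + N.
    rewrite /H mulrDr mulN1r mulrN addrC (le_trans (ler_normB _ _))// lerD//.
      exact: FM.
    exact: GN.
  rewrite (cH x 0) normrM (ger0_norm x0) /x divfK ?gt_eqF//.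
  by rewrite leNgt ltrDl ltr01.
apply/funext => x; apply/eqP; rewrite -subr_eq0 addrC -mulN1r; apply/eqP.
by rewrite -H0; exact: cH.
Qed.

Lemma tail_weight1 f : rschwartz f -> exists M, forall x, 0 <= x -> `|x * f x| <= M.
Proof.
move=> [_ /(_ 1%N)[M fM]]; exists M => x _.
by have := fM 1%N 0%N x isT isT; rewrite expr1.
Qed.

Lemma tailint_weight1 f : rschwartz f ->
  exists M, forall x, 0 <= x -> `|x * tailint f x| <= M.
Proof.
move=> rf; have [_ /(_ 3%N)[r fr]] := rf; exists (2 * r * pi) => x x0.
by have := @tailint_weight f r 1 x rf x0 fr; rewrite expr1.
Qed.

Lemma tailint_lin a f g : rschwartz f -> rschwartz g ->
  tailint (fun x => a * f x + g x) = (fun x => a * tailint f x + tailint g x).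
Proof.
move=> rf rg; have rh := rschwartz_lin a rf rg.
have [sf df] := smooth_tailint rf; have [sg dg] := smooth_tailint rg.
have [sh dh] := smooth_tailint rh.
have [M fM] := tailint_weight1 rf; have [N gN] := tailint_weight1 rg.
have [P hP] := tailint_weight1 rh.
apply: (@tail_unique _ _ P (`|a| * M + N)) => //; first exact: smooth_lin.
  have [_ ->] := derive1_lin a (sf 0%N) (sg 0%N).
  by rewrite df dg dh; apply/funext => x; ring.
move=> x x0; rewrite mulrDr (le_trans (ler_normD _ _))// lerD//; last exact: gN.
by rewrite mulrCA normrM ler_wpM2l// fM.
Qed.

Lemma tailint_derive f : rschwartz f -> tailint (D1 f) = (fun x => -1 * f x + 0).
Proof.
move=> rf; have rd := rschwartz_derive rf.
have [sd dd] := smooth_tailint rd; have sf := rschwartz_smooth rf.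
have [M dM] := tailint_weight1 rd; have [N fN] := tail_weight1 rf.
apply: (@tail_unique _ _ M N) => //.
- by apply: smooth_lin => //; exact: smooth_cst.
- have [_ ->] := derive1_lin (-1) (sf 0%N) (smooth_cst 0 0%N).
  by rewrite dd; apply/funext => x; rewrite derive1_cst addr0 mulN1r.
- by move=> x x0; rewrite addr0 mulN1r mulrN normrN fN.
Qed.

Lemma tailint_eq0 f b x : (forall t, b <= t -> f t = 0) -> b <= x -> tailint f x = 0.
Proof.
move=> f0 bx; apply: lprim_eq0 => t tx; apply: f0; apply: le_trans bx _; lra.
Qed.

Definition chi x : R := step (1 * x + 2).

Lemma smooth_chi : smooth chi.
Proof. by apply: smooth_affine; exact: smooth_step. Qed.

Lemma chi_eq0 x : x <= - 2 -> chi x = 0.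
Proof. by move=> ?; rewrite /chi step_eq0//; lra. Qed.

Lemma chi_eq1 x : - 1 <= x -> chi x = 1.
Proof. by move=> ?; rewrite /chi step_eq1//; lra. Qed.

Lemma chi_bound n : exists2 C, 0 <= C & forall i x, (i <= n)%N -> `|Dn i chi x| <= C.
Proof.
have [C C0 hC] := @affine_step_bound R n; exists C => // i x lin.
by apply: hC; rewrite ?normr1.
Qed.

(* chi is 1 near [0, +oo[, where prim f is therefore the primitive of - f that
   decays at +oo; chi only ensures the decay at -oo. *)
Definition prim f x : R := chi x * tailint f x.

Lemma smooth_prim f : rschwartz f -> smooth (prim f).
Proof.
by move=> /smooth_tailint[? _]; apply: smooth_mul => //; exact: smooth_chi.
Qed.

Lemma prim_bound K : exists2 C, 0 <= C & forall f r, rschwartz f ->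
  rbound K.+2 f r -> rbound K (prim f) (C * r).
Proof.
have [C C0 hC] := chi_bound K.
(* 2 ^ K covers the weight on [-2, 0], 2 pi the integral, and the summand 1 the derivatives, which
   fall back on f itself. *)
have [A AE] : exists A : R, A = 2 ^+ K * (2 * pi + 1) by eexists.
have A0 : 0 <= A by rewrite AE mulr_ge0 ?exprn_ge0// addr_ge0// mulr_ge0// pi_ge0.
exists (2 ^+ K * (C * A)) => [|f r rf fr].
  by apply: mulr_ge0; [exact: exprn_ge0|exact: mulr_ge0].
move=> k n x kK nK; have r0 := rbound_ge0 fr.
have [sF dF] := smooth_tailint rf.
have [x2|x2] := ltP x (- 2).
  rewrite (@derive1n_lt0 _ _ x (-2)) ?mulr0 ?normr0//.
    by apply: mulr_ge0 => //; apply: mulr_ge0; [exact: exprn_ge0|exact: mulr_ge0].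
  by move=> y /ltW y2; rewrite /prim chi_eq0 ?mul0r.
rewrite -!mulrA; apply: weighted_product_bound => //.
- exact: smooth_chi.
- by rewrite mulr_ge0.
- by move=> i iK; exact: hC.
rewrite AE; have p2 : 1 <= 2 ^+ K :> R by rewrite exprn_ege1// ler1n.
move=> [|i] iK.
  have [x0|x0] := leP 0 x.
    rewrite (@le_trans _ _ (2 * r * pi))//.
      apply: tailint_weight => //; apply: rboundW fr => //.
    rewrite mulrAC ler_wpM2r// -[leLHS]mul1r ler_pM ?mulr_ge0 ?pi_ge0//.
    by rewrite lerDl.
  rewrite normrM -mulrA ler_pM//.
    rewrite normrX (@le_trans _ _ (2 ^+ k))//.
      by rewrite lerXn2r ?nnegrE// ltr0_norm// lerNl.
    by rewrite ler_weXn2l// ler1n.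
  rewrite (le_trans (tailint_bound x rf (rboundW _ (lexx r) fr)))//.
  by rewrite mulrAC ler_wpM2r// lerDl.
rewrite derive1Sn dF.
have -> : (fun x => - f x) = (fun x => -1 * f x + 0).
  by apply/funext => y; rewrite mulN1r addr0.
rewrite derive1n_lin; [|exact: rschwartz_smooth|exact: smooth_cst].
rewrite derive1n_cst0 addr0 mulN1r mulrN normrN.
apply: (@le_trans _ _ r).
  by apply: fr; rewrite !leqW// ltnW.
by rewrite ler_peMl// mulr_ege1// lerDr mulr_ge0// pi_ge0.
Qed.

Lemma prim_rschwartz f : rschwartz f -> rschwartz (prim f).
Proof.
move=> rf; split=> [|K]; first exact: smooth_prim.
have [C C0 hC] := prim_bound K; have [_ /(_ K.+2)[r fr]] := rf.
by exists (C * r); exact: hC.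
Qed.

Lemma prim_lin a f g : rschwartz f -> rschwartz g ->
  prim (fun x => a * f x + g x) = (fun x => a * prim f x + prim g x).
Proof.
by move=> rf rg; apply/funext => x; rewrite /prim tailint_lin//; ring.
Qed.

Lemma prim_derive f : rschwartz f -> prim (D1 f) = (fun x => -1 * (chi x * f x) + 0).
Proof.
by move=> rf; apply/funext => x; rewrite /prim tailint_derive//; ring.
Qed.

Lemma prim_eq0 f b x : (forall t, b <= t -> f t = 0) -> b <= x -> prim f x = 0.
Proof. by move=> f0 bx; rewrite /prim (tailint_eq0 f0)// mulr0. Qed.

Lemma derive_prim f : rschwartz f ->
  D1 (prim f) = (fun x => D1 chi x * tailint f x - chi x * f x).
Proof.
move=> rf; have [sF dF] := smooth_tailint rf.
have [_ ->] := derive1_mul (smooth_chi 0%N) (sF 0%N).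
by rewrite dF; apply/funext => x; rewrite mul1r mulrN addrC.
Qed.

Lemma testfun_antiderivative a b f M : a <= b -> testfun a b f ->
  (forall x, `|f x| <= M) -> exists F, [/\ smooth F, D1 F = f,
    forall x, x <= a -> F x = 0, forall x, b <= x -> F x = F b &
    forall x, `|F x| <= M * (b - a)].
Proof.
move=> ab [sf f0] fM.
have [Q _ fQ] := cpt_decay (smooth_continuous sf) f0.
have [sF dF] := smooth_lprim sf fQ.
have F0 x : x <= a -> lprim f x = 0.
  rewrite le_eqVlt => /predU1P[->|xa]; last first.
    apply: lprim_eq0 => t tx; apply: f0.
    by rewrite negb_and -!ltNge (le_lt_trans tx xa).
  apply: lprim_eq0 => t; rewrite le_eqVlt => /predU1P[->|ta]; last first.
    by apply: f0; rewrite negb_and -!ltNge ta.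
  by have := @smooth_vanish_left R f a sf _ 0%N; apply => y ya; apply: f0; rewrite negb_and -!ltNge ya.
have Fb x : b <= x -> lprim f x = lprim f b.
  apply: is_derive0_const => z /andP[bz _].
  have := smooth_is_derive z sF; rewrite dF.
  suff -> : f z = 0 by [].
  move: bz; rewrite le_eqVlt => /predU1P[<-|bz]; last first.
    by apply: f0; rewrite negb_and -!ltNge bz orbT.
  (* At the right end b, f vanishes by [smooth_vanish_left] applied to the reflected function at -
     b. *)
  have sr : smooth (fun y => f (-1 * y + 0)) by exact: smooth_affine.
  have := @smooth_vanish_left R _ (- b) sr _ 0%N; rewrite /= mulN1r opprK addr0; apply.
  move=> y yb; apply: f0; rewrite negb_and -!ltNge; apply/orP; right; lra.
exists (lprim f); split=> // x.
have M0 : 0 <= M by rewrite (le_trans _ (fM 0)).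
have B y : a <= y <= b -> `|lprim f y| <= M * (b - a).
  move=> /andP[ay yb].
  have := @mvt_bound R (lprim f) f a y M ay.
  rewrite (F0 a)// subr0 => h; apply: (le_trans (h _ _)) => //.
    by move=> z _; have := smooth_is_derive z sF; rewrite dF.
  by rewrite ler_wpM2l// lerB.
have [xa|/ltW ax] := leP x a.
  by rewrite F0// normr0 mulr_ge0// subr_ge0.
have [bx|/ltW xb] := leP b x; last by apply: B; rewrite ax.
by rewrite Fb// B// ab lexx.
Qed.

End Antiderivatives.

(** * Topology of the Schwartz space *)

Section Modulus.
Context {R : realType}.
Implicit Types (z w : R[i]) (x y r : R).

(** The norm of [R[i]] takes its values in [R[i]]; estimates are easier with a modulus in [R]. *)
Definition cmod z : R := Re `|z|.

Lemma cmodE z : `|z| = (cmod z)%:C.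
Proof. by rewrite /cmod normc_def. Qed.

Lemma cmod_le z r : (`|z| <= r%:C) = (cmod z <= r).
Proof. by rewrite cmodE lecR. Qed.

Lemma cmod_ge0 z : 0 <= cmod z.
Proof. by rewrite -lecR -cmodE normr_ge0. Qed.

Lemma cmodM z w : cmod (z * w) = cmod z * cmod w.
Proof. by apply: complexI; rewrite -cmodE normrM !cmodE rmorphM. Qed.

Lemma cmodD z w : cmod (z + w) <= cmod z + cmod w.
Proof. by rewrite -cmod_le rmorphD/= -!cmodE ler_normD. Qed.

Lemma cmodN z : cmod (- z) = cmod z.
Proof. by rewrite /cmod normrN. Qed.

Lemma cmod0 : cmod 0 = 0.
Proof. by rewrite /cmod normr0. Qed.

Lemma cmod1 : cmod 1 = 1.
Proof. by rewrite /cmod normr1. Qed.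

Lemma cmodV z : cmod z^-1 = (cmod z)^-1.
Proof. by apply: complexI; rewrite -cmodE normfV cmodE fmorphV. Qed.

Lemma cmod_eq0 z : (cmod z == 0) = (z == 0).
Proof. by rewrite -[RHS]normr_eq0 cmodE; apply/eqP/eqP => [->|[]]. Qed.

Lemma cmod_gt0 z : (0 < cmod z) = (z != 0).
Proof. by rewrite lt_def cmod_ge0 cmod_eq0 andbT. Qed.

Lemma cmod_real x : cmod x%:C = `|x|.
Proof. by rewrite /cmod normc_def/= expr0n/= addr0 sqrtr_sqr. Qed.

Lemma cmod_i : cmod 'i%C = 1 :> R.
Proof. by rewrite /cmod normc_def/= expr0n/= add0r expr1n sqrtr1. Qed.

Lemma Re_le_cmod z : `|Re z| <= cmod z.
Proof. by rewrite -lecR -cmodE normc_ge_Re. Qed.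

Lemma Im_le_cmod z : `|Im z| <= cmod z.
Proof. by have := Re_le_cmod (z * 'i%C); rewrite ReiNIm normrN cmodM cmod_i mulr1. Qed.

Lemma cmod_le_ReIm z : cmod z <= `|Re z| + `|Im z|.
Proof.
rewrite {1}(complexE z) (le_trans (cmodD _ _))// cmodM cmod_i mul1r.
by rewrite !cmod_real.
Qed.

End Modulus.

Section SchwartzTopology.
Context {R : realType}.
Implicit Types (u : schwartz R -> R[i]^o) (phi psi : schwartz R) (r : R) (K k n : nat).

Definition sbound K phi r : Prop :=
  forall k n x, (k <= K)%N -> (n <= K)%N -> cmod (jet k n phi x) <= r.

Lemma schwartzP phi : is_schwartz phi.
Proof. by have /asboolP := schwartz_funP phi. Qed.

Lemma jet_lin k n a phi psi x :
  jet k n (a *: phi + psi : schwartz R) x = a * jet k n phi x + jet k n psi x.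
Proof.
have [sp _] := schwartzP phi; have [sq _] := schwartzP psi.
rewrite /jet cderiven_lin// mulrDr; congr (_ + _).
by rewrite mulrCA.
Qed.

Lemma sbound_ge0 K phi r : sbound K phi r -> 0 <= r.
Proof. by move=> /(_ 0%N 0%N 0 isT isT); apply: le_trans; exact: cmod_ge0. Qed.

Lemma sboundW K K' phi r r' : (K' <= K)%N -> r <= r' ->
  sbound K phi r -> sbound K' phi r'.
Proof.
move=> KK rr fr k n x kK nK; apply: le_trans rr.
by apply: fr; [exact: leq_trans KK|exact: leq_trans KK].
Qed.

Lemma sbound_lin K a phi psi r s : sbound K phi r -> sbound K psi s ->
  sbound K (a *: phi + psi) (cmod a * r + s).
Proof.
move=> pr qs k n x kK nK; rewrite jet_lin (le_trans (cmodD _ _))// lerD ?qs//.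
by rewrite cmodM ler_wpM2l ?cmod_ge0// pr.
Qed.

Lemma sbound0 K : sbound K 0 0.
Proof.
move=> k n x _ _; have := jet_lin k n (-1) 0 0 x.
by rewrite scaler0 addr0 mulN1r addNr => ->; rewrite cmod0.
Qed.

Lemma sboundZ K a phi r : sbound K phi r -> sbound K (a *: phi) (cmod a * r).
Proof.
by move=> phir; have := sbound_lin a phir (@sbound0 K); rewrite !addr0.
Qed.

Definition sball phi K e : set (schwartz R) := [set psi | sbound K (psi - phi) e].

(** The topology is initial for a map into a pointwise product of uniform spaces, so convergence is
    tested on one jet at a time, and a uniform neighbourhood contains a ball. *)
Let jets_near (F : set_system (schwartz R)) phi : Filter F ->
  (forall K e, 0 < e -> F (sball phi K e)) -> F --> phi.
Proof.
move=> FF hF A [B [[C Cop <-] Cphi] sBA].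
have cF : (@schwartz_jets R) @ F --> schwartz_jets phi.
  apply/cvg_sup => -[k n] D [_ [[E Eop <-] Ephi] sED].
  have /uniform_nbhs[G [entG sGE]] : nbhs (jet k n phi : {uniform R -> R[i]^o}) E.
    by move: Eop; rewrite openE; apply.
  move: entG; rewrite -entourage_ballE => -[e e0 seG].
  (* The radius is an element of [R[i]]; being positive, it is real. *)
  have [d [d0 eE]] : exists d : R, 0 < d /\ e = d%:C.
    have : (0 : R[i]) < e by exact: e0.
    by case: (e) => x y; rewrite ltcE/= => /andP[/eqP -> x0]; exists x.
  have d2 : 0 < d / 2 by rewrite divr_gt0.
  rewrite /= /nbhs/=.
  apply: filterS (hF (maxn k n) (d / 2) d2) => psi hpsi.
  apply: sED; apply: sGE => y _; apply: seG; rewrite /= -ball_normE/= eE.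
  have := hpsi k n y (leq_maxl _ _) (leq_maxr _ _).
  rewrite -scaleN1r addrC jet_lin mulN1r -cmodN opprD opprK => h.
  by rewrite cmodE ltcR (le_lt_trans h)// ltr_pdivrMr// ltr_pMr// ltr1n.
have : nbhs (schwartz_jets phi) C by move: Cop; rewrite openE; apply.
move=> /cF FC; have {}FC : F (@schwartz_jets R @^-1` C) := FC.
by apply: filterS FC => psi; exact: sBA.
Qed.

Let nbhs_jet phi k n e : 0 < e -> nbhs phi
  [set psi : schwartz R | forall x, cmod (jet k n (psi - phi) x) < e].
Proof.
move=> e0.
have cj : {for phi, continuous (fun psi : schwartz R =>
    (schwartz_jets psi (k, n) : {uniform R -> R[i]^o}))}.
  apply: (@continuous_comp _ _ _ (@schwartz_jets R)
    (fun g : {ptws (nat * nat)%type -> {uniform R -> R[i]^o}} => g (k, n))).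
    exact: initial_continuous.
  exact: proj_continuous.
have : nbhs (schwartz_jets phi (k, n) : {uniform R -> R[i]^o})
    [set h | forall y, setT y -> ball (schwartz_jets phi (k, n) y) e%:C (h y)].
  apply/uniform_nbhs.
  exists [set xy : R[i]^o * R[i]^o | ball xy.1 e%:C xy.2]; split => //.
  rewrite -entourage_ballE; exists e%:C => //=.
  by rewrite ltcR.
move=> /cj FC; apply: (@filterS _ (nbhs phi) _ _ _ _ FC) => psi hpsi x.
have := hpsi x I; rewrite -ball_normE/= cmodE ltcR => h.
rewrite -scaleN1r addrC jet_lin mulN1r -cmodN opprD opprK.
exact: h.
Qed.

#[local] Instance schwartz_nbhs_filter phi : Filter (nbhs phi).
Proof. by have [] := @nbhs_filter (schwartz R) phi. Qed.

Lemma nbhs_sball phi K e : 0 < e -> nbhs phi (sball phi K e).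
Proof.
move=> e0.
have h k n : nbhs phi [set psi : schwartz R |
    forall x, cmod (jet k n (psi - phi) x) < e] by exact: nbhs_jet.
pose A (i : 'I_K.+1 * 'I_K.+1) := [set psi : schwartz R |
    forall x, cmod (jet i.1 i.2 (psi - phi) x) < e].
have FA := @filter_forall (schwartz R) _ A (nbhs phi) (schwartz_nbhs_filter phi) (fun i => h i.1 i.2).
apply: (@filterS _ (nbhs phi) _ _ _ _ FA) => psi hpsi k n x kK nK.
by apply/ltW/(hpsi (Ordinal (kK : (k < K.+1)%N), Ordinal (nK : (n < K.+1)%N))).
Qed.

Lemma cvg_sballP (F : set_system (schwartz R)) phi : Filter F ->
  (forall K e, 0 < e -> F (sball phi K e)) <-> F --> phi.
Proof.
move=> FF; split=> [|Fphi K e e0]; first exact: jets_near.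
by apply: Fphi; exact: nbhs_sball.
Qed.

(** The filter of seminorm balls at 0 converges to 0, so some ball of radius e is sent into the open
    unit disc; homogeneity then gives C = 1 / e. *)
Lemma continuous_sbound u : linear u -> continuous u ->
  exists K C, 0 <= C /\ forall phi r, sbound K phi r -> cmod (u phi) <= C * r.
Proof.
move=> lu cu.
have uZ a phi : u (a *: phi) = a * u phi.
  have := lu 0 0 0; rewrite scale0r addr0 scale0r add0r => u00.
  have u0 : u 0 = 0.
    by have := lu 1 0 0; rewrite scaler0 addr0 scale1r => /eqP; rewrite eq_sym -subr_eq0 addrK => /eqP.
  by have := lu a phi 0; rewrite addr0 u0 addr0.
pose F : set_system (schwartz R) :=
  filter_from [set Ke : nat * R | 0 < Ke.2] (fun Ke => sball 0 Ke.1 Ke.2).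
have FF : Filter F.
  apply: filter_from_filter; first by exists (0%N, 1) => /=.
  move=> [K e] [L d] /= e0 d0; exists (maxn K L, Num.min e d) => /=.
    by rewrite lt_min e0 d0.
  move=> psi hpsi; split; apply: sboundW hpsi.
  - exact: leq_maxl.
  - by rewrite ge_min lexx.
  - exact: leq_maxr.
  - by rewrite ge_min lexx orbT.
have F0 : F --> (0 : schwartz R).
  by apply/cvg_sballP => K e e0; exists (K, e).
have u0 : u 0 = 0 by rewrite -(scale0r 0) uZ mul0r.
have : nbhs (u 0) [set z : R[i]^o | cmod z < 1].
  have : nbhs (u 0) (ball (u 0) (1%:C : R[i])) by apply: nbhsx_ballx; rewrite ltcR.
  apply: filterS => z; rewrite u0 -ball_normE/= add0r normrN cmodE ltcR.
  by [].
move=> /cu /F0 [[K e]] /= e0 Ke; exists K, e^-1.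
split=> [|phi r phir]; first by rewrite invr_ge0 ltW.
have r0 := sbound_ge0 phir.
(* As r may be 0, the rescaling uses positive s >= r, and s then tends to r. *)
have H s : 0 < s -> r <= s -> cmod (u phi) <= e^-1 * s.
  move=> s0 rs.
  have es : 0 <= e / s by rewrite divr_ge0// ltW.
  have : cmod (u ((e / s)%:C *: phi)) < 1.
    apply: Ke; rewrite /sball/= subr0.
    have := sboundZ (e / s)%:C phir; rewrite cmod_real (ger0_norm es).
    by apply: sboundW => //; rewrite mulrAC ler_pdivrMr// ler_wpM2l// ltW.
  rewrite uZ cmodM cmod_real (ger0_norm es) => h.
  have -> : e^-1 * s = (e / s)^-1 by rewrite invf_div mulrC.
  by rewrite -[leRHS]mulr1 ler_pdivlMl ?divr_gt0// ltW.
apply/ler_addgt0Pr => d d0.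
have := H (r + e * d); rewrite mulrDr mulKf ?gt_eqF//; apply.
  by rewrite ltr_wpDl// mulr_gt0.
by rewrite lerDl mulr_ge0// ltW.
Qed.

Lemma sbound_continuous u K C : linear u ->
  (forall phi r, sbound K phi r -> cmod (u phi) <= C * r) -> continuous u.
Proof.
move=> lu uC phi.
have C0 : 0 <= `|C| + 1 by rewrite addr_ge0.
have C1 : 0 < `|C| + 1 by rewrite ltr_wpDl.
apply/cvg_ballP => e e0.
have [d [d0 eE]] : exists d : R, 0 < d /\ e = d%:C.
  have : (0 : R[i]) < e by exact: e0.
  by case: (e) => x y; rewrite ltcE/= => /andP[/eqP -> x0]; exists x.
have d2 : 0 < d / 2 / (`|C| + 1) by rewrite !divr_gt0.
apply: filterS (nbhs_sball phi K d2) => psi /uC h.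
rewrite -ball_normE/= eE.
have -> : u phi - u psi = - u (psi - phi).
  have := lu (-1) phi psi; rewrite !scaleN1r => E.
  by rewrite [psi - phi]addrC E opprD opprK.
rewrite normrN cmodE ltcR (le_lt_trans h)//.
rewrite (@le_lt_trans _ _ (d / 2))//; last by rewrite ltr_pdivrMr// ltr_pMr// ltr1n.
rewrite (@le_trans _ _ ((`|C| + 1) * (d / 2 / (`|C| + 1))))//.
  rewrite ler_wpM2r ?(ltW d2)// (le_trans (ler_norm _))// lerDl//.
by rewrite mulrC divfK// gt_eqF.
Qed.

End SchwartzTopology.

(** * Tempered distributions and their primitives *)

Section RealAndImaginaryParts.
Context {R : realType}.
Implicit Types (u : schwartz R -> R[i]^o) (phi psi : schwartz R).
Implicit Types (f g : R -> R) (h : R -> R[i]^o) (K k n : nat) (a b r s x : R).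

Definition re h : R -> R := fun x => Re (h x).
Definition im h : R -> R := fun x => Im (h x).

Lemma iter_cderiveE n h :
  iter n cderive h = (fun x => Dn n (re h) x +i* Dn n (im h) x).
Proof.
elim: n => [|n IHn]; first by apply/funext => x /=; rewrite /re /im; case: (h x).
by rewrite iterS IHn.
Qed.

Lemma csmoothP h : csmooth h <-> smooth (re h) /\ smooth (im h).
Proof.
split=> [sh|[[sr] [si]] n x]; last by rewrite iter_cderiveE; split; [exact: sr|exact: si].
by split; split => n x; have := sh n x; rewrite iter_cderiveE => -[].
Qed.

Lemma jetE k n h x :
  jet k n h x = (x ^+ k * Dn n (re h) x) +i* (x ^+ k * Dn n (im h) x).
Proof.
by rewrite /jet iter_cderiveE; apply/eqP; rewrite eq_complex/= !mul0r subr0 addr0 !eqxx.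
Qed.

Lemma is_schwartzP h : is_schwartz h <-> rschwartz (re h) /\ rschwartz (im h).
Proof.
split=> [[/csmoothP[sr si] bh]|[[sr br] [si bi]]].
  split; apply: rschwartz_pointwise => // k n; have [M hM] := bh k n;
    exists M => x; have := hM x; rewrite cmod_le; apply: le_trans.
    by have := Re_le_cmod (jet k n h x); rewrite jetE.
  by have := Im_le_cmod (jet k n h x); rewrite jetE.
split=> [|k n]; first exact/csmoothP.
have [M hM] := br (maxn k n); have [N hN] := bi (maxn k n).
exists (M + N) => x; rewrite cmod_le (le_trans (cmod_le_ReIm _))// jetE lerD//=.
  by apply: hM; [exact: leq_maxl|exact: leq_maxr].
by apply: hN; [exact: leq_maxl|exact: leq_maxr].
Qed.

Lemma rschwartz_re phi : rschwartz (re phi).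
Proof. by have /is_schwartzP[] := schwartzP phi. Qed.

Lemma rschwartz_im phi : rschwartz (im phi).
Proof. by have /is_schwartzP[] := schwartzP phi. Qed.

Lemma rschwartz0 : rschwartz (fun=> 0 : R).
Proof. exact: (rschwartz_re 0). Qed.

(* Junk value: sreal f = 0 when f is not a Schwartz function. *)
Definition sreal f : schwartz R :=
  odflt 0 (insub (fun x => (f x)%:C : R[i]^o)).

Lemma sreal_in f : rschwartz f -> (fun x => (f x)%:C : R[i]^o) \in schwartz_pred.
Proof.
by move=> rf; apply/asboolP/is_schwartzP; split => //; exact: rschwartz0.
Qed.

Lemma srealE f : rschwartz f -> sreal f = (fun x => (f x)%:C) :> (R -> R[i]^o).
Proof. by move=> /sreal_in rf; rewrite /sreal insubT. Qed.

Lemma re_sreal f : rschwartz f -> re (sreal f) = f.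
Proof. by move=> rf; rewrite srealE. Qed.

Lemma im_sreal f : rschwartz f -> im (sreal f) = (fun=> 0).
Proof. by move=> rf; rewrite srealE. Qed.

Lemma schwartz_eq phi psi : re phi = re psi -> im phi = im psi -> phi = psi.
Proof.
move=> er ei; apply: val_inj; apply/funext => x /=.
have := congr1 (fun f => f x) er; have := congr1 (fun f => f x) ei; rewrite /re /im.
by case: (schwartz_fun phi x) (schwartz_fun psi x) => [? ?] [? ?] /= -> ->.
Qed.

Lemma re_lin c phi psi x : re (c *: phi + psi : schwartz R) x =
  Re c * re phi x - Im c * im phi x + re psi x.
Proof.
by rewrite /re /im; have := jet_lin 0 0 c phi psi x; rewrite /jet !expr0 !mul1r/= => ->;
  case: c (schwartz_fun phi x) (schwartz_fun psi x) => ? ? [? ?] [? ?].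
Qed.

Lemma im_lin c phi psi x : im (c *: phi + psi : schwartz R) x =
  Re c * im phi x + Im c * re phi x + im psi x.
Proof.
by rewrite /re /im; have := jet_lin 0 0 c phi psi x; rewrite /jet !expr0 !mul1r/= => ->;
  case: c (schwartz_fun phi x) (schwartz_fun psi x) => ? ? [? ?] [? ?].
Qed.

Lemma sreal_lin a f g : rschwartz f -> rschwartz g ->
  sreal (fun x => a * f x + g x) = a%:C *: sreal f + sreal g.
Proof.
move=> rf rg; have rh := rschwartz_lin a rf rg.
apply: schwartz_eq; apply/funext => x.
  by rewrite re_lin !re_sreal// im_sreal//= mul0r subr0.
by rewrite im_lin !im_sreal// re_sreal//= !mulr0 mul0r !addr0.
Qed.

Lemma schwartz_split phi : phi = 'i%C *: sreal (im phi) + sreal (re phi).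
Proof.
have rr := rschwartz_re phi; have ri := rschwartz_im phi.
apply: schwartz_eq; apply/funext => x.
  by rewrite re_lin !re_sreal// im_sreal//= mul0r mul1r oppr0 !add0r.
by rewrite im_lin !im_sreal// re_sreal//= mul0r mul1r add0r addr0.
Qed.

Lemma sbound_re K phi r : sbound K phi r -> rbound K (re phi) r.
Proof.
move=> pr k n x kK nK; rewrite (le_trans _ (pr k n x kK nK))//.
by have := Re_le_cmod (jet k n phi x); rewrite jetE.
Qed.

Lemma sbound_im K phi r : sbound K phi r -> rbound K (im phi) r.
Proof.
move=> pr k n x kK nK; rewrite (le_trans _ (pr k n x kK nK))//.
by have := Im_le_cmod (jet k n phi x); rewrite jetE.
Qed.

Lemma sbound_ReIm K phi r s : rbound K (re phi) r -> rbound K (im phi) s ->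
  sbound K phi (r + s).
Proof.
move=> pr ps k n x kK nK; rewrite (le_trans (cmod_le_ReIm _))// jetE lerD//=.
  exact: pr.
exact: ps.
Qed.

Lemma sbound_ex K phi : exists r, sbound K phi r.
Proof.
have [_ /(_ K)[r hr]] := rschwartz_re phi; have [_ /(_ K)[s hs]] := rschwartz_im phi.
by exists (r + s); exact: sbound_ReIm.
Qed.

Lemma sbound_sreal K f r : rschwartz f -> rbound K f r -> sbound K (sreal f) r.
Proof.
move=> rf fr; rewrite -[r]addr0; apply: sbound_ReIm; first by rewrite re_sreal.
rewrite im_sreal// => k n x _ _.
by rewrite derive1n_cst0 mulr0 normr0.
Qed.

(** A complex-linear functional is determined by its values on real Schwartz functions; the calculus
    is done on these values, and [cext] leads back to functionals. *)
Definition ev u f : R[i] := u (sreal f).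

Definition cext (W : (R -> R) -> R[i]) : schwartz R -> R[i]^o :=
  fun phi => 'i%C * W (im phi) + W (re phi).

Lemma ev_lin u a f g : linear u -> rschwartz f -> rschwartz g ->
  ev u (fun x => a * f x + g x) = a%:C * ev u f + ev u g.
Proof. by move=> lu rf rg; rewrite /ev sreal_lin// lu. Qed.

Lemma ev_split u phi : linear u -> u phi = 'i%C * ev u (im phi) + ev u (re phi).
Proof. by move=> lu; rewrite {1}(schwartz_split phi) lu. Qed.

Lemma ev_eq u v : linear u -> linear v ->
  (forall f, rschwartz f -> ev u f = ev v f) -> u = v.
Proof.
move=> lu lv uv; apply/funext => phi; rewrite !(@ev_split _ phi)// !uv//.
  exact: rschwartz_re.
exact: rschwartz_im.
Qed.

Section Extension.
Variable W : (R -> R) -> R[i].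
Hypothesis W_lin : forall a f g, rschwartz f -> rschwartz g ->
  W (fun x => a * f x + g x) = a%:C * W f + W g.

Lemma ext0 : W (fun=> 0) = 0.
Proof.
have := W_lin (-1) rschwartz0 rschwartz0.
rewrite mulr0 addr0 => {1}->; rewrite rmorphN1 mulN1r addNr//.
Qed.

Lemma ev_cext f : rschwartz f -> ev (cext W) f = W f.
Proof. by move=> rf; rewrite /ev /cext re_sreal// im_sreal// ext0 mulr0 add0r. Qed.

Lemma cext_linear : linear (cext W).
Proof.
move=> c phi psi; rewrite /cext.
have rr := rschwartz_re phi; have ri := rschwartz_im phi.
have sr := rschwartz_re psi; have si := rschwartz_im psi.
have -> : im (c *: phi + psi) =
    (fun x => Re c * im phi x + (Im c * re phi x + im psi x)).
  by apply/funext => x; rewrite im_lin addrA.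
have -> : re (c *: phi + psi) =
    (fun x => Re c * re phi x + (- Im c * im phi x + re psi x)).
  by apply/funext => x; rewrite re_lin mulNr addrA.
rewrite !W_lin//; do ?exact: rschwartz_lin.
rewrite rmorphN/=.
have -> : c *: ('i * W (im phi) + W (re phi) : R[i]^o) =
    c * ('i * W (im phi) + W (re phi)) by [].
have ii : 'i%C * 'i%C = -1 :> R[i] by rewrite -expr2 sqr_i.
move: (W (im phi)) (W (re phi)) (W (im psi)) (W (re psi)) => A B A' B'.
(* The two sides differ by the multiple q A of -1 - i * i. *)
have key (i p q : R[i]) : i * i = -1 -> i * (p * A + (q * B + A')) + (p * B + (- q * A + B')) =
    (p + i * q) * (i * A + B) + (i * A' + B').
  move=> i2; apply/eqP; rewrite -subr_eq0; apply/eqP.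
  transitivity ((q * A) * (-1 - i * i)); first by ring.
  by rewrite i2 subrr mulr0.
by have := key _ (Re c)%:C (Im c)%:C ii; rewrite -complexE.
Qed.

Lemma cext_tempered K C : (forall f r, rschwartz f -> rbound K f r ->
  cmod (W f) <= C * r) -> tempered (cext W).
Proof.
move=> WC; split; first exact: cext_linear.
apply: (@sbound_continuous _ _ K (C + C)); first exact: cext_linear.
move=> phi r phir; rewrite /cext (le_trans (cmodD _ _))// cmodM cmod_i mul1r mulrDl.
rewrite lerD// WC//; [exact: rschwartz_im|exact: sbound_im|exact: rschwartz_re|exact: sbound_re].
Qed.

End Extension.

Lemma ev_bound u : tempered u -> exists K C, 0 <= C /\
  forall f r, rschwartz f -> rbound K f r -> cmod (ev u f) <= C * r.
Proof.
move=> [lu cu]; have [K [C [C0 hC]]] := continuous_sbound lu cu.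
by exists K, C; split=> // f r rf fr; apply: hC; exact: sbound_sreal.
Qed.

Lemma ev_approx u f : tempered u -> rschwartz f ->
  (forall K e, 0 < e -> exists2 g, rschwartz g & ev u g = 0 /\
     rbound K (fun x => (-1) * g x + f x) e) -> ev u f = 0.
Proof.
move=> tu rf H; have [K [C [C0 hC]]] := ev_bound tu; have [lu _] := tu.
apply/eqP; rewrite -cmod_eq0 eq_le cmod_ge0 andbT.
apply/ler_addgt0Pr => e e0; rewrite add0r.
have C1 : 0 < C + 1 by rewrite ltr_wpDl.
have [g rg [ug gf]] := H K (e / (C + 1)) (divr_gt0 e0 C1).
have := hC _ _ (rschwartz_lin (-1) rg rf) gf.
rewrite ev_lin// ug mulr0 add0r => h; rewrite (le_trans h)//.
by rewrite mulrA ler_pdivrMr// [leRHS]mulrDr [C * e]mulrC mulr1 lerDl ltW.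
Qed.

Lemma tsupp_out phi x : ~ tsupp phi x -> re phi x = 0 /\ im phi x = 0.
Proof.
move=> xo; have p0 : schwartz_fun phi x = 0.
  by apply/eqP/negPn/negP => px; apply: xo; exact: subset_closure.
by rewrite /re /im p0.
Qed.

Lemma tsupp_sreal a b f : testfun a b f -> tsupp (sreal f) `<=` `[a, b]%classic.
Proof.
move=> tf; have rf := testfun_rschwartz tf; have [_ f0] := tf.
have -> : `[a, b]%classic = closure `[a, b]%classic.
  by apply/closure_id; exact: itv_closed.
apply: closure_subset => x /=; rewrite srealE// in_itv/= => fx.
by apply/negPn/negP => /f0 xab; move: fx; rewrite xab eqxx.
Qed.

Lemma compact_tsupp_sreal a b f : testfun a b f -> compact (tsupp (sreal f)).
Proof.
move=> tf; apply: (subclosed_compact _ (@segment_compact R a b)).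
  exact: closed_closure.
exact: tsupp_sreal.
Qed.

(** a and b are the least and greatest points of the support; since they belong to it, a condition
    on the support becomes a condition on a and b. *)
Lemma tsupp_testfun phi : compact (tsupp phi) -> phi = 0 \/
  exists a b, [/\ tsupp phi a, tsupp phi b, testfun a b (re phi) & testfun a b (im phi)].
Proof.
move=> cphi; have [p0|/set0P p0] := eqVneq (tsupp phi) set0.
  left; apply: schwartz_eq; apply/funext => x.
    by have [|-> _] := @tsupp_out phi x; [rewrite p0|rewrite /re].
  by have [|_ ->] := @tsupp_out phi x; [rewrite p0|rewrite /im].
right; have ci : {within tsupp phi, continuous (id : R -> R)}.
  by apply: continuous_subspaceT => x.
have [b pb bmax] := compact_EVT_max p0 cphi ci.
have [a pa amin] := compact_EVT_min p0 cphi ci.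
have out x : ~~ (a <= x <= b) -> re phi x = 0 /\ im phi x = 0.
  move=> xo; apply: tsupp_out => px; move/negP: xo; apply.
  by rewrite amin ?inE// bmax ?inE.
exists a, b; move: pa pb; rewrite !inE => pa pb; split => //; split.
- exact/rschwartz_smooth/rschwartz_re.
- by move=> x /out[].
- exact/rschwartz_smooth/rschwartz_im.
- by move=> x /out[].
Qed.

End RealAndImaginaryParts.

(** * Distributions supported in [0, oo[ and their primitives *)

Section HalfLineDistributions.
Context {R : realType}.
Implicit Types (u v : schwartz R -> R[i]^o) (phi psi : schwartz R).
Implicit Types (f g : R -> R) (K k n m : nat) (a b d r s x y : R).

Lemma ev0 u : linear u -> ev u (fun=> 0) = 0.
Proof.
move=> lu; have := ev_lin (-1) lu (@rschwartz0 R) (@rschwartz0 R).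
by rewrite mulr0 addr0 => {1}->; rewrite rmorphN1 mulN1r addNr.
Qed.

(* The supremum of the s such that u vanishes on test functions supported in
   [a, s] cannot be smaller than b, by a smooth cut at that supremum. *)
Lemma half_open u a b f : tempered_half u -> testfun a b f -> b < 0 -> ev u f = 0.
Proof.
move=> [tu su] tf b0; have [lu _] := tu.
have [ab|ba] := leP a b; last first.
  have -> : f = fun=> 0; last exact: ev0.
  apply/funext => x; apply: (testfun_out tf); apply/negP => /andP[ax xb].
  by move: (le_trans ax xb); rewrite leNgt ba.
pose P s := forall g, testfun a s g -> ev u g = 0.
pose S := [set s | s <= b /\ P s].
suff : P b by exact.
have Sa : S (a - 1).
  split=> [|g tg]; first by rewrite (le_trans _ ab)// gerBl.
  have -> : g = fun=> 0; last exact: ev0.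
  apply/funext => x; apply: (testfun_out tg); apply/negP => /andP[ax xb].
  by move: (le_trans ax xb); rewrite leNgt gtrBl ltr01.
have uS : ubound S b by move=> s [].
have hS : has_sup S by split; [exists (a - 1)|exists b].
pose s0 := sup S.
have s0b : s0 <= b by apply: ge_sup => //; exists (a - 1).
have : ~ dist_supp u s0.
  by move=> /su /=; rewrite leNgt (le_lt_trans s0b b0).
rewrite /dist_supp /= => /contrapT[U [oU vU] Us0].
have [d d0 sdU] : exists2 d, 0 < d & forall y, `|s0 - y| < d -> U y.
  have : nbhs s0 U by apply: open_nbhs_nbhs; split.
  by rewrite -nbhs_ballE => -[d d0 dU]; exists d => // y sy; apply: dU.
have d4 : 0 < d / 4 by rewrite divr_gt0.
have [s [sb Ps] ss0] := sup_adherent d4 hS; rewrite -/s0 in ss0.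
have key : P (s0 + d / 2).
  move=> g tg; have [sg g0] := tg.
  (* w rises from 0 at s0 - d/2 to 1 at s0 - d/4. So w g is supported in U, and (1 - w) g ends
     before s, which exceeds s0 - d/4. *)
  pose w x := step (4 / d * x + (2 - 4 / d * s0)).
  have sw : smooth w by apply: smooth_affine; exact: smooth_step.
  have wE x : 4 / d * x + (2 - 4 / d * s0) = 2 + (x - s0) * (4 / d) by ring.
  have t1 : testfun (s0 - d / 2) (s0 + d / 2) (fun x => w x * g x).
    split=> [|x]; first exact: smooth_mul.
    rewrite negb_and -!ltNge => /orP[xs|sx]; last first.
      by rewrite g0 ?mulr0// negb_and -!ltNge sx orbT.
    rewrite /w wE step_eq0 ?mul0r//.
    rewrite mulrA addrC -lerBrDr add0r ler_pdivrMr//; lra.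
  have t2 : testfun a s (fun x => -1 * (w x * g x) + g x).
    split=> [|x]; first by apply: smooth_lin => //; exact: smooth_mul.
    rewrite negb_and -!ltNge => /orP[xs|sx].
      by rewrite g0 ?mulr0 ?addr0// negb_and -!ltNge xs.
    rewrite /w wE step_eq1 ?mul1r ?mulN1r ?addNr//.
    have h : -1 <= (x - s0) * (4 / d) by rewrite mulrA ler_pdivlMr//; lra.
    lra.
  have r1 := testfun_rschwartz t1; have r2 := testfun_rschwartz t2.
  have -> : g = (fun x => 1 * (w x * g x) + (-1 * (w x * g x) + g x)).
    by apply/funext => x; ring.
  rewrite ev_lin// (Ps _ t2) addr0 mul1r; apply: vU.
    exact: compact_tsupp_sreal t1.
  move=> x /(tsupp_sreal t1) /=; rewrite in_itv/= => /andP[x1 x2].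
  apply: sdU; rewrite ltr_norml; apply/andP; split; lra.
have bs : b <= s0.
  rewrite leNgt; apply/negP => s0b'.
  have : S (Num.min b (s0 + d / 2)).
    split=> [|g tg]; first by rewrite ge_min lexx.
    apply: key; apply: testfunW tg => //.
    by rewrite ge_min lexx orbT.
  move=> /(sup_upper_bound hS); rewrite -/s0 ge_min => /orP[|].
    by rewrite leNgt s0b'.
  by rewrite gerDl leNgt divr_gt0.
move=> g tg; apply: key; apply: testfunW tg => //.
by rewrite (le_trans bs)// lerDl ltW// divr_gt0.
Qed.

(** Cut-offs of f approximate it by test functions ending at - d, to which [half_open] applies. *)
Lemma half_vanish u d f : tempered_half u -> rschwartz f -> 0 < d ->
  (forall x, - d <= x -> f x = 0) -> ev u f = 0.
Proof.
move=> hu rf d0 f0; have [tu _] := hu.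
apply: ev_approx => // K e e0; have [rho rho0 hrho] := cutoff_approx K rf e0.
have tc := testfun_cutoff rho (rschwartz_smooth rf).
exists (cutoff rho f); first exact: testfun_rschwartz tc.
split=> //; apply: (@half_open u (- rho - 1) (- d)) => //; last by rewrite oppr_lt0.
split=> [|x]; first by case: tc.
rewrite negb_and -!ltNge => /orP[xr|dx]; last by rewrite /cutoff f0 ?mulr0// ltW.
by apply: (testfun_out tc); rewrite negb_and -!ltNge xr.
Qed.

Lemma tempered_halfI u : tempered u ->
  (forall a b f, testfun a b f -> b < 0 -> ev u f = 0) -> tempered_half u.
Proof.
move=> tu u0; split=> // x; rewrite /dist_supp /= leNgt => h; apply/negP => x0.
apply: h; exists [set y | y < 0] => //; split; first exact: open_lt.
move=> phi cphi sphi; have [lu _] := tu.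
have [->|[a [b [_ pb tr ti]]]] := tsupp_testfun cphi.
  have := lu (-1) 0 0; rewrite scaler0 addr0 => ->.
  by rewrite scaleN1r addNr.
have b0 : b < 0 := sphi b pb.
by rewrite ev_split// (u0 _ _ _ tr b0) (u0 _ _ _ ti b0) mulr0 addr0.
Qed.

Lemma tempered_lin c u v : tempered u -> tempered v -> tempered (c *: u + v).
Proof.
move=> [lu cu] [lv cv].
have luv : linear (c *: u + v).
  move=> e phi psi; rewrite !fctE lu lv !scalerDr !scalerA [c * e]mulrC.
  by rewrite !addrA; congr (_ + _); rewrite -!addrA; congr (_ + _); rewrite addrC.
split; first exact: luv.
have [K [C [C0 hC]]] := continuous_sbound lu cu.
have [L [D [D0 hD]]] := continuous_sbound lv cv.
apply: (@sbound_continuous _ _ (maxn K L) (cmod c * C + D)) => // phi r phir.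
rewrite (le_trans (cmodD _ _))// mulrDl lerD//; last first.
  by apply: hD; apply: sboundW phir => //; exact: leq_maxr.
rewrite cmodM -mulrA ler_wpM2l ?cmod_ge0// hC//.
by apply: sboundW phir => //; exact: leq_maxl.
Qed.

Lemma ev_fun_lin c u v f : ev (c *: u + v) f = c * ev u f + ev v f.
Proof. by []. Qed.

Lemma tempered_half_lin c u v : tempered_half u -> tempered_half v ->
  tempered_half (c *: u + v).
Proof.
move=> hu hv; have [tu _] := hu; have [tv _] := hv.
apply: tempered_halfI; first exact: tempered_lin.
move=> a b f tf b0; rewrite ev_fun_lin.
by rewrite (half_open hu tf b0) (half_open hv tf b0) mulr0 addr0.
Qed.

Lemma tempered_half0 : tempered_half (0 : schwartz R -> R[i]^o).
Proof.
have l0 : linear ((fun=> 0) : schwartz R -> R[i]^o).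
  by move=> c phi psi; rewrite scaler0 addr0.
apply: tempered_halfI => //; split=> //.
apply: (@sbound_continuous _ _ 0 0) => // phi r _.
by rewrite mul0r cmod0.
Qed.

Lemma tempered_half_sum (b : nat -> R[i]) (w : nat -> schwartz R -> R[i]^o) N :
  (forall n, tempered_half (w n)) -> tempered_half (\sum_(n < N) b n *: w n).
Proof.
move=> hw; elim: N => [|N IHN]; first by rewrite big_ord0; exact: tempered_half0.
by rewrite big_ord_recr/= addrC; exact: tempered_half_lin.
Qed.

Lemma ev_derive u f : linear u -> rschwartz f -> ev (dist_derive u) f = - ev u (D1 f).
Proof.
move=> lu rf; rewrite /ev /dist_derive; congr (- u _); apply: val_inj.
have rd := rschwartz_derive rf.
rewrite /= srealE// srealE//; have := iter_cderiveE 1 (fun x => (f x)%:C : R[i]^o).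
by rewrite /= => ->; apply/funext => x; rewrite /re /im /= derive1_cst.
Qed.

Lemma dist_derive_linear u : linear u -> linear (dist_derive u).
Proof.
move=> lu c phi psi; rewrite /dist_derive.
have -> : schwartz_derive (c *: phi + psi) =
    c *: schwartz_derive phi + schwartz_derive psi.
  apply: val_inj; have [sp _] := schwartzP phi; have [sq _] := schwartzP psi.
  exact: (cderiven_lin 1 c sp sq).
by rewrite lu opprD scalerN.
Qed.

Lemma dist_derive_half u : tempered_half u -> tempered_half (dist_derive u).
Proof.
move=> hu; have [tu _] := hu; have [lu cu] := tu.
have ld := dist_derive_linear lu.
apply: tempered_halfI => [|a b f tf b0].
  split; first exact: ld.
  have [K [C [C0 hC]]] := continuous_sbound lu cu.
  apply: (@sbound_continuous _ _ K.+1 C) => // phi r phir.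
  rewrite /dist_derive cmodN hC// => k n x kK nK.
  by have := phir k n.+1 x (leqW kK) nK; rewrite /jet iterSr.
rewrite ev_derive//; last exact: testfun_rschwartz tf.
by rewrite (half_open hu (testfun_derive tf) b0) oppr0.
Qed.

(** The transpose of [prim]. Near [0, oo[, which is all that u sees, [prim] and differentiation
    invert each other up to sign, so this is a two-sided inverse of [dist_derive] on
    [tempered_half]. *)
Definition dist_prim u : schwartz R -> R[i]^o := cext (fun f => ev u (prim f)).

Let prim_ev_lin u : linear u -> forall a f g, rschwartz f -> rschwartz g ->
  ev u (prim (fun x => a * f x + g x)) = a%:C * ev u (prim f) + ev u (prim g).
Proof.
move=> lu a f g rf rg; rewrite prim_lin// ev_lin//; exact: prim_rschwartz.
Qed.

Lemma ev_dist_prim u f : linear u -> rschwartz f -> ev (dist_prim u) f = ev u (prim f).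
Proof. by move=> lu rf; rewrite ev_cext//; exact: prim_ev_lin. Qed.

Lemma dist_prim_half u : tempered_half u -> tempered_half (dist_prim u).
Proof.
move=> hu; have [tu _] := hu; have [lu _] := tu.
have [K [C [C0 hC]]] := ev_bound tu; have [D D0 hD] := @prim_bound R K.
have tp : tempered (dist_prim u).
  apply: (@cext_tempered _ _ (prim_ev_lin lu) K.+2 (C * D)) => f r rf fr.
  rewrite -mulrA hC//; first exact: prim_rschwartz.
  exact: hD.
apply: tempered_halfI => // a b f tf b0; have rf := testfun_rschwartz tf.
rewrite ev_dist_prim//.
have b2 : 0 < - b / 2 by rewrite divr_gt0// oppr_gt0.
apply: (half_vanish hu (prim_rschwartz rf) b2) => x bx.
apply: (@prim_eq0 _ _ (b / 2)); last by lra.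
by move=> t bt; apply: (testfun_out tf); rewrite negb_and -!ltNge; apply/orP; right; lra.
Qed.

Lemma dist_primK u : tempered_half u -> dist_derive (dist_prim u) = u.
Proof.
move=> hu; have [tu _] := hu; have [lu _] := tu.
have hp := dist_prim_half hu; have [[lp _] _] := hp.
apply: ev_eq => //; first exact: dist_derive_linear.
move=> f rf; have rd := rschwartz_derive rf.
have sf := rschwartz_smooth rf; have rp := prim_rschwartz rd.
have rh := rschwartz_lin 1 rp rf.
have h0 : ev u (fun x => 1 * prim (D1 f) x + f x) = 0.
  apply: (@half_vanish u 1) => // x x1; rewrite prim_derive// chi_eq1//; ring.
rewrite ev_derive// ev_dist_prim//; apply/esym/eqP; rewrite -subr_eq0 opprK addrC.
by rewrite -h0 ev_lin// mul1r.
Qed.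

Lemma dist_deriveK u : tempered_half u -> dist_prim (dist_derive u) = u.
Proof.
move=> hu; have [tu _] := hu; have [lu _] := tu.
have hd := dist_derive_half hu; have hp := dist_prim_half hd.
have [[ld _] _] := hd; have [[lp _] _] := hp.
apply: ev_eq => // f rf; have rp := prim_rschwartz rf.
have rdp := rschwartz_derive rp.
rewrite ev_dist_prim// ev_derive//.
have rh := rschwartz_lin 1 rdp rf.
have h0 : ev u (fun x => 1 * D1 (prim f) x + f x) = 0.
  (* The derivative of [chi] occurs here, so [chi] must be constant near x and not only at x; hence
     the margin 1/2 instead of 1. *)
  apply: (@half_vanish u (2^-1)) => // x x1; rewrite derive_prim// chi_eq1; last by lra.
  have -> : D1 (chi : R -> R) x = 0; last by ring.
  apply: is_derive1E; apply: (@near_eq_is_derive _ _ _ (cst (1 : R))) => //.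
  near=> y; rewrite chi_eq1//; near: y; apply: lt_le_nbhsr; lra.
apply/esym/eqP; rewrite -subr_eq0 opprK addrC.
by rewrite -h0 ev_lin// mul1r.
Unshelve. all: by end_near. Qed.

Lemma iter_dist_prim_half m u : tempered_half u -> tempered_half (iter m dist_prim u).
Proof. by move=> hu; elim: m => //= m IHm; exact: dist_prim_half. Qed.

Lemma iter_dist_primK m u : tempered_half u ->
  iter m dist_derive (iter m dist_prim u) = u.
Proof.
move=> hu; elim: m => // m IHm; rewrite iterSr iterS dist_primK//.
exact: iter_dist_prim_half.
Qed.

Lemma iter_dist_deriveK m u : tempered_half u ->
  iter m dist_prim (iter m dist_derive u) = u.
Proof.
elim: m u => // m IHm u hu; rewrite iterS iterSr IHm ?dist_deriveK//.
exact: dist_derive_half.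
Qed.

(** Iterated differentiation is injective on [tempered_half], so the set from which [primitive]
    picks an element is a singleton. *)
Lemma primitiveE m u : tempered_half u -> primitive m u = iter m dist_prim u.
Proof.
move=> hu; apply: get_subset1 => [|v w [hv vu] [hw wu]].
  by split; [exact: iter_dist_prim_half|exact: iter_dist_primK].
by rewrite -(iter_dist_deriveK m hv) -(iter_dist_deriveK m hw) vu wu.
Qed.

Lemma dist_prim_lin c u v : linear u -> linear v ->
  dist_prim (c *: u + v) = c *: dist_prim u + dist_prim v.
Proof.
move=> lu lv; apply/funext => phi; rewrite /dist_prim /cext !fctE.
rewrite !ev_fun_lin.
have -> (x y : R[i]^o) : c *: x + y = c * x + y by [].
ring.
Qed.

Lemma iter_dist_prim_sum m (b : nat -> R[i]) (w : nat -> schwartz R -> R[i]^o) N :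
  (forall n, tempered_half (w n)) ->
  iter m dist_prim (\sum_(n < N) b n *: w n) = \sum_(n < N) b n *: iter m dist_prim (w n).
Proof.
elim: m w => // m IHm w hw; rewrite !iterSr.
under [RHS]eq_bigr do rewrite iterSr.
rewrite -(IHm (fun n => dist_prim (w n))); last by move=> n; exact: dist_prim_half.
congr (iter m dist_prim _); move: {IHm} N; elim=> [|N IHN].
  rewrite !big_ord0; have e0 : 'i%C * 0 + 0 = 0 :> R[i] by rewrite mulr0 addr0.
  by apply/funext => phi; first [exact: e0|exact: esym e0].
rewrite !big_ord_recr/= ![_ + b N *: _]addrC -IHN dist_prim_lin//.
  by have [[]] := hw N.
by have [[]] := tempered_half_sum b N hw.
Qed.

Lemma ev_iter_derive u m f : linear u -> rschwartz f ->
  ev (iter m dist_derive u) f = (-1) ^+ m * ev u (Dn m f).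
Proof.
move=> lu rf; elim: m u lu => [|m IHm] u lu; first by rewrite mul1r.
rewrite iterSr IHm; last exact: dist_derive_linear.
rewrite ev_derive//; last by elim: m {IHm} => // m IHm; exact: rschwartz_derive.
by rewrite exprSr mulrN1 mulNr mulrN.
Qed.

End HalfLineDistributions.

(** * Moment problems *)

Section CauchyLimits.
Context {R : realType}.

(** The intervals of centre x k and radius c k meet pairwise, and the supremum of their left ends
    lies in all of them. This gives the limit together with its error at every k. *)
Lemma real_limit (x c : nat -> R) n0 :
  (forall k l, (n0 <= k)%N -> (n0 <= l)%N -> `|x k - x l| <= c k + c l) ->
  exists y, forall k, (n0 <= k)%N -> `|x k - y| <= c k.
Proof.
move=> xc.
pose S := [set y | exists2 k, (n0 <= k)%N & y = x k - c k].
have S0 : S !=set0 by exists (x n0 - c n0), n0.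
have ub l : (n0 <= l)%N -> ubound S (x l + c l).
  move=> n0l _ [k n0k ->]; have := xc _ _ n0k n0l.
  by move=> /(le_trans (ler_norm _)) => h; lra.
exists (sup S) => k n0k; rewrite ler_norml; apply/andP; split.
  have : sup S <= x k + c k by apply: ge_sup => //; exact: ub.
  lra.
have : x k - c k <= sup S.
  by apply: ub_le_sup; [exists (x n0 + c n0); exact: ub|exists k].
lra.
Qed.

Lemma complex_limit (z : nat -> R[i]) (c : nat -> R) :
  (forall k l, cmod (z k - z l) <= c k + c l) ->
  exists w, forall k, cmod (z k - w) <= c k + c k.
Proof.
move=> zc.
have [|a ha] := @real_limit (fun k => Re (z k)) c 0.
  move=> k l _ _; rewrite (le_trans _ (zc k l))//.
  by have := Re_le_cmod (z k - z l); case: (z k) (z l) => ? ? [? ?].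
have [|b hb] := @real_limit (fun k => Im (z k)) c 0.
  move=> k l _ _; rewrite (le_trans _ (zc k l))//.
  by have := Im_le_cmod (z k - z l); case: (z k) (z l) => ? ? [? ?].
exists (a +i* b) => k; rewrite (le_trans (cmod_le_ReIm _))// lerD//.
  by have := ha k isT; case: (z k).
by have := hb k isT; case: (z k).
Qed.

End CauchyLimits.

(** * Domination modulo finitely many functionals *)

Section FiniteCodimension.
Context {R : realType} {X : lmodType R[i]}.
Implicit Types (phi psi : X) (g h : X -> R[i]^o) (W : set X) (r s C D : R).

(* A seminorm N is encoded by the relation p phi r <-> N phi <= r, which avoids
   suprema. *)
Record seminorm_rel (p : X -> R -> Prop) : Prop := SeminormRel {
  seminorm_ge0 : forall phi r, p phi r -> 0 <= r;
  seminormW : forall phi r s, r <= s -> p phi r -> p phi s;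
  seminormZ : forall a phi r, p phi r -> p (a *: phi) (cmod a * r);
  seminormD : forall phi psi r s, p phi r -> p psi s -> p (phi + psi) (r + s);
  seminorm_ex : forall phi, exists r, p phi r }.

Definition dominated W (p : X -> R -> Prop) h : Prop :=
  exists C, 0 <= C /\ forall phi r, W phi -> p phi r -> cmod (h phi) <= C * r.

Definition linsub W : Prop :=
  W 0 /\ forall a phi psi, W phi -> W psi -> W (a *: phi + psi).

Lemma functional0 h : linear h -> h 0 = 0.
Proof. by move=> lh; have := lh (-1) 0 0; rewrite scaler0 addr0 scaleN1r addNr. Qed.

Lemma functionalZ h a phi : linear h -> h (a *: phi) = a * h phi.
Proof. by move=> lh; have := lh a phi 0; rewrite !addr0 functional0// addr0. Qed.

Lemma functionalB h phi psi : linear h -> h (phi - psi) = h phi - h psi.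
Proof. by move=> lh; rewrite addrC -scaleN1r lh scaleN1r addrC. Qed.

Lemma functional_lin h g a : linear h -> linear g ->
  linear ((fun phi => h phi - a * g phi) : X -> R[i]^o).
Proof.
move=> lh lg b phi psi; rewrite lh lg /GRing.scale/=.
by move: (h phi) (h psi) (g phi) (g psi) => x y z t; ring.
Qed.

Lemma linsubZ W a phi : linsub W -> W phi -> W (a *: phi).
Proof. by move=> [W0 Wl] Wphi; rewrite -[_ *: _]addr0; exact: Wl. Qed.

Lemma linsubB W phi psi : linsub W -> W phi -> W psi -> W (phi - psi).
Proof. by move=> [W0 Wl] Wphi Wpsi; rewrite addrC -scaleN1r; exact: Wl. Qed.

Section OneSeminorm.
Variable p : X -> R -> Prop.
Hypothesis semip : seminorm_rel p.

Lemma seminormB phi psi r s : p phi r -> p psi s -> p (phi - psi) (r + s).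
Proof.
move=> pr ps; apply: (seminormD semip) => //.
by have := seminormZ semip (-1) ps; rewrite scaleN1r cmodN cmod1 mul1r.
Qed.

(* If g is not dominated on W, pick e k in W with g (e k) = 1 and seminorm
   tending to 0; then h - (lim h (e k)) g is dominated. *)
Lemma dominated_codim1 W g h : linsub W -> linear g -> linear h ->
  dominated (W `&` [set phi | g phi = 0]) p h ->
  exists d, dominated W p (fun phi => h phi - d * g phi).
Proof.
move=> sW lg lh [C [C0 hC]].
(* If g is dominated, subtracting g phi times some e1 in W with g e1 = 1 projects W onto the kernel
   of g with controlled seminorm; if there is no such e1, W already lies in that kernel. *)
have [[D [D0 gD]]|gnD] := pselect (dominated W p g).
  have [[e [We ge]]|ge] := pselect (exists e, W e /\ g e <> 0); last first.
    exists 0, C; split=> // phi r Wphi pr; rewrite mul0r subr0; apply: hC => //.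
    by split=> //=; apply: contrapT => gphi; apply: ge; exists phi.
  have [e1 [We1 ge1]] : exists e1, W e1 /\ g e1 = 1.
    exists ((g e)^-1 *: e); split; first exact: linsubZ.
    by rewrite functionalZ// mulVf//; exact/eqP.
  have [s ps] := seminorm_ex semip e1; have s0 := seminorm_ge0 semip ps.
  exists (h e1), (C * (1 + D * s)); split=> [|phi r Wphi pr].
    by rewrite mulr_ge0// addr_ge0// mulr_ge0.
  have r0 := seminorm_ge0 semip pr.
  have -> : h phi - h e1 * g phi = h (phi - g phi *: e1).
    by rewrite functionalB// functionalZ// mulrC.
  rewrite (le_trans (hC _ (r + cmod (g phi) * s) _ _))//.
  - by split; [apply: linsubB => //; exact: linsubZ|rewrite /= functionalB// functionalZ// ge1 mulr1 subrr].
  - by apply: seminormB => //; exact: seminormZ.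
  rewrite -mulrA ler_wpM2l// mulrDl mul1r lerD2l mulrAC ler_wpM2r//.
  exact: gD.
have /choice[e he] : forall k, exists e, [/\ W e, g e = 1 & p e (k.+1%:R^-1)].
  move=> k; apply: contrapT => ne; apply: gnD; exists k.+1%:R; split => // phi r Wphi pr.
  have r0 := seminorm_ge0 semip pr.
  rewrite leNgt; apply/negP => gr; apply: ne.
  have g0 : g phi != 0 by rewrite -cmod_gt0 (le_lt_trans _ gr)// mulr_ge0.
  exists ((g phi)^-1 *: phi); split.
  - exact: linsubZ.
  - by rewrite functionalZ// mulVf.
  - have := seminormZ semip (g phi)^-1 pr; apply: (seminormW semip).
    rewrite cmodV mulrC ler_pdivrMr ?cmod_gt0// mulrC ler_pdivlMr ?ltr0n//.
    by rewrite mulrC ltW.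
have hB k l phi r : W phi -> p phi r ->
    cmod (h phi - h (e k) * g phi) <= C * (r + cmod (g phi) * k.+1%:R^-1).
  move=> Wphi pr; have [We ge pe] := he k.
  have -> : h phi - h (e k) * g phi = h (phi - g phi *: e k).
    by rewrite functionalB// functionalZ// mulrC.
  apply: hC; last by apply: seminormB => //; exact: seminormZ.
  by split; [apply: linsubB => //; exact: linsubZ|rewrite /= functionalB// functionalZ// ge mulr1 subrr].
(* The values h (e k) are Cauchy because e k - e l lies in the kernel of g, where h is dominated. *)
have [|d hd] := @complex_limit R (h \o e) (fun k => C * k.+1%:R^-1).
  move=> k l; have [We ge pe] := he k; have [We' ge' pe'] := he l.
  rewrite /= -functionalB// -mulrDr; apply: hC; last exact: seminormB.
  by split; [exact: linsubB|rewrite /= functionalB// ge ge' subrr].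
exists d, C; split=> // phi r Wphi pr.
apply/ler_addgt0Pr => eps eps0.
pose Q := 3 * C * cmod (g phi).
have Q0 : 0 <= Q by rewrite !mulr_ge0// cmod_ge0.
pose k := Num.truncn (Q / eps).
have kQ : Q * k.+1%:R^-1 <= eps.
  rewrite ler_pdivrMr ?ltr0n// mulrC -ler_pdivrMr//.
  by rewrite ltW// truncnS_gt.
have -> : h phi - d * g phi = (h phi - h (e k) * g phi) + (h (e k) - d) * g phi by ring.
rewrite (le_trans (cmodD _ _))//.
apply: (@le_trans _ _ (C * (r + cmod (g phi) * k.+1%:R^-1) +
    (C * k.+1%:R^-1 + C * k.+1%:R^-1) * cmod (g phi))).
  rewrite lerD//; first exact: hB.
  by rewrite cmodM ler_wpM2r ?cmod_ge0//; exact: hd.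
by apply: le_trans (lerD (lexx (C * r)) kQ); rewrite /Q le_eqVlt; apply/orP; left; apply/eqP; ring.
Qed.

(** The common kernel of the first N functionals is itself a subspace, so the last functional is
    removed there by [dominated_codim1] and induction removes the others. *)
Lemma dominated_codim W (g : nat -> X -> R[i]^o) N h : linsub W ->
  (forall i, linear (g i)) -> linear h ->
  dominated (W `&` [set phi | forall i, (i < N)%N -> g i phi = 0]) p h ->
  exists b : nat -> R[i], dominated W p (fun phi => h phi - \sum_(i < N) b i * g i phi).
Proof.
move=> sW lg; elim: N h => [|N IHN] h lh [C [C0 hC]].
  exists (fun=> 0), C; split=> // phi r Wphi pr; rewrite big_ord0 subr0.
  by apply: hC => //; split.
have sW' : linsub (W `&` [set phi | forall i, (i < N)%N -> g i phi = 0]).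
  have [W0 Wl] := sW; split; first by split=> // i _; exact: functional0.
  move=> a phi psi [Wphi phi0] [Wpsi psi0]; split; first exact: Wl.
  by move=> i iN; rewrite lg phi0// psi0// scaler0 addr0.
have [|d hd] := @dominated_codim1 _ (g N) h sW' (lg N) lh.
  exists C; split=> // phi r [[Wphi phi0] gN] pr; apply: hC => //; split=> // i.
  by rewrite ltnS leq_eqVlt => /predU1P[->//|/phi0].
have [b [D [D0 hb]]] := IHN _ (functional_lin d lh (lg N)) hd.
exists (fun i => if (i < N)%N then b i else d), D; split=> // phi r Wphi pr.
rewrite big_ord_recr/= ltnn.
have -> : \sum_(i < N) (if (i < N)%N then b i else d) * g i phi =
    \sum_(i < N) b i * g i phi by apply: eq_bigr => i _; rewrite ltn_ord.
by rewrite opprD [- _ - d * _]addrC addrA; exact: hb.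
Qed.

(** Eidelheit's dichotomy. If no small element of the common kernel had g N = 1, then g N would be
    dominated on that kernel, hence on W modulo the other functionals. *)
Lemma dominated_or_approx W (g : nat -> X -> R[i]^o) N : linsub W ->
  (forall i, linear (g i)) ->
  (forall b : nat -> R[i],
    ~ dominated W p (fun phi => g N phi - \sum_(i < N) b i * g i phi)) ->
  forall c eps, 0 < eps -> exists phi, [/\ W phi,
    forall i, (i < N)%N -> g i phi = 0, g N phi = c & p phi eps].
Proof.
move=> sW lg nd c eps eps0.
have c1 : 0 < cmod c + 1 by rewrite ltr_wpDl// cmod_ge0.
suff [phi [Wphi phi0 phiN pphi]] : exists phi, [/\ W phi,
    forall i, (i < N)%N -> g i phi = 0, g N phi = 1 & p phi (eps / (cmod c + 1))].
  exists (c *: phi); split.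
  - exact: linsubZ.
  - by move=> i iN; rewrite (functionalZ _ _ (lg i)) phi0// mulr0.
  - by rewrite (functionalZ _ _ (lg N)) phiN mulr1.
  - have := seminormZ semip c pphi; apply: (seminormW semip).
    by rewrite mulrA ler_pdivrMr// mulrC ler_wpM2l ?ltW// ltrDl.
have d0 : 0 < eps / (cmod c + 1) by rewrite divr_gt0.
move: (eps / _) d0 => d d0; apply: contrapT => ne.
have [|b] := @dominated_codim W g N (g N) sW lg (lg N); last exact: nd.
exists d^-1; split; first by rewrite invr_ge0 ltW.
move=> phi r [Wphi phi0] pr; rewrite leNgt; apply/negP => gr; apply: ne.
have r0 := seminorm_ge0 semip pr.
have g0 : g N phi != 0 by rewrite -cmod_gt0 (le_lt_trans _ gr)// mulr_ge0// invr_ge0 ltW.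
exists ((g N phi)^-1 *: phi); split.
- exact: linsubZ.
- by move=> i iN; rewrite (functionalZ _ _ (lg i)) (phi0 i iN) mulr0.
- by rewrite (functionalZ _ _ (lg N)) mulVf.
- have := seminormZ semip (g N phi)^-1 pr; apply: (seminormW semip).
  rewrite cmodV mulrC ler_pdivrMr ?cmod_gt0// -ler_pdivrMl//.
  exact: ltW.
Qed.

End OneSeminorm.

End FiniteCodimension.

(** * Completeness of the Schwartz space, with a rate *)

Section Completeness.
Context {R : realType}.
Implicit Types (phi psi : schwartz R) (f g : R -> R) (K k n N M : nat) (x e : R).

Lemma small_geometric (A e : R) : 0 <= A -> 0 < e ->
  exists N0, forall N, (N0 <= N)%N -> A * 2 ^- N <= e.
Proof.
move=> A0 e0; exists (Num.truncn (A / e)) => N hN.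
rewrite ler_pdivrMr ?exprn_gt0// mulrC -ler_pdivrMr// ltW//.
apply: (lt_le_trans (truncnS_gt _)); rewrite -natrX ler_nat.
by apply: leq_ltn_trans hN _; exact: ltn_expl.
Qed.

Section RealSequence.
Variable F : nat -> R -> R.
Hypothesis rF : forall N, rschwartz (F N).
Hypothesis cF : forall K, exists n0, forall N, (n0 <= N)%N ->
  rbound K (fun x => -1 * F N x + F N.+1 x) (2 ^- N).

Let FS k n : exists n0, forall N x, (n0 <= N)%N ->
  `|x ^+ k * (Dn n (F N.+1) x - Dn n (F N) x)| <= 2 ^- N.
Proof.
have [n0 hn0] := cF (maxn k n); exists n0 => N x n0N.
have := hn0 N n0N k n x (leq_maxl _ _) (leq_maxr _ _).
by rewrite derive1n_lin; [rewrite mulN1r addrC|case: (rF N)|case: (rF N.+1)].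
Qed.

Let FD k n : exists n0, forall N M x, (n0 <= N)%N -> (N <= M)%N ->
  `|x ^+ k * (Dn n (F M) x - Dn n (F N) x)| <= 2 * 2 ^- N.
Proof.
have [n0 hn0] := FS k n; exists n0 => N M x n0N NM.
(* The exact geometric tail, strong enough for the induction on M - N. *)
apply: (@le_trans _ _ (2 * 2 ^- N - 2 * 2 ^- M)); last first.
  by rewrite gerBl mulr_ge0// invr_ge0 exprn_ge0.
rewrite -(subnKC NM); elim: (M - N)%N => [|d IHd].
  by rewrite addn0 !subrr mulr0 normr0.
have := hn0 (N + d)%N x (leq_trans n0N (leq_addr _ _)) => h.
rewrite addnS -(subrKA (Dn n (F (N + d)%N) x)) mulrDr.
rewrite (le_trans (ler_normD _ _))//.
apply: le_trans (lerD h IHd) _; rewrite exprS invfM mulrA divff// mul1r.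
by rewrite le_eqVlt; apply/orP; left; apply/eqP; ring.
Qed.

Let limF n x : exists y, exists n0, forall N, (n0 <= N)%N ->
  `|Dn n (F N) x - y| <= 2 * 2 ^- N.
Proof.
have [n0 hn0] := FD 0 n.
have p2 N : 0 <= 2 * 2 ^- N :> R by rewrite mulr_ge0// invr_ge0 exprn_ge0.
have [|y hy] := @real_limit R (fun N => Dn n (F N) x) (fun N => 2 * 2 ^- N) n0.
  move=> k l n0k n0l; wlog kl : k l n0k n0l / (k <= l)%N.
    move=> hw; have [kl|/ltnW lk] := leqP k l; first exact: hw.
    by rewrite distrC [leRHS]addrC; exact: hw.
  have := hn0 k l x n0k kl; rewrite mul1r distrC => /le_trans; apply.
  by rewrite lerDl.
by exists y, n0.
Qed.

Lemma rschwartz_complete : exists f, rschwartz f /\ forall K, exists n0,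
  forall N, (n0 <= N)%N -> rbound K (fun x => -1 * f x + F N x) (2 * 2 ^- N).
Proof.
have /choice[G hG] : forall p : nat * R, exists y, exists n0, forall N, (n0 <= N)%N ->
    `|Dn p.1 (F N) p.2 - y| <= 2 * 2 ^- N by move=> [n x]; exact: limF.
pose g n x := G (n, x).
have gP n x : exists n0, forall N, (n0 <= N)%N -> `|Dn n (F N) x - g n x| <= 2 * 2 ^- N.
  exact: hG (n, x).
have /choice[M hM] : forall n, exists B : R, exists N0, forall N x, (N0 <= N)%N ->
    `|Dn n (F N) x| <= B.
  move=> n; have [n0 hn0] := FD 0 n; have [_ /(_ n)[M hM]] := rF n0.
  exists (2 * 2 ^- n0 + M), n0 => N x n0N.
  rewrite -[Dn n (F N) x](subrK (Dn n (F n0) x)) (le_trans (ler_normD _ _))// lerD//.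
    by have := hn0 n0 N x (leqnn _) n0N; rewrite mul1r.
  by have := hM 0%N n x isT (leqnn n); rewrite mul1r.
have cg n x : Dn n (F N) x @[N --> \oo] --> g n x.
  apply/cvgrPdist_le => e e0; have [n0 hn0] := gP n x.
  have [N0 hN0] := small_geometric (ler0n R 2) e0.
  exists (maxn n0 N0) => // N /=; rewrite geq_max => /andP[n0N N0N].
  by rewrite distrC (le_trans (hn0 N n0N))// hN0.
have [sg dg] := smooth_limit (fun N => rschwartz_smooth (rF N)) hM cg.
have key k n : exists n0, forall N x, (n0 <= N)%N ->
    `|x ^+ k * (Dn n (F N) x - g n x)| <= 2 * 2 ^- N.
  have [n0 hn0] := FD k n; exists n0 => N x n0N.
  apply/ler_addgt0Pr => e e0; have [n1 hn1] := gP n x.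
  have [N0 hN0] := small_geometric (mulr_ge0 (normr_ge0 (x ^+ k)) (ler0n R 2)) e0.
  (* m may depend on x and e, for only the comparison of F N with F m has to be uniform; the
     remaining error at x is at most e even after weighting. *)
  pose m := maxn N (maxn n1 N0).
  rewrite -(subrKA (Dn n (F m) x)) mulrDr (le_trans (ler_normD _ _))// lerD//.
    by rewrite -normrN -mulrN opprB; apply: hn0 => //; exact: leq_maxl.
  rewrite normrM (le_trans (ler_wpM2l _ (hn1 m _)))//.
    by rewrite leq_max leq_maxl orbT.
  by rewrite mulrA hN0// leq_max leq_maxr orbT.
exists (g 0%N); split.
  apply: rschwartz_pointwise => // k n; have [n0 hn0] := key k n.
  have [_ /(_ (maxn k n))[B hB]] := rF n0.
  exists (2 * 2 ^- n0 + B) => x; rewrite dg.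
  rewrite -[g n x](subrK (Dn n (F n0) x)) mulrDr (le_trans (ler_normD _ _))// lerD//.
    by rewrite -normrN -mulrN opprB hn0.
  by apply: hB; [exact: leq_maxl|exact: leq_maxr].
move=> K; have /choice[m hm] : forall p : nat * nat, exists n0, forall N x, (n0 <= N)%N ->
    `|x ^+ p.1 * (Dn p.2 (F N) x - g p.2 x)| <= 2 * 2 ^- N.
  by move=> [k n]; exact: key.
exists (\max_(k < K.+1) \max_(n < K.+1) m (nat_of_ord k, nat_of_ord n)) => N mN k n x kK nK.
rewrite derive1n_lin//; last by case: (rF N).
rewrite dg mulN1r addrC; apply: (hm (k, n)); apply: leq_trans mN.
apply: leq_trans (leq_bigmax (Ordinal (kK : (k < K.+1)%N))).
exact: (leq_bigmax (Ordinal (nK : (n < K.+1)%N))).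
Qed.

End RealSequence.

Lemma re_lin1 phi psi : re (psi - phi : schwartz R) = (fun x => -1 * re phi x + re psi x).
Proof.
by apply/funext => x; rewrite addrC -scaleN1r re_lin /= oppr0 mul0r subr0.
Qed.

Lemma im_lin1 phi psi : im (psi - phi : schwartz R) = (fun x => -1 * im phi x + im psi x).
Proof.
by apply/funext => x; rewrite addrC -scaleN1r im_lin /= oppr0 mul0r addr0.
Qed.

Lemma schwartz_complete (F : nat -> schwartz R) :
  (forall K, exists n0, forall N, (n0 <= N)%N -> sbound K (F N.+1 - F N) (2 ^- N)) ->
  exists phi, forall K, exists n0, forall N, (n0 <= N)%N ->
    sbound K (F N - phi) (4 * 2 ^- N).
Proof.
move=> cF.
have [|f [rf hf]] := @rschwartz_complete (fun N => re (F N)) (fun N => rschwartz_re (F N)).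
  move=> K; have [n0 hn0] := cF K; exists n0 => N n0N.
  by rewrite -re_lin1; apply: sbound_re; exact: hn0.
have [|g [rg hg]] := @rschwartz_complete (fun N => im (F N)) (fun N => rschwartz_im (F N)).
  move=> K; have [n0 hn0] := cF K; exists n0 => N n0N.
  by rewrite -im_lin1; apply: sbound_im; exact: hn0.
pose phi : schwartz R := 'i%C *: sreal g + sreal f.
have rphi : re phi = f.
  apply/funext => x; rewrite re_lin !re_sreal// im_sreal//=.
  by rewrite mul0r mul1r oppr0 !add0r.
have iphi : im phi = g.
  apply/funext => x; rewrite im_lin !im_sreal// re_sreal//=.
  by rewrite mul0r mul1r add0r addr0.
exists phi => K; have [n0 hn0] := hf K; have [n1 hn1] := hg K.
exists (maxn n0 n1) => N; rewrite geq_max => /andP[n0N n1N].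
have -> : 4 * 2 ^- N = 2 * 2 ^- N + 2 * 2 ^- N :> R by ring.
apply: sbound_ReIm.
  by rewrite re_lin1 rphi; exact: hn0.
by rewrite im_lin1 iphi; exact: hn1.
Qed.

End Completeness.

(** * Eidelheit's criterion on S(0, oo) *)

Section Eidelheit.
Context {R : realType}.
Implicit Types (phi psi : schwartz R) (f : nat -> schwartz R -> R[i]^o) (K n N : nat).

Lemma schwartz_halfP phi : schwartz_half phi <->
  forall x, x < 0 -> re phi x = 0 /\ im phi x = 0.
Proof.
split=> [hphi x x0|h].
  by apply: tsupp_out => /hphi /=; rewrite leNgt x0.
have c0 : closed [set x : R | 0 <= x] by exact: closed_ge.
rewrite /schwartz_half /= (iffLR (closure_id _) c0).
apply: closure_subset => x /= px; rewrite leNgt; apply/negP => /h; rewrite /re /im => -[r0 i0].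
by move: px; rewrite [schwartz_fun phi x]complexE r0 i0 mulr0 addr0 eqxx.
Qed.

Lemma schwartz_half_linsub : linsub (@schwartz_half R).
Proof.
split; first by apply: (iffRL (schwartz_halfP 0)) => x _; rewrite /re /im.
move=> a phi psi hp hq; apply: (iffRL (schwartz_halfP _)) => x x0.
have [p0 p1] := iffLR (schwartz_halfP phi) hp x x0.
have [q0 q1] := iffLR (schwartz_halfP psi) hq x x0.
by rewrite re_lin im_lin p0 p1 q0 q1 !mulr0 subr0 !addr0.
Qed.

Lemma sbound_seminorm K : seminorm_rel (@sbound R K).
Proof.
split.
- by move=> phi r; exact: sbound_ge0.
- by move=> phi r s rs; exact: sboundW.
- by move=> a phi r; exact: sboundZ.
- move=> phi psi r s pr ps; have := sbound_lin 1 pr ps.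
  by rewrite scale1r cmod1 mul1r.
- exact: sbound_ex.
Qed.

(** The zero seminorm: to be dominated by it means to vanish, so plain linear independence becomes
    an instance of [dominated_or_approx]. *)
Lemma trivial_seminorm : seminorm_rel (fun (_ : schwartz R) (r : R) => 0 <= r).
Proof.
split=> //.
- by move=> _ r s rs r0; exact: le_trans rs.
- by move=> a _ r r0; rewrite mulr_ge0// cmod_ge0.
- by move=> _ _ r s r0 s0; rewrite addr_ge0.
- by move=> _; exists 0.
Qed.

Definition dependent f n : Prop := exists b : nat -> R[i],
  forall phi, schwartz_half phi -> f n phi = \sum_(i < n) b i * f i phi.

Definition top f K n : Prop := exists b : nat -> R[i],
  dominated schwartz_half (sbound K)
    ((fun phi => f n phi - \sum_(i < n) b i * f i phi) : schwartz R -> R[i]^o).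

Lemma topW f K K' n : (K <= K')%N -> top f K n -> top f K' n.
Proof.
move=> KK [b [C [C0 hC]]]; exists b, C; split=> // phi r hphi pr; apply: hC => //.
exact: sboundW pr.
Qed.

(** [pre n] tabulates the values below n and is [t0] elsewhere; H n never looks there, by its
    extensionality below n. *)
Lemma strong_recursion (T : Type) (t0 : T) (H : nat -> (nat -> T) -> T) :
  (forall n p q, (forall i, (i < n)%N -> p i = q i) -> H n p = H n q) ->
  exists a : nat -> T, forall n, a n = H n a.
Proof.
move=> Hext.
pose pre := fix pre n := if n is m.+1 then
  fun i => if i == m then H m (pre m) else pre m i else fun=> t0.
have preE n i : (i < n)%N -> pre n i = pre i.+1 i.
  elim: n => // n IHn; rewrite ltnS leq_eqVlt => /predU1P[->//|lin] /=.
  by rewrite (ltn_eqF lin) IHn.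
exists (fun n => pre n.+1 n) => n /=; rewrite eqxx; apply: Hext => i lin.
exact: preE.
Qed.

(* If infinitely many f n were tops, say with constants C n, choosing a n
   recursively so that a n exceeds the corresponding combination of the previous
   a i by n (C n + 1) would contradict the existence of phi. *)
Lemma moments_not_top f : (forall a : nat -> R[i], exists phi,
    schwartz_half phi /\ forall n, f n phi = a n) ->
  (forall n, ~ dependent f n) /\ forall K, exists nu, forall n, (nu <= n)%N -> ~ top f K n.
Proof.
move=> sol; split=> [n [b hb]|K].
  have [phi [hphi fphi]] := sol (fun i => (i == n)%:R).
  have := hb phi hphi; rewrite fphi eqxx big1 => [/eqP|i _].
    by rewrite oner_eq0.
  by rewrite fphi (ltn_eqF (ltn_ord i)) mulr0.
apply: contrapT => ntop.
have {ntop} tops nu : exists2 n, (nu <= n)%N & top f K n.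
  apply: contrapT => nn; apply: ntop; exists nu => n nun tn.
  by apply: nn; exists n.
have /choice[bC hbC] : forall n, exists bC : (nat -> R[i]) * R, top f K n -> 0 <= bC.2 /\
    forall phi r, schwartz_half phi -> sbound K phi r ->
      cmod (f n phi - \sum_(i < n) bC.1 i * f i phi) <= bC.2 * r.
  move=> n; have [[b [C [C0 hC]]]|ntn] := pselect (top f K n); first by exists (b, C).
  by exists (fun=> 0, 0).
pose H n (p : nat -> R[i]) : R[i] :=
  (n%:R * ((bC n).2 + 1))%:C + \sum_(i < n) (bC n).1 i * p i.
have [|a ha] := @strong_recursion _ 0 H.
  by move=> n p q pq; rewrite /H; congr (_ + _); apply: eq_bigr => i _; rewrite pq.
have [phi [hphi fphi]] := sol a; have [r pr] := sbound_ex K phi.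
have r0 := sbound_ge0 pr.
(* A top with n > r, whereas the choice of a n makes n (C + 1) at most C r, hence at most r (C +
   1). *)
have [n rn tn] := tops (Num.truncn r).+1.
have [C0 hC] := hbC n tn; have := hC phi r hphi pr.
rewrite fphi ha /H; under [X in _ - X]eq_bigr do rewrite fphi.
rewrite addrK cmod_real ger0_norm; last by rewrite mulr_ge0// addr_ge0.
move=> h; have : n%:R * ((bC n).2 + 1) <= r * ((bC n).2 + 1).
  by rewrite (le_trans h)// mulrDr mulrC mulr1 lerDl.
rewrite ler_pM2r ?ltr_wpDl// leNgt (lt_le_trans (truncnS_gt r))//.
by rewrite ler_nat.
Qed.

(** The n-th correction keeps the moments below n, sets the n-th one right, and is at most 2 ^ (-n)
    in every seminorm K <= n for which n is no top. For fixed K this covers all large n, so the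
    series of corrections converges in every seminorm. *)
Lemma not_top_moments f : (forall n, tempered (f n)) -> (forall n, ~ dependent f n) ->
  (forall K, exists nu, forall n, (nu <= n)%N -> ~ top f K n) ->
  forall a : nat -> R[i], exists phi, schwartz_half phi /\ forall n, f n phi = a n.
Proof.
move=> tf nd nt a; have lf n : linear (f n) by have [] := tf n.
have ap0 n c : exists psi, [/\ schwartz_half psi,
    forall i, (i < n)%N -> f i psi = 0 & f n psi = c].
  have [|psi [? ? ? _]] := @dominated_or_approx R _ _ trivial_seminorm _ f n
    schwartz_half_linsub lf _ c 1 ltr01; last by exists psi.
  move=> b [C [C0 hC]]; apply: (nd n); exists b => phi hphi.
  have := hC phi 0 hphi (lexx 0); rewrite mulr0 => h.
  by apply/eqP; rewrite -subr_eq0 -cmod_eq0 eq_le h cmod_ge0.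
have apK K n c e : 0 < e -> ~ top f K n -> exists psi, [/\ schwartz_half psi,
    forall i, (i < n)%N -> f i psi = 0, f n psi = c & sbound K psi e].
  move=> e0 ntK; apply: (dominated_or_approx (sbound_seminorm K)) => //.
    exact: schwartz_half_linsub.
  by move=> b hb; apply: ntK; exists b.
have step n psi : exists psi', [/\ schwartz_half psi',
    forall i, (i < n)%N -> f i psi' = 0, f n psi' = a n - f n psi &
    forall K, (K <= n)%N -> ~ top f K n -> sbound K psi' (2 ^- n)].
  have e0 : 0 < 2 ^- n :> R by rewrite invr_gt0 exprn_gt0.
  (* Seminorms increase with K, so a correction small for the largest admissible K <= m is small for
     all smaller ones; the induction on m finds that K. *)
  suff H m : exists psi', [/\ schwartz_half psi',
      forall i, (i < n)%N -> f i psi' = 0, f n psi' = a n - f n psi &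
      forall K, (K <= m)%N -> ~ top f K n -> sbound K psi' (2 ^- n)] by exact: H.
  elim: m => [|m [psi' [h1 h2 h3 h4]]].
    have [t0|nt0] := pselect (top f 0 n).
      have [psi' [h1 h2 h3]] := ap0 n (a n - f n psi).
      by exists psi'; split => // K; rewrite leqn0 => /eqP ->.
    have [psi' [h1 h2 h3 h4]] := apK 0%N n (a n - f n psi) _ e0 nt0.
    by exists psi'; split => // K; rewrite leqn0 => /eqP ->.
  have [tm|ntm] := pselect (top f m.+1 n).
    exists psi'; split => // K; rewrite leq_eqVlt => /predU1P[->//|]; exact: h4.
  have [psi2 [g1 g2 g3 g4]] := apK m.+1 n (a n - f n psi) _ e0 ntm.
  by exists psi2; split => // K Km _; exact: sboundW g4.
have /choice[s hs] : forall p : nat * schwartz R, exists psi', [/\ schwartz_half psi',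
    forall i, (i < p.1)%N -> f i psi' = 0, f p.1 psi' = a p.1 - f p.1 p.2 &
    forall K, (K <= p.1)%N -> ~ top f K p.1 -> sbound K psi' (2 ^- p.1)].
  by move=> [n psi]; exact: step.
pose F := fix F n := if n is m.+1 then F m + s (m, F m) else 0.
have lfD n phi psi : f n (phi + psi) = f n phi + f n psi.
  by have := lf n 1 phi psi; rewrite !scale1r.
have hF n : schwartz_half (F n) /\ forall i, (i < n)%N -> f i (F n) = a i.
  elim: n => [|n [hFn fF]]; first by split=> //; case: schwartz_half_linsub.
  have [h1 h2 h3 h4] := hs (n, F n); split=> [|i].
    have [_ sl] := schwartz_half_linsub; rewrite /= addrC -[s _]scale1r.
    exact: sl.
  rewrite ltnS leq_eqVlt /= lfD => /predU1P[->|lin].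
    by rewrite h3 /= addrC subrK.
  by rewrite fF// h2// addr0.
have [|phi hphi] := @schwartz_complete R F.
  move=> K; have [nu hnu] := nt K; exists (maxn K nu) => N.
  rewrite geq_max => /andP[KN nuN]; have [_ _ _] := hs (N, F N).
  by rewrite /= addrC addKr; apply => //; exact: hnu.
exists phi; split=> [|n].
  apply: (iffRL (schwartz_halfP phi)) => x x0; have [n0 hn0] := hphi 0%N.
  have lim0 (y : R) : (forall N, (n0 <= N)%N -> `|y| <= 4 * 2 ^- N) -> y = 0.
    move=> hy; apply/eqP; rewrite -normr_le0; apply/ler_addgt0Pr => e e0; rewrite add0r.
    have [N0 hN0] := small_geometric (ler0n R 4) e0.
    apply: (le_trans (hy (maxn n0 N0) (leq_maxl _ _))); apply: hN0; exact: leq_maxr.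
  have FN0 N := iffLR (schwartz_halfP (F N)) (hF N).1 x x0.
  split; apply: lim0 => N n0N.
    have := sbound_re (hn0 N n0N) (k := 0%N) (n := 0%N) x isT isT.
    by rewrite mul1r re_lin1 /= (FN0 N).1 addr0 mulN1r normrN.
  have := sbound_im (hn0 N n0N) (k := 0%N) (n := 0%N) x isT isT.
  by rewrite mul1r im_lin1 /= (FN0 N).2 addr0 mulN1r normrN.
have [K [C [C0 hC]]] := continuous_sbound (lf n) (tf n).2.
have [n0 hn0] := hphi K.
apply/eqP; rewrite -subr_eq0 -cmod_eq0 eq_le cmod_ge0 andbT.
apply/ler_addgt0Pr => e e0; rewrite add0r.
have [N0 hN0] := small_geometric (mulr_ge0 C0 (ler0n R 4)) e0.
pose N := maxn n.+1 (maxn n0 N0).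
have nN : (n < N)%N by exact: leq_maxl.
rewrite -((hF N).2 n nN) -cmodN opprB -functionalB//.
rewrite (le_trans (hC _ _ (hn0 N _)))//; first by rewrite leq_max leq_maxl orbT.
by rewrite mulrA hN0// leq_max leq_maxr orbT.
Qed.

End Eidelheit.

(** * Distributions with Cesaro estimates are dominated by a seminorm *)

Section RegularDistributions.
Context {R : realType}.
Implicit Types (u v : schwartz R -> R[i]^o) (g : R -> R[i]^o) (f h : R -> R).
Implicit Types (a b c d e r s x y Q : R) (U : set R) (K k n m : nat).
Local Notation mu := (@lebesgue_measure R).

Lemma ReM_real (z : R[i]) x : Re (z * x%:C) = Re z * x.
Proof. by case: z => p q /=; rewrite mulr0 subr0. Qed.

Lemma ImM_real (z : R[i]) x : Im (z * x%:C) = Im z * x.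
Proof. by case: z => p q /=; rewrite mulr0 add0r. Qed.

Lemma regular_bound U g v a b h Q : measurable U -> regular_on U g v ->
  testfun a b h -> `[a, b] `<=` U ->
  (forall x, U x -> cmod (g x) * `|h x| <= Q * (oneDsqr x)^-1) ->
  cmod (ev v h) <= 2 * (`|Q| * pi).
Proof.
move=> mU [[[mr _ _] [mi _ _]] reg] th abU gh.
have rh := testfun_rschwartz th.
rewrite /ev reg; last 2 first.
- exact: compact_tsupp_sreal th.
- by apply: subset_trans abU; exact: tsupp_sreal.
have mh : measurable_fun U h.
  apply: measurable_funTS; apply: continuous_measurable_fun.
  by apply: smooth_continuous; exact: testfun_smooth th.
have -> : g * (sreal h : R -> R[i]^o) = (fun x => g x * (h x)%:C) by rewrite srealE.
rewrite (le_trans (cmod_le_ReIm _))// mulr_natl mulr2n lerD// /cintegral/=.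
- have [] := @decay_integral R U (fun x => Re (g x * (h x)%:C)) Q mU.
  + under eq_fun do rewrite ReM_real.
    exact: measurable_funM.
  + move=> x Ux; rewrite ReM_real normrM; apply: le_trans (gh x Ux).
    by rewrite ler_wpM2r// Re_le_cmod.
  by [].
- have [] := @decay_integral R U (fun x => Im (g x * (h x)%:C)) Q mU.
  + under eq_fun do rewrite ImM_real.
    exact: measurable_funM.
  + move=> x Ux; rewrite ImM_real normrM; apply: le_trans (gh x Ux).
    by rewrite ler_wpM2r// Im_le_cmod.
  by [].
Qed.

Lemma cmod_continuous g x : {for x, continuous g} -> {for x, continuous (cmod \o g)}.
Proof.
move=> /cvgrPdist_le cg; apply/cvgrPdist_le => e e0.
have eC : 0 < e%:C :> R[i] by rewrite ltcR.
apply: filterS (cg _ eC) => y; rewrite cmod_le => gxy.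
apply: le_trans gxy; rewrite ler_norml; apply/andP; split.
  have E : cmod (g y - g x) = cmod (g x - g y) by rewrite -cmodN opprB.
  have := cmodD (g x) (g y - g x); rewrite [g x + _]addrC subrK E => h; lra.
have := cmodD (g y) (g x - g y); rewrite [g y + _]addrC subrK => h; lra.
Qed.

Lemma horner_bound (P : {poly R[i]}) : exists2 B, 0 <= B &
  (forall x, 0 <= x <= 1 -> cmod P.[x%:C] <= B) /\
  (forall x, 1 <= x -> cmod P.[x%:C] <= B * x ^+ size P).
Proof.
pose B : R := \sum_(i < size P) cmod P`_i.
have hB x : 0 <= x -> cmod P.[x%:C] <= \sum_(i < size P) cmod P`_i * x ^+ i.
  move=> x0; rewrite horner_coef.
  elim/big_ind2: _ => [|z1 x1 z2 x2 h1 h2|i _]; first by rewrite cmod0.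
    by rewrite (le_trans (cmodD _ _))// lerD.
  by rewrite cmodM -rmorphXn/= cmod_real ger0_norm// exprn_ge0.
exists B; first by rewrite sumr_ge0// => i _; exact: cmod_ge0.
split=> [x /andP[x0 x1]|x x1].
  rewrite (le_trans (hB x x0))// ler_sum// => i _.
  by rewrite ler_piMr ?cmod_ge0// exprn_ile1.
rewrite (le_trans (hB x (le_trans ler01 x1)))// mulr_suml ler_sum// => i _.
by rewrite ler_wpM2l ?cmod_ge0// ler_weXn2l// ltnW.
Qed.

Lemma near_at_right0 (P : set R) : (\forall x \near 0^'+, P x) ->
  exists2 d, 0 < d & forall x, 0 < x < d -> P x.
Proof.
rewrite /at_right near_withinE => -[d d0 hd]; exists d => // x /andP[x0 xd].
by apply: hd => //=; rewrite sub0r normrN gtr0_norm.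
Qed.

(** For 0 < x < 1 both x ^ (- alpha + m) and 1 are at most x ^ (-A), so the polynomial, bounded
    there, is absorbed too. *)
Lemma cesaro_zero_growth alpha (A m : nat) u : alpha <= A%:R -> cesaro_zero alpha m u ->
  exists delta d g C, [/\ 0 < d <= 1, d <= delta, 0 <= C,
    regular_on `]0, delta[ g (primitive m u) &
    forall x, 0 < x < d -> cmod (g x) <= C * x ^- A].
Proof.
move=> aA [delta [g [P [M [delta0 reg sP /near_at_right0[d d0 hd]]]]]].
have [B B0 [hB _]] := horner_bound P.
exists delta, (Num.min d (Num.min 1 delta)), g, (`|M| + B); split=> //.
- by rewrite !lt_min d0 ltr01 delta0 !ge_min lexx orbT.
- by rewrite !ge_min lexx !orbT.
- by rewrite addr_ge0.
move=> x /andP[x0]; rewrite !lt_min => /and3P[xd x1 _].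
have x01 : 0 < x <= 1 by rewrite x0 ltW.
have p1 : x `^ (- alpha + m%:R) <= x ^- A.
  rewrite -powR_invn ?(ltW x0)//; apply: ger_powR => //.
  by rewrite -[leLHS]addr0 lerD// lerN2.
have p2 : 1 <= x ^- A by rewrite invf_ge1 ?exprn_gt0// exprn_ile1// ltW.
rewrite -[g x](subrK P.[x%:C]) (le_trans (cmodD _ _))// mulrDl lerD//.
  have := hd x; rewrite x0 xd => /(_ isT); rewrite cmod_le => /le_trans; apply.
  apply: le_trans (ler_wpM2r (powR_ge0 _ _) (ler_norm M)) _.
  by rewrite ler_wpM2l.
by rewrite (le_trans (hB x _)) ?(ltW x0) ?(ltW x1)// ler_peMr.
Qed.

(** For x >= 1 the polynomial is at most a constant times x ^ m, because its size is at most m, and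
    is absorbed in x ^ (A + m). *)
Lemma cesaro_pinfty_growth alpha (A m : nat) u : alpha <= A%:R -> cesaro_pinfty alpha m u ->
  exists B X g C, [/\ 1 <= X, B < X, 0 <= C,
    regular_on `]B, +oo[ g (primitive m u) &
    forall x, X <= x -> cmod (g x) <= C * x ^+ (A + m)].
Proof.
move=> aA [B [g [P [M [reg sP [X0 [_ hX]]]]]]].
have [D D0 [_ hD]] := horner_bound P.
pose X := Num.max (X0 + 1) (Num.max 1 (B + 1)).
exists B, X, g, (`|M| + D); split=> //.
- by rewrite /X !le_max lexx orbT.
- by rewrite /X !lt_max ltrDl ltr01 !orbT.
- by rewrite addr_ge0.
move=> x; rewrite /X !ge_max => /and3P[xX x1 _].
have x0 : 0 <= x by exact: le_trans x1.
have p1 : x `^ (alpha + m%:R) <= x ^+ (A + m).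
  by rewrite -powR_mulrn// natrD; apply: ler_powR => //; rewrite lerD2r.
rewrite -[g x](subrK P.[x%:C]) (le_trans (cmodD _ _))// mulrDl lerD//.
  have := hX x; rewrite (lt_le_trans _ xX) ?ltrDl// => /(_ isT).
  rewrite cmod_le => /le_trans; apply.
  apply: le_trans (ler_wpM2r (powR_ge0 _ _) (ler_norm M)) _.
  by rewrite ler_wpM2l.
rewrite (le_trans (hD x x1))// ler_wpM2l// ler_weXn2l//.
by rewrite (leq_trans sP)// leq_addl.
Qed.

Lemma rbound_deriven m K f r : rbound (K + m)%N f r -> rbound K (Dn m f) r.
Proof.
move=> fr k n x kK nK; rewrite derive1n_add; apply: fr.
  by rewrite (leq_trans kK)// leq_addr.
by rewrite leq_add2r.
Qed.

Lemma cmod_sign n : cmod ((-1) ^+ n : R[i]) = 1.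
Proof.
by elim: n => [|n IHn]; rewrite ?cmod1// exprS mulN1r cmodN.
Qed.

Lemma step_norm x : `|step x| <= 1 :> R.
Proof. by have /andP[? ?] := step_bound x; rewrite ger0_norm. Qed.

Lemma one_minus_norm x y : 0 <= x <= 1 -> 0 <= y <= 1 ->
  `|-1 * x + (-1 * y + 1)| <= 1.
Proof. by move=> /andP[? ?] /andP[? ?]; rewrite ler_norml; apply/andP; split; lra. Qed.

Lemma oneDsqr_mono Q c x : 0 <= Q -> 0 <= x <= c -> Q <= Q * oneDsqr c * (oneDsqr x)^-1.
Proof.
move=> Q0 /andP[x0 xc]; rewrite ler_pdivlMr ?(lt_le_trans _ (oneDsqr_ge1 _))//.
by rewrite ler_wpM2l// /oneDsqr lerD2l lerXn2r ?nnegrE// (le_trans x0).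
Qed.

(* On each of the three regions (near 0, middle, near infinity) a cut of the
   m-th derivative of f is integrated against the corresponding density. *)
Lemma cesaro_testfun_bound alpha (m : nat) : exists K, forall u, tempered_half u ->
  cesaro_pinfty alpha m u -> continuous_on_pos (primitive m u) -> cesaro_zero alpha m u ->
  exists2 C, 0 <= C & forall a b f r, 0 < a -> testfun a b f -> rbound K f r ->
    cmod (ev u f) <= C * r.
Proof.
pose A := (Num.truncn alpha).+1.
have aA : alpha <= A%:R by rewrite ltW// truncnS_gt.
(* m derivatives lead to [th], A + m powers balance the growth at infinity and two more make the
   product integrable; the A derivatives used near 0 fit in as well. *)
exists ((A + m).+2 + m)%N => u hu cinf [gc [cgc regc]] czero.
have [delta [d [g0 [C0 [/andP[d0 d1] ddelta C00 reg0 hg0]]]]] := cesaro_zero_growth aA czero.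
have [B [X [g1 [C1 [X1 BX C10 reg1 hg1]]]]] := cesaro_pinfty_growth aA cinf.
have [Cm Cm0 hCm] : exists2 Cm, 0 <= Cm &
    forall x, d / 2 <= x <= X + 1 -> cmod (gc x) <= Cm.
  have dX : d / 2 <= X + 1.
    rewrite (@le_trans _ _ 1)//; last by rewrite (le_trans X1)// lerDl.
    by rewrite ler_pdivrMr// mul1r (le_trans d1)// ler1n.
  have [|c _ hc] := @EVT_max R (cmod \o gc) _ _ dX.
    apply: continuous_in_subspaceT => x; rewrite inE/= in_itv/= => /andP[dx _].
    by apply: cmod_continuous; apply: cgc; apply: lt_le_trans dx; rewrite divr_gt0.
  by exists (cmod (gc c)); [exact: cmod_ge0|move=> x xdX; apply: hc; rewrite in_itv].
pose Q := 2 * C0 + C1 * 2 + Cm * oneDsqr (X + 1).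
have q0 : 0 <= 2 * C0 by rewrite mulr_ge0.
have q1 : 0 <= C1 * 2 by rewrite mulr_ge0.
have q2 : 0 <= Cm * oneDsqr (X + 1).
  by rewrite mulr_ge0// (le_trans ler01)// oneDsqr_ge1.
exists (2 * (Q * pi)) => [|a b f r a0 tf fr].
  by rewrite mulr_ge0// mulr_ge0 ?pi_ge0// /Q !addr_ge0.
have r0 := rbound_ge0 fr.
have sf := testfun_smooth tf; have rf := testfun_rschwartz tf.
have [[lu _] _] := hu; set v := primitive m u in reg0 reg1 regc.
have vE : v = iter m dist_prim u by rewrite /v primitiveE.
have hv : tempered_half v by rewrite vE; exact: iter_dist_prim_half.
have [[lv _] _] := hv.
pose th := Dn m f; have tth : testfun a b th by exact: testfun_deriven.
have ufE : ev u f = (-1) ^+ m * ev v th.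
  by rewrite -ev_iter_derive// vE iter_dist_primK.
have fr0 : rbound (A + m).+2 th r by exact: rbound_deriven.
(* [chi0] falls from 1 at d/2 to 0 at 3d/4, so its part stays inside ]0, delta[; [chi1] rises from 0
   at X to 1 at X + 1. *)
pose chi0 x := step (- (4 / d) * x + 3).
pose chi1 x := step (1 * x + - X).
have s0 : smooth chi0 by apply: smooth_affine; exact: smooth_step.
have s1 : smooth chi1 by apply: smooth_affine; exact: smooth_step.
have chi0_1 x : x <= d / 2 -> chi0 x = 1.
  move=> xd; rewrite /chi0 step_eq1//.
  suff : 4 / d * x <= 2 by lra.
  by rewrite mulrAC ler_pdivrMr//; lra.
have chi0_0 x : 3 * d / 4 <= x -> chi0 x = 0.
  move=> xd; rewrite /chi0 step_eq0//.
  suff : 3 <= 4 / d * x by lra.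
  by rewrite mulrAC ler_pdivlMr//; lra.
have chi1_0 x : x <= X -> chi1 x = 0 by move=> ?; rewrite /chi1 step_eq0//; lra.
have chi1_1 x : X + 1 <= x -> chi1 x = 1 by move=> ?; rewrite /chi1 step_eq1//; lra.
pose h0 x := chi0 x * th x; pose h1 x := chi1 x * th x.
pose h2 x := (-1 * chi0 x + (-1 * chi1 x + 1)) * th x.
have sth : smooth th := testfun_smooth tth.
have thE x : ~~ (a <= x <= b) -> th x = 0 by exact: (testfun_out tth).
have t0 : testfun a (3 * d / 4) h0.
  split=> [|x]; first exact: smooth_mul.
  rewrite negb_and -!ltNge => /orP[xa|xd]; last by rewrite /h0 chi0_0 ?mul0r// ltW.
  by rewrite /h0 thE ?mulr0// negb_and -!ltNge xa.
have t1 : testfun X b h1.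
  split=> [|x]; first exact: smooth_mul.
  rewrite negb_and -!ltNge => /orP[xX|bx]; first by rewrite /h1 chi1_0 ?mul0r// ltW.
  by rewrite /h1 thE ?mulr0// negb_and -!ltNge bx orbT.
have t2 : testfun (d / 2) (X + 1) h2.
  split=> [|x].
    apply: smooth_mul => //; apply: smooth_lin => //; apply: smooth_lin => //.
    exact: smooth_cst.
  rewrite negb_and -!ltNge => /orP[xd|Xx].
    by rewrite /h2 chi0_1 ?(ltW xd)// chi1_0; [ring|lra].
  by rewrite /h2 chi1_1 ?(ltW Xx)// chi0_0; [ring|lra].
have thsum : th = (fun x => 1 * h0 x + (1 * h1 x + h2 x)).
  by apply/funext => x; rewrite /h0 /h1 /h2; ring.
have rh0 := testfun_rschwartz t0; have rh1 := testfun_rschwartz t1.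
have rh2 := testfun_rschwartz t2.
have -> : cmod (ev u f) = cmod (ev v th).
  by rewrite ufE cmodM cmod_sign mul1r.
rewrite thsum ev_lin//; last exact: rschwartz_lin.
rewrite ev_lin// !mul1r.
have b0 : cmod (ev v h0) <= 2 * (`|2 * C0 * r| * pi).
  apply: (@regular_bound `]0, delta[ g0 v _ _ h0 _ _ reg0 t0) => //.
    by move=> x /=; rewrite !in_itv/= => /andP[ax xd]; apply/andP; split; lra.
  move=> x /=; rewrite in_itv/= => /andP[x0 _].
  have [xd|dx] := ltP x d; last first.
    rewrite /h0 chi0_0; last by lra.
    by rewrite mul0r normr0 mulr0 divr_ge0// ?mulr_ge0// (le_trans ler01)// oneDsqr_ge1.
  (* The singularity x ^ (-A) of the density is cancelled by Taylor's formula for f, which vanishes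
     near 0. *)
  apply: (@le_trans _ _ (C0 * x ^- A * (1 * (x ^+ A * r)))).
    rewrite ler_pM ?cmod_ge0//; first by apply: hg0; rewrite x0.
    rewrite normrM ler_pM// ?step_norm//.
    apply: taylor_vanish => //; [exact: ltW| | |].
    - by apply: (@derive1n_lt0 _ f 0 a) => // y ya; apply: (testfun_out tf); rewrite negb_and -!ltNge ya.
    - move=> i; apply: (@derive1n_lt0 _ f 0 a) => // y ya.
      by apply: (testfun_out tf); rewrite negb_and -!ltNge ya.
    - move=> y _; have := fr 0%N (m + A)%N y isT; rewrite mul1r; apply.
      by apply: leq_trans (leq_addr m _); rewrite addnC; do 2 apply: leqW.
  have -> : C0 * x ^- A * (1 * (x ^+ A * r)) = C0 * r.
    by field; rewrite expf_neq0// gt_eqF.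
  have := @oneDsqr_mono (C0 * r) 1 x (mulr_ge0 C00 r0).
  rewrite (ltW x0) (le_trans (ltW xd) d1) => /(_ isT).
  by rewrite /oneDsqr expr1n [C0 * r * _]mulrC mulrA.
have b1 : cmod (ev v h1) <= 2 * (`|C1 * (2 * r)| * pi).
  apply: (@regular_bound `]B, +oo[ g1 v _ _ h1 _ _ reg1 t1) => //.
    by move=> x /=; rewrite !in_itv/= andbT => /andP[ax _]; lra.
  move=> x /=; rewrite in_itv/= andbT => x0.
  have [xX|Xx] := ltP x X.
    rewrite /h1 (chi1_0 _ (ltW xX)) mul0r normr0 mulr0 mulr_ge0 ?invr_ge0//.
    by rewrite !mulr_ge0.
  apply: (@le_trans _ _ (C1 * x ^+ (A + m) * (1 * `|th x|))).
    rewrite ler_pM ?cmod_ge0//; first exact: hg1.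
    by rewrite normrM ler_wpM2r// step_norm.
  rewrite mul1r -!mulrA ler_wpM2l// mulrA.
  have := rbound_decay x (leqnn (A + m)) fr0; rewrite normrM ger0_norm//.
  by rewrite exprn_ge0// (le_trans _ Xx)// (le_trans _ X1).
have b2 : cmod (ev v h2) <= 2 * (`|Cm * r * oneDsqr (X + 1)| * pi).
  apply: (@regular_bound `]0, +oo[ gc v _ _ h2 _ _ regc t2) => //.
    move=> x /=; rewrite !in_itv/= andbT => /andP[ax _].
    by apply: lt_le_trans ax; rewrite divr_gt0.
  move=> x /=; rewrite in_itv/= andbT => x0.
  have [xdX|xo] := boolP (d / 2 <= x <= X + 1); last first.
    rewrite (testfun_out t2)// normr0 mulr0 mulr_ge0 ?invr_ge0//.
    by rewrite !mulr_ge0// (le_trans ler01)// oneDsqr_ge1.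
  apply: (@le_trans _ _ (Cm * (1 * r))).
    rewrite ler_pM ?cmod_ge0//; first exact: hCm.
    rewrite normrM ler_pM//.
      by apply: one_minus_norm; exact: step_bound.
    by have := fr0 0%N 0%N x isT isT; rewrite mul1r.
  rewrite mul1r; apply: oneDsqr_mono; first exact: mulr_ge0.
  by rewrite (ltW x0); case/andP: xdX.
have -> : 2 * (Q * pi) * r = 2 * (`|2 * C0 * r| * pi) +
    (2 * (`|C1 * (2 * r)| * pi) + 2 * (`|Cm * r * oneDsqr (X + 1)| * pi)).
  have n0 : 0 <= 2 * C0 * r by rewrite mulr_ge0.
  have n1 : 0 <= C1 * (2 * r) by rewrite mulrA mulr_ge0.
  have n2 : 0 <= Cm * r * oneDsqr (X + 1) by rewrite mulrAC mulr_ge0.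
  by rewrite (ger0_norm n0) (ger0_norm n1) (ger0_norm n2) /Q; ring.
rewrite (le_trans (cmodD _ _))// lerD// (le_trans (cmodD _ _))// lerD//.
Qed.

Lemma schwartz_half_le0 phi : schwartz_half phi ->
  (forall x, x <= 0 -> re phi x = 0) /\ (forall x, x <= 0 -> im phi x = 0).
Proof.
move=> /schwartz_halfP h.
have hr y : y < 0 -> re phi y = 0 by move=> /h[].
have hi y : y < 0 -> im phi y = 0 by move=> /h[].
split=> x; rewrite le_eqVlt => /predU1P[->|/h[]//].
  exact: (smooth_vanish_left (rschwartz_smooth (rschwartz_re phi)) hr 0).
exact: (smooth_vanish_left (rschwartz_smooth (rschwartz_im phi)) hi 0).
Qed.

(** u is continuous for some seminorm L, perhaps stronger than K. Approximating in both at once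
    makes the L-error small and leaves the K-bound with constant C; real and imaginary parts double
    it. *)
Lemma dominated_testfun u K C : tempered u -> 0 <= C ->
  (forall a b f r, 0 < a -> testfun a b f -> rbound K f r -> cmod (ev u f) <= C * r) ->
  dominated (@schwartz_half R) (sbound K) u.
Proof.
move=> tu C0 hC; have [lu _] := tu; have [L [D [D0 hD]]] := ev_bound tu.
have key f r : rschwartz f -> (forall x, x <= 0 -> f x = 0) -> rbound K f r ->
    cmod (ev u f) <= C * r.
  move=> rf f0 fr; apply/ler_addgt0Pr => e e0.
  have CD : 0 < C + D + 1 by rewrite ltr_wpDl// addr_ge0.
  pose d := e / (C + D + 1); have d0 : 0 < d by rewrite divr_gt0.
  have [a [b [g [a0 _ tg gf]]]] := positive_approx (maxn K L) rf f0 d0.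
  have rg := testfun_rschwartz tg; have rd := rschwartz_lin (-1) rg rf.
  have sg := rschwartz_smooth rg; have sf := rschwartz_smooth rf.
  have gE : g = (fun x => -1 * (-1 * g x + f x) + f x) by apply/funext => x; ring.
  have fE : f = (fun x => 1 * g x + (-1 * g x + f x)) by apply/funext => x; ring.
  have gr : rbound K g (d + r).
    have gf' := rboundW (leq_maxl K L) (lexx d) gf.
    have := rbound_lin (-1) (smooth_lin (-1) sg sf) sf gf' fr.
    by rewrite normrN1 mul1r -gE.
  rewrite {1}fE ev_lin// mul1r (le_trans (cmodD _ _))//.
  apply: (@le_trans _ _ (C * (d + r) + D * d)).
    rewrite lerD//; first exact: hC tg gr.
    by apply: hD => //; apply: rboundW gf => //; exact: leq_maxr.
  have dE : (C + D + 1) * d = e by rewrite mulrC divfK// gt_eqF.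
  by rewrite -dE; nra.
exists (C + C); split=> [|phi r hphi pr]; first exact: addr_ge0.
have [p0 p1] := schwartz_half_le0 hphi.
rewrite ev_split// (le_trans (cmodD _ _))// cmodM cmod_i mul1r mulrDl lerD// key//.
- exact: rschwartz_im.
- exact: sbound_im.
- exact: rschwartz_re.
- exact: sbound_re.
Qed.

End RegularDistributions.

(** * Distributions dominated by a seminorm have a continuous primitive *)

Section OrderReduction.
Context {R : realType}.
Implicit Types (u v w : schwartz R -> R[i]^o) (f h psi : R -> R).
Implicit Types (a b c d e r s t x y X M C : R) (K k n m j L : nat).

Lemma testfun_sup1 a b f X M : testfun a b f -> 0 <= a -> b <= X -> 0 <= X ->
  (forall x, `|D1 f x| <= M) -> forall x, `|f x| <= X * M.
Proof.
move=> tf a0 bX X0 fM x; have sf := testfun_smooth tf.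
have M0 : 0 <= M by rewrite (le_trans _ (fM 0)).
have [xab|xo] := boolP (a <= x <= b); last first.
  by rewrite (testfun_out tf)// normr0 mulr_ge0.
have f0 : f 0 = 0.
  move: a0; rewrite le_eqVlt => /predU1P[a0|a0]; last first.
    by apply: (testfun_out tf); rewrite negb_and -!ltNge a0.
  apply: (@smooth_vanish_left R f 0 sf _ 0%N) => y y0.
  by apply: (testfun_out tf); rewrite negb_and -!ltNge -a0 y0.
have x0 : 0 <= x by case/andP: xab => ax _; exact: le_trans ax.
have := @mvt_bound R f (D1 f) 0 x M x0 (fun y _ => smooth_is_derive y sf) (fun y _ => fM y).
rewrite f0 !subr0 => /le_trans; apply; rewrite mulrC ler_wpM2r//.
by case/andP: xab => _ xb; exact: le_trans bX.
Qed.

(** Each of the i integrations from 0 runs over a length at most X. *)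
Lemma testfun_sup j i a b f X M : testfun a b f -> 0 <= a -> b <= X -> 0 <= X ->
  (i <= j)%N -> (forall x, `|Dn j f x| <= M) ->
  forall x, `|Dn (j - i) f x| <= X ^+ i * M.
Proof.
move=> tf a0 bX X0 ij fM; elim: i ij => [|i IHi] ij x; first by rewrite subn0 mul1r.
rewrite exprS -mulrA; apply: (@testfun_sup1 a b _ X) => // [|y].
  exact: testfun_deriven.
by rewrite -[D1 _]/(Dn (j - i.+1).+1 f) -subSn// subSS; apply: IHi; exact: ltnW.
Qed.

Definition rstep x : R := step (1 * x + -1).
(** A bump on [1, 2] of integral 1, since its antiderivative [rstep] goes from 0 to 1 there. *)
Definition omega : R -> R := D1 rstep.

Lemma smooth_rstep : smooth rstep.
Proof. by apply: smooth_affine; exact: smooth_step. Qed.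

Lemma testfun_omega : testfun 1 2 omega.
Proof.
split=> [|x]; first by apply: smooth_derive; exact: smooth_rstep.
move=> xo; rewrite /omega /rstep.
have [_ ->] := derive1_affine 1 (-1) (@smooth_step R 0%N).
rewrite addr0 mul1r; apply: (@derive_step_out R 0).
by move: xo; rewrite mul1r subr_ge0 lerBlDr.
Qed.

Lemma rstep_norm x : `|rstep x| <= 1.
Proof. exact: step_norm. Qed.

(** With c the integral of f, the function f - c omega has integral 0, so its antiderivative psi is
    again a test function. *)
Lemma omega_decomposition a b f M : 0 < a -> a <= b -> testfun a b f ->
  (forall x, `|f x| <= M) -> exists F c psi, [/\
    [/\ smooth F, D1 F = f, forall x, x <= a -> F x = 0 & forall x, b <= x -> F x = c],
    testfun (Num.min a 1) (Num.max b 2) psi,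
    f = (fun x => c * omega x + D1 psi x),
    `|c| <= M * (b - a) & forall x, `|psi x| <= 2 * (M * (b - a))].
Proof.
move=> a0 ab tf fM.
have [F [sF dF F0 Fb FM]] := testfun_antiderivative ab tf fM.
have sr := smooth_rstep.
exists F, (F b), (fun x => - F b * rstep x + F x); split=> //.
- split=> [|x]; first exact: smooth_lin.
  rewrite negb_and -!ltNge lt_min gt_max => /orP[/andP[xa x1]|/andP[bx x2]].
    rewrite (F0 x (ltW xa)) addr0 /rstep step_eq0 ?mulr0//; lra.
  rewrite (Fb x (ltW bx)) /rstep step_eq1; [ring|lra].
- have [_ ->] := derive1_lin (- F b) (sr 0%N) (sF 0%N).
  by rewrite dF; apply/funext => x; rewrite -/omega; ring.
- move=> x; rewrite mulr_natl mulr2n (le_trans (ler_normD _ _))// lerD//.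
  by rewrite normrM normrN (le_trans _ (FM b))// ler_piMr// rstep_norm.
Qed.

(** w is controlled by the sup norm, but only on j-th derivatives of test functions supported in ]0,
    X]. The power of X will become polynomial growth. *)
Definition order_bound w j L C : Prop := forall X a b f M,
  2 <= X -> 0 < a -> a <= b -> b <= X -> testfun a b f ->
  (forall x, `|Dn j f x| <= M) -> cmod (ev w (Dn j f)) <= C * X ^+ L * M.

(** Writing f = c omega + psi', the j-th derivative of f is c times a fixed function plus the
    (j+1)-st derivative of psi, where the hypothesis applies. The integral c of f costs X ^ (j +
    1). *)
Lemma order_boundS w j L C : linear w -> 0 <= C -> order_bound w j.+1 L C ->
  exists2 C', 0 <= C' & order_bound w j (L + j.+1) C'.
Proof.
move=> lw C0 H.
have [B B0 hB] := testfun_bound (testfun_deriven j testfun_omega).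
pose E := cmod (ev w (Dn j omega)).
have E0 : 0 <= E by exact: cmod_ge0.
exists (C * (1 + B) + E) => [|X a b f M X2 a0 ab bX tf fM].
  by rewrite addr_ge0// mulr_ge0// addr_ge0.
have X0 : 0 <= X by exact: le_trans X2.
have X1 : 1 <= X by apply: le_trans X2; rewrite ler1n.
have M0 : 0 <= M by rewrite (le_trans _ (fM 0)).
have fM0 x : `|f x| <= X ^+ j * M.
  by have := testfun_sup tf (ltW a0) bX X0 (leqnn j) fM x; rewrite subnn.
have [F [c [psi [_ tpsi fE cM _]]]] := omega_decomposition a0 ab tf fM0.
have so : smooth omega := testfun_smooth testfun_omega.
have sp := testfun_smooth tpsi.
have ab' : Num.min a 1 <= Num.max b 2 by rewrite ge_min le_max ab.
have a0' : 0 < Num.min a 1 by rewrite lt_min a0 ltr01.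
have bX' : Num.max b 2 <= X by rewrite ge_max bX.
have cX : `|c| <= X ^+ j.+1 * M.
  rewrite (le_trans cM)// exprS -[leRHS]mulrA [leLHS]mulrC ler_wpM2r//.
    by rewrite mulr_ge0// exprn_ge0.
  by rewrite (le_trans _ bX)// gerBl ltW.
have DE : Dn j f = (fun x => c * Dn j omega x + Dn j.+1 psi x).
  by rewrite derive1Sn {1}fE derive1n_lin//; exact: smooth_derive.
have psiM x : `|Dn j.+1 psi x| <= M + X ^+ j.+1 * M * B.
  have -> : Dn j.+1 psi x = Dn j f x - c * Dn j omega x by rewrite DE; ring.
  rewrite (le_trans (ler_normB _ _))// lerD// normrM ler_pM//.
have := H X _ _ psi _ X2 a0' ab' bX' tpsi psiM => h.
have ro := testfun_rschwartz (testfun_deriven j testfun_omega).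
have rp := testfun_rschwartz (testfun_deriven j.+1 tpsi).
rewrite DE ev_lin// (le_trans (cmodD _ _))// cmodM cmod_real.
apply: (@le_trans _ _ (X ^+ j.+1 * M * E + C * X ^+ L * (M + X ^+ j.+1 * M * B))).
  by rewrite lerD// ler_wpM2r.
have XL1 : 1 <= X ^+ L by rewrite exprn_ege1.
have Xj1 : 1 <= X ^+ j.+1 by rewrite exprn_ege1.
rewrite exprD; set p := X ^+ L in XL1 *; set q := X ^+ j.+1 in Xj1 *.
have e1 : q * M * E <= p * q * M * E.
  by rewrite -!mulrA ler_peMl// !mulr_ge0// (le_trans ler01).
have e2 : C * p * M <= C * p * q * M.
  by rewrite ler_wpM2r// ler_peMr// mulr_ge0// (le_trans ler01).
have -> : (C * (1 + B) + E) * (p * q) * M =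
  p * q * M * E + (C * p * q * M + C * p * (q * M * B)) by ring.
by rewrite mulrDr lerD// lerD.
Qed.

Lemma order_bound0 j L : exists L', forall w, linear w ->
  (exists2 C, 0 <= C & order_bound w j L C) -> exists2 C, 0 <= C & order_bound w 0 L' C.
Proof.
elim: j L => [|j IHj] L; first by exists L.
have [L' hL'] := IHj (L + j.+1)%N; exists L' => w lw [C C0 hC].
by apply: hL' => //; exact: order_boundS hC.
Qed.

Lemma testfun_half a b f : 0 < a -> testfun a b f -> schwartz_half (sreal f).
Proof.
move=> a0 tf; apply/schwartz_halfP => x x0; have rf := testfun_rschwartz tf.
rewrite re_sreal// im_sreal//; split=> //; apply: (testfun_out tf).
by rewrite negb_and -!ltNge (lt_trans x0).
Qed.

(** Up to sign, u f is the K-th primitive on the K-th derivative of f. The K-th seminorm of f is at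
    most X ^ (K + K) times the sup of that derivative: X ^ K for the weights, X ^ K for the
    integrations. *)
Lemma dominated_order_bound K u : tempered_half u ->
  dominated (@schwartz_half R) (sbound K) u ->
  exists2 C, 0 <= C & order_bound (iter K dist_prim u) K (K + K) C.
Proof.
move=> hu [C [C0 hC]]; exists C => // X a b f M X2 a0 ab bX tf fM.
have X0 : 0 <= X by exact: le_trans X2.
have X1 : 1 <= X by apply: le_trans X2; rewrite ler1n.
have M0 : 0 <= M by rewrite (le_trans _ (fM 0)).
have rf := testfun_rschwartz tf.
have hp := iter_dist_prim_half K hu; have [[lp _] _] := hp.
have : ev u f = (-1) ^+ K * ev (iter K dist_prim u) (Dn K f).
  by rewrite -ev_iter_derive// iter_dist_primK.
move=> E; have -> : cmod (ev (iter K dist_prim u) (Dn K f)) = cmod (ev u f).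
  by rewrite E cmodM cmod_sign mul1r.
rewrite -mulrA; apply: hC; first exact: testfun_half tf.
apply: sbound_sreal => // k n x kK nK.
have [xab|xo] := boolP (a <= x <= b); last first.
  by rewrite (testfun_out (testfun_deriven n tf))// mulr0 normr0 mulr_ge0// exprn_ge0.
have x0 : 0 <= x by case/andP: xab => ax _; rewrite (le_trans _ ax)// ltW.
have xX : x <= X by case/andP: xab => _ xb; exact: le_trans bX.
have := testfun_sup tf (ltW a0) bX X0 (leq_subr n K) fM x; rewrite subKn// => h.
rewrite normrM exprD -mulrA; apply: ler_pM => //.
  rewrite normrX ger0_norm// (@le_trans _ _ (X ^+ k))// ?ler_weXn2l//.
  by rewrite lerXn2r ?nnegrE.
by rewrite (le_trans h)// ler_wpM2r// ler_weXn2l// leq_subr.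
Qed.

(** M (b - a) stands in for the integral of |f|: morally, v has a density of size at most C X ^ L on
    ]0, X]. *)
Definition length_bound v L C : Prop := forall X a b f M,
  2 <= X -> 0 < a -> a <= b -> b <= X -> testfun a b f ->
  (forall x, `|f x| <= M) -> cmod (ev v f) <= C * X ^+ L * (M * (b - a)).

(** In f = c omega + psi', the primitive sends psi' to - w psi, and both c and sup |psi| are of
    order M (b - a). *)
Lemma order_length_bound w L C : tempered_half w -> 0 <= C -> order_bound w 0 L C ->
  exists2 C', 0 <= C' & length_bound (dist_prim w) L C'.
Proof.
move=> hw C0 H; have [[lw _] _] := hw.
have [[lv _] _] := dist_prim_half hw.
pose E := cmod (ev (dist_prim w) omega).
have E0 : 0 <= E by exact: cmod_ge0.
exists (2 * C + E) => [|X a b f M X2 a0 ab bX tf fM]; first by rewrite addr_ge0// mulr_ge0.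
have X1 : 1 <= X by apply: le_trans X2; rewrite ler1n.
have M0 : 0 <= M by rewrite (le_trans _ (fM 0)).
have [F [c [psi [_ tpsi fE cM psiM]]]] := omega_decomposition a0 ab tf fM.
have ab' : Num.min a 1 <= Num.max b 2 by rewrite ge_min le_max ab.
have a0' : 0 < Num.min a 1 by rewrite lt_min a0 ltr01.
have bX' : Num.max b 2 <= X by rewrite ge_max bX.
have h := H X _ _ psi _ X2 a0' ab' bX' tpsi psiM.
have ro := testfun_rschwartz testfun_omega; have rp := testfun_rschwartz tpsi.
have evp : ev (dist_prim w) (D1 psi) = - ev w psi.
  by rewrite -{2}(dist_primK hw) ev_derive// opprK.
rewrite fE ev_lin//; last exact: rschwartz_derive.
rewrite evp (le_trans (cmodD _ _))// cmodN cmodM cmod_real.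
have XL1 : 1 <= X ^+ L by rewrite exprn_ege1.
have Mab : 0 <= M * (b - a) by rewrite mulr_ge0// subr_ge0.
have -> : (2 * C + E) * X ^+ L * (M * (b - a)) =
  X ^+ L * (M * (b - a)) * E + C * X ^+ L * (2 * (M * (b - a))) by ring.
rewrite lerD// ler_wpM2r// (le_trans cM)// ler_peMl//.
Qed.

End OrderReduction.

(** * A continuous function from the values on cut half-lines *)

Section ContinuousDensity.
Context {R : realType}.
Implicit Types (f h Phi Psi : R -> R) (a b c d e r s t x y X M : R).

(** A smooth indicator of the half-line below s: the argument is (s - t) / e, so it falls from 1 to
    0 on [s - e, s]. *)
Definition sig s e t : R := step (- e^-1 * t + s / e).

Lemma smooth_sig s e : smooth (sig s e).
Proof. by apply: smooth_affine; exact: smooth_step. Qed.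

Let sigE s e t : - e^-1 * t + s / e = (s - t) / e.
Proof. by rewrite mulrBl mulNr addrC [e^-1 * t]mulrC. Qed.

Lemma sig_eq0 s e t : 0 < e -> s <= t -> sig s e t = 0.
Proof.
by move=> e0 st; rewrite /sig sigE step_eq0// ler_pdivrMr// mul0r subr_le0.
Qed.

Lemma sig_eq1 s e t : 0 < e -> t <= s - e -> sig s e t = 1.
Proof.
move=> e0 st; rewrite /sig sigE step_eq1// ler_pdivlMr// mul1r; lra.
Qed.

Lemma sigB_norm s e s' e' t : `|-1 * sig s' e' t + sig s e t| <= 1.
Proof.
have /andP[? ?] := step_bound (- e^-1 * t + s / e).
have /andP[? ?] := step_bound (- e'^-1 * t + s' / e').
by rewrite /sig ler_norml; apply/andP; split; lra.
Qed.

Lemma cmodNDD (x y z : R[i]) : cmod (- x + y + z) <= cmod x + cmod y + cmod z.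
Proof.
by rewrite (le_trans (cmodD _ _))// lerD2r (le_trans (cmodD _ _))// cmodN.
Qed.

Lemma telescope3 (x y z w : R[i]) : x - y = - (z - x) + (z - w) + (w - y).
Proof. ring. Qed.

Definition cutl Phi s e t : R := sig s e t * Phi t.

Lemma testfun_cutl Phi s e : smooth Phi -> (forall t, t <= -2 -> Phi t = 0) -> 0 < e ->
  testfun (-2) s (cutl Phi s e).
Proof.
move=> sP P0 e0; split=> [|t]; first by apply: smooth_mul => //; exact: smooth_sig.
rewrite negb_and -!ltNge => /orP[t2|st]; first by rewrite /cutl P0 ?mulr0// ltW.
by rewrite /cutl sig_eq0 ?mul0r// ltW.
Qed.

Variables (v : schwartz R -> R[i]^o) (L : nat) (C : R).
Hypothesis hv : tempered_half v.
Hypothesis C0 : 0 <= C.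
Hypothesis vB : length_bound v L C.

Let lv : linear v. Proof. by have [[]] := hv. Qed.

Definition cutev Phi s e : R[i] := ev v (cutl Phi s e).

(** Both cuts are 1 below lo and 0 above hi, so their difference is a test function on [lo, hi] to
    which the length bound applies. *)
Lemma cutev_diff Phi s e s' e' X M lo hi : smooth Phi ->
  (forall t, t <= -2 -> Phi t = 0) -> 0 < e -> 0 < e' -> 0 < lo ->
  lo <= s - e -> lo <= s' - e' -> s <= hi -> s' <= hi -> hi <= X -> 2 <= X ->
  (forall t, lo <= t <= hi -> `|Phi t| <= M) ->
  cmod (cutev Phi s e - cutev Phi s' e') <= C * X ^+ L * (M * (hi - lo)).
Proof.
move=> sP P0 e0 e0' lo0 los los' shi shi' hiX X2 PM.
have lohi : lo <= hi by rewrite (le_trans los)// (le_trans _ shi)// gerBl ltW.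
have M0 : 0 <= M by rewrite (le_trans _ (PM lo _))// lexx lohi.
have t1 := testfun_cutl s sP P0 e0; have t2 := testfun_cutl s' sP P0 e0'.
have -> : cutev Phi s e - cutev Phi s' e' =
    ev v (fun t => -1 * cutl Phi s' e' t + cutl Phi s e t).
  rewrite ev_lin//; [|exact: testfun_rschwartz t2|exact: testfun_rschwartz t1].
  by rewrite rmorphN1 mulN1r addrC.
have hE t : -1 * cutl Phi s' e' t + cutl Phi s e t =
    (-1 * sig s' e' t + sig s e t) * Phi t by rewrite /cutl; ring.
have th : testfun lo hi (fun t => -1 * cutl Phi s' e' t + cutl Phi s e t).
  split=> [|t]; first by apply: smooth_lin; [case: t2|case: t1].
  rewrite negb_and -!ltNge hE => /orP[tlo|hit].
    by rewrite !sig_eq1 ?mulr1 ?addNr ?mul0r// (le_trans (ltW tlo)).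
  by rewrite !sig_eq0 ?mulr0 ?addr0 ?mul0r// ?(le_trans shi)// ?(le_trans shi')// ltW.
apply: (vB X2 lo0 lohi hiX th) => t.
have [tlh|tlh] := boolP (lo <= t <= hi); last by rewrite (testfun_out th)// normr0.
by rewrite hE normrM -[leRHS]mul1r ler_pM// ?sigB_norm// PM.
Qed.

(* F s is the value of v on Phi times the indicator of the half-line below s. *)
Lemma cutev_limit Phi M : smooth Phi -> (forall t, t <= -2 -> Phi t = 0) ->
  (forall t, `|Phi t| <= M) -> exists F : R -> R[i], forall s e X,
  0 < e < s -> s <= X -> 2 <= X -> cmod (cutev Phi s e - F s) <= 4 * (C * X ^+ L * M * e).
Proof.
move=> sP P0 PM; have M0 : 0 <= M by rewrite (le_trans _ (PM 0)).
suff /choice[F hF] : forall s, exists w, forall e X, 0 < e < s -> s <= X -> 2 <= X ->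
    cmod (cutev Phi s e - w) <= 4 * (C * X ^+ L * M * e) by exists F.
move=> s; have [s0|s0] := ltP 0 s; last first.
  by exists 0 => e X /andP[e0 es]; move: (lt_le_trans es s0); rewrite ltNge ltW.
(* The least admissible X, so that one limit serves for all X. *)
pose X0 := Num.max s 2; pose D := C * X0 ^+ L * M.
have X02 : 2 <= X0 by rewrite le_max lexx orbT.
have sX0 : s <= X0 by rewrite le_max lexx.
have D0 : 0 <= D by rewrite !mulr_ge0// exprn_ge0// (le_trans _ X02).
have dE e e' : 0 < e < s -> 0 < e' < s ->
    cmod (cutev Phi s e - cutev Phi s e') <= D * (e + e').
  move=> /andP[e0 es] /andP[e0' es']; pose m := Num.max e e'.
  have m0 : 0 < m by rewrite lt_max e0.
  have ms : 0 < s - m by rewrite subr_gt0 gt_max es es'.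
  have em : e <= m by rewrite le_max lexx.
  have em' : e' <= m by rewrite le_max lexx orbT.
  have := @cutev_diff Phi s e s e' X0 M (s - m) s sP P0 e0 e0' ms.
  rewrite !lerB// subKr !mulrA => /(_ isT isT (lexx s) (lexx s) sX0 X02).
  move=> /(_ (fun t _ => PM t)) /le_trans; apply; rewrite ler_wpM2l//.
  by rewrite ge_max lerDl lerDr !ltW.
pose ep (k : nat) := s / k.+2%:R.
have ep0 k : 0 < ep k < s.
  by rewrite divr_gt0//= ltr_pdivrMr// ltr_pMr// ltr1n.
have [|w hw] := @complex_limit R (fun k => cutev Phi s (ep k)) (fun k => D * ep k).
  by move=> k l; rewrite -mulrDr; exact: dE.
exists w => e X es sX X2; have /andP[e0 _] := es.
have [k ke] : exists k, ep k <= e.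
  exists (Num.truncn (s / e)); rewrite /ep ler_pdivrMr// mulrC -ler_pdivrMr//.
  by rewrite ltW// (lt_trans (truncnS_gt _))// ltr_nat.
have D1 : D <= C * X ^+ L * M.
  have X0X : X0 <= X by rewrite ge_max sX.
  have X00 : 0 <= X0 by rewrite (le_trans _ X02).
  rewrite ler_wpM2r// ler_wpM2l//.
  by rewrite lerXn2r// ?nnegrE// (le_trans X00).
rewrite -(subrKA (cutev Phi s (ep k))) (le_trans (cmodD _ _))//.
apply: (@le_trans _ _ (4 * (D * e))); last first.
  by rewrite ler_wpM2l// ler_wpM2r// ltW.
apply: (le_trans (lerD (dE _ _ es (ep0 k)) (hw k))).
(* The total error D (e + ep k) + 2 D ep k is then at most 4 D e. *)
have De : D * ep k <= D * e by rewrite ler_wpM2l.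
rewrite mulrDr; move: (D * e) (D * ep k) De => p q; lra.
Qed.

Let chi_out t : t <= -2 -> (chi t : R) = 0.
Proof. exact: chi_eq0. Qed.

Let chi_norm t : `|chi t : R| <= 1.
Proof. exact: step_norm. Qed.

Let smallprod (A d e : R) : 0 <= A -> (forall e', 0 < e' < e -> d <= A * e') -> 0 < e -> d <= 0.
Proof.
move=> A0 h e0; apply/ler_addgt0Pr => r r0; rewrite add0r.
have A1 : 0 < A + 1 by rewrite ltr_wpDl.
pose e' := Num.min (e / 2) (r / (A + 1)).
have e'0 : 0 < e' by rewrite lt_min !divr_gt0.
have e'e : e' < e by rewrite gt_min ltr_pdivrMr// ltr_pMr// ltr1n.
rewrite (le_trans (h e' _)) ?e'0//.
apply: (@le_trans _ _ (A * (r / (A + 1)))).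
  by rewrite ler_wpM2l// ge_min lexx orbT.
by rewrite mulrA ler_pdivrMr// [leRHS]mulrDr [A * r]mulrC mulr1 lerDl ltW.
Qed.

Section OneTest.
Variables (G F : R -> R[i]) (Phi : R -> R) (a b M : R).
Hypothesis hG : forall s e X, 0 < e < s -> s <= X -> 2 <= X ->
  cmod (cutev chi s e - G s) <= 4 * (C * X ^+ L * 1 * e).
Hypothesis a0 : 0 < a.
Hypothesis tP : testfun a b Phi.
Hypothesis PM : forall t, `|Phi t| <= M.
Hypothesis hF : forall s e X, 0 < e < s -> s <= X -> 2 <= X ->
  cmod (cutev Phi s e - F s) <= 4 * (C * X ^+ L * M * e).

Let P0 t : t <= -2 -> Phi t = 0.
Proof.
move=> t2; apply: (testfun_out tP); rewrite negb_and -!ltNge; apply/orP; left.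
by rewrite (le_lt_trans t2)// (lt_trans _ a0)// oppr_lt0.
Qed.

Let sP : smooth Phi. Proof. by case: tP. Qed.

Let M0 : 0 <= M. Proof. by rewrite (le_trans _ (PM 0)). Qed.

Lemma cut_start s : 0 < s < a -> F s = 0.
Proof.
move=> /andP[s0 sa]; have X2 : 2 <= s + 2 by rewrite lerDr ltW.
have A0 : 0 <= 4 * (C * (s + 2) ^+ L * M).
  by rewrite !mulr_ge0// exprn_ge0// (le_trans _ X2).
apply/eqP; rewrite -cmod_eq0 eq_le cmod_ge0 andbT.
apply: (smallprod A0 _ s0) => e /andP[e0 es].
have es' : 0 < e < s by rewrite e0.
have s2 : s <= s + 2 by rewrite lerDl.
have := hF es' s2 X2.
have -> : cutev Phi s e = 0.
  rewrite /cutev (_ : cutl Phi s e = fun=> 0) ?ev0//; apply/funext => t; rewrite /cutl.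
  have [st|ts] := leP s t; first by rewrite sig_eq0 ?mul0r.
  by rewrite (testfun_out tP) ?mulr0// negb_and -!ltNge (lt_trans ts sa).
by rewrite sub0r cmodN -!mulrA.
Qed.

Lemma cut_end s : 0 < s -> b < s -> F s = ev v Phi.
Proof.
move=> s0 bs; have X2 : 2 <= s + 2 by rewrite lerDr ltW.
have A0 : 0 <= 4 * (C * (s + 2) ^+ L * M).
  by rewrite !mulr_ge0// exprn_ge0// (le_trans _ X2).
have m0 : 0 < Num.min s (s - b) by rewrite lt_min s0 subr_gt0.
apply/eqP; rewrite -subr_eq0 -cmod_eq0 eq_le cmod_ge0 andbT.
apply: (smallprod A0 _ m0) => e /andP[e0]; rewrite lt_min => /andP[es esb].
have es' : 0 < e < s by rewrite e0.
have s2 : s <= s + 2 by rewrite lerDl.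
have := hF es' s2 X2.
have -> : cutev Phi s e = ev v Phi.
  congr ev; apply/funext => t; rewrite /cutl.
  have [bt|tb] := ltP b t.
    by rewrite (testfun_out tP) ?mulr0// negb_and -!ltNge bt orbT.
  by rewrite sig_eq1 ?mul1r//; lra.
by rewrite -cmodN opprB -!mulrA.
Qed.

(** Cuts of width d = |t - s| approximate G t and G s within 4 D d each, and differ from one another
    by at most 2 D d; hence the factor 10. *)
Lemma cut_lipschitz s t : 0 < s -> `|t - s| < s / 4 -> `|t - s| < 1 ->
  cmod (G t - G s) <= 10 * (C * (s + 2) ^+ L) * `|t - s|.
Proof.
move=> s0 ds d1; have [->|ts] := eqVneq t s.
  by rewrite !subrr cmod0 normr0 mulr0.
have X2 : 2 <= s + 2 by rewrite lerDr ltW.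
have d0 : 0 < `|t - s| by rewrite normr_gt0 subr_eq0.
have dt : - `|t - s| <= t - s <= `|t - s| by rewrite -ler_norml.
move: (`|t - s|) ds d1 d0 dt => d ds d1 d0 /andP[dt1 dt2].
pose D := C * (s + 2) ^+ L.
have g1 : cmod (cutev chi t d - G t) <= 4 * (C * (s + 2) ^+ L * 1 * d).
  by apply: hG => //; [apply/andP; split|]; lra.
have g2 : cmod (cutev chi s d - G s) <= 4 * (C * (s + 2) ^+ L * 1 * d).
  by apply: hG => //; [apply/andP; split|]; lra.
have st0 : 0 < Num.min s t - d by rewrite subr_gt0 lt_min; apply/andP; split; lra.
have g3 : cmod (cutev chi t d - cutev chi s d) <=
    C * (s + 2) ^+ L * (1 * (Num.max s t - (Num.min s t - d))).
  apply: cutev_diff => //; first exact: smooth_chi.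
  - by rewrite lerB// ge_min lexx orbT.
  - by rewrite lerB// ge_min lexx.
  - by rewrite le_max lexx orbT.
  - by rewrite le_max lexx.
  - by rewrite ge_max; apply/andP; split; lra.
have m2 : Num.max s t - (Num.min s t - d) <= 2 * d.
  rewrite /Num.max /Num.min; case: ifP => _; lra.
rewrite (telescope3 (G t) (G s) (cutev chi t d) (cutev chi s d)).
rewrite (le_trans (cmodNDD _ _ _))//.
have D0 : 0 <= D by rewrite mulr_ge0// exprn_ge0// (le_trans _ X2).
have g3' : cmod (cutev chi t d - cutev chi s d) <= D * (2 * d).
  by rewrite (le_trans g3)// mul1r ler_wpM2l.
rewrite !mulr1 in g1 g2.
have -> : 10 * D * d = 4 * (D * d) + D * (2 * d) + 4 * (D * d) by ring.
by rewrite lerD// lerD.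
Qed.

(* As Phi - Phi s is O(t - s) between s and t, length_bound makes the cut
   Phi - Phi s contribute only to second order. *)
Lemma cut_increment (M1 : R) s t : (forall x, `|D1 Phi x| <= M1) -> 0 < s ->
  `|t - s| < s / 4 -> `|t - s| < 1 ->
  cmod (F t - F s - (Phi s)%:C * (G t - G s)) <=
    C * (s + 2) ^+ L * (16 * M + 4 * M1) * `|t - s| ^+ 2.
Proof.
move=> PM1 s0 ds d1; have [->|ts] := eqVneq t s.
  by rewrite !subrr mulr0 subrr cmod0 normr0 expr0n mulr0.
have M10 : 0 <= M1 by rewrite (le_trans _ (PM1 0)).
have X2 : 2 <= s + 2 by rewrite lerDr ltW.
have d0 : 0 < `|t - s| by rewrite normr_gt0 subr_eq0.
have dt : - `|t - s| <= t - s <= `|t - s| by rewrite -ler_norml.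
move: (`|t - s|) ds d1 d0 dt => d ds d1 d0 /andP[dt1 dt2].
(* The error of a cut is proportional to its width, so a width of d ^ 2 keeps it quadratic. *)
pose e := d ^+ 2; have e0 : 0 < e by rewrite exprn_gt0.
have ed : e <= d by rewrite /e expr2 ler_piMl// ltW.
pose D := C * (s + 2) ^+ L.
have D0 : 0 <= D by rewrite mulr_ge0// exprn_ge0// (le_trans _ X2).
have tX : t <= s + 2 by lra.
have sX : s <= s + 2 by lra.
have te : 0 < e < t by rewrite e0; lra.
have se : 0 < e < s by rewrite e0; lra.
have g1 := hG te tX X2; have g2 := hG se sX X2.
have f1 := hF te tX X2; have f2 := hF se sX X2.
rewrite -/D !mulr1 in g1 g2 f1 f2.
(* Equal to Phi - Phi s where [chi] is 1, hence of size M1 (2 d) on the interval that separates the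
   two cuts. *)
pose Psi x := - Phi s * chi x + Phi x.
have sPsi : smooth Psi by apply: smooth_lin => //; exact: smooth_chi.
have Psi0 x : x <= -2 -> Psi x = 0.
  by move=> x2; rewrite /Psi (P0 x2) chi_eq0// mulr0 addr0.
have cutE x : cutev Psi x e = cutev Phi x e - (Phi s)%:C * cutev chi x e.
  have t1 := testfun_cutl x (@smooth_chi R) chi_out e0.
  have t2 := testfun_cutl x sP P0 e0.
  rewrite /cutev (_ : cutl Psi x e = fun y => - Phi s * cutl chi x e y + cutl Phi x e y).
    rewrite ev_lin//; [|exact: testfun_rschwartz t1|exact: testfun_rschwartz t2].
    by rewrite rmorphN/= mulNr addrC.
  by apply/funext => y; rewrite /cutl /Psi; ring.
have st0 : 0 < Num.min s t - e by rewrite subr_gt0 lt_min; apply/andP; split; lra.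
have m2 : Num.max s t - (Num.min s t - e) <= 2 * d.
  rewrite /Num.max /Num.min; case: ifP => _; lra.
have g3 : cmod (cutev Psi t e - cutev Psi s e) <=
    D * (M1 * (2 * d) * (Num.max s t - (Num.min s t - e))).
  apply: cutev_diff => //.
  - by rewrite lerB// ge_min lexx orbT.
  - by rewrite lerB// ge_min lexx.
  - by rewrite le_max lexx orbT.
  - by rewrite le_max lexx.
  - by rewrite ge_max; apply/andP; split; lra.
  move=> x /andP[x1 x2]; rewrite /Psi chi_eq1 ?mulr1; last by lra.
  have xs : `|x - s| <= 2 * d.
    rewrite ler_norml; apply/andP; split.
      by move: x1 m2; rewrite /Num.max /Num.min; case: ifP => _; lra.
    by move: x2 m2; rewrite /Num.max /Num.min; case: ifP => _; lra.
  apply: (@le_trans _ _ (M1 * `|x - s|)); last by rewrite ler_wpM2l.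
  rewrite addrC; have [sx|/ltW xs'] := leP s x.
    rewrite (ger0_norm (_ : 0 <= x - s)) ?subr_ge0//.
    by apply: (mvt_bound sx) => [y _|y _]; [exact: smooth_is_derive|exact: PM1].
  rewrite distrC [`|x - s|]distrC (ger0_norm (_ : 0 <= s - x)) ?subr_ge0//.
  by apply: (mvt_bound xs') => [y _|y _]; [exact: smooth_is_derive|exact: PM1].
have g3' : cmod (cutev Psi t e - cutev Psi s e) <= D * (4 * M1 * d ^+ 2).
  rewrite (le_trans g3)// ler_wpM2l//.
  have -> : 4 * M1 * d ^+ 2 = M1 * (2 * d) * (2 * d) by ring.
  by rewrite ler_wpM2l// !mulr_ge0// ltW.
have key (A A' B B' p p' q q' c : R[i]) : p - p' - c * (q - q') =
    ((A - c * B) - (A' - c * B')) +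
    ((- (A - p) + (A' - p')) + (c * (B - q) - c * (B' - q'))) by ring.
have -> : F t - F s - (Phi s)%:C * (G t - G s) =
    (cutev Psi t e - cutev Psi s e) +
    ((- (cutev Phi t e - F t) + (cutev Phi s e - F s)) +
     ((Phi s)%:C * (cutev chi t e - G t) - (Phi s)%:C * (cutev chi s e - G s))).
  by rewrite (cutE t) (cutE s); exact: key.
have -> : D * (16 * M + 4 * M1) * d ^+ 2 = D * (4 * M1 * d ^+ 2) +
   ((4 * (D * M * e) + 4 * (D * M * e)) + (M * (4 * (D * e)) + M * (4 * (D * e)))).
  by rewrite /e; ring.
rewrite (le_trans (cmodD _ _))// lerD// (le_trans (cmodD _ _))// lerD//.
  by rewrite (le_trans (cmodD _ _))// cmodN lerD.
rewrite (le_trans (cmodD _ _))// cmodN !cmodM !cmod_real.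
by apply: lerD; apply: ler_pM => //; exact: cmod_ge0.
Qed.

(** p stands for Re and Im at once. The remainder splits into the one of [cut_increment], a product
    of two Lipschitz increments, and p (G s) times the Taylor remainder of Phi; all three are
    quadratic. *)
Lemma cut_derivative (p : R[i] -> R) : (forall z, `|p z| <= cmod z) ->
  (forall z w, p (z - w) = p z - p w) -> (forall x z, p (x%:C * z) = x * p z) ->
  forall s, 0 < s -> is_derive s 1 (fun x => - (p (F x) - Phi x * p (G x))) (p (G s) * D1 Phi s).
Proof.
move=> p_le pB pZ s s0.
have [M1 M10 hM1] := testfun_bound (testfun_derive tP).
have [M2 M20 hM2] := testfun_bound (testfun_deriven 2 tP).
pose D := C * (s + 2) ^+ L.
pose B := D * (16 * M + 4 * M1) + 10 * D * M1 + cmod (G s) * M2.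
have eta0 : 0 < Num.min (s / 4) 1 by rewrite lt_min divr_gt0//=.
apply: (@is_derive_quadratic _ _ _ _ B _ eta0) => h; rewrite lt_min => /andP[hs h1].
have E : `|s + h - s| = `|h| by rewrite [s + h]addrC addrK.
have := @cut_increment M1 s (s + h) hM1 s0; rewrite E => /(_ hs h1) i1.
have := @cut_lipschitz s (s + h) s0; rewrite E => /(_ hs h1) i2.
have i3 : `|Phi (s + h) - Phi s| <= M1 * `|h|.
  have [h0|/ltW h0] := leP 0 h.
    have := @mvt_bound R Phi (D1 Phi) s (s + h) M1.
    rewrite lerDl h0 => /(_ isT (fun y _ => smooth_is_derive y sP) (fun y _ => hM1 y)).
    by rewrite [s + h]addrC addrK (ger0_norm h0).
  have := @mvt_bound R Phi (D1 Phi) (s + h) s M1.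
  rewrite gerDl h0 => /(_ isT (fun y _ => smooth_is_derive y sP) (fun y _ => hM1 y)).
  by rewrite opprD addNKr distrC (ler0_norm h0).
have i4 := @second_order_bound R Phi s h M2 sP hM2.
set g := G s in B *; set z := F (s + h) - F s - (Phi s)%:C * (G (s + h) - g) in i1 *.
have -> : - (p (F (s + h)) - Phi (s + h) * p (G (s + h))) -
    - (p (F s) - Phi s * p g) - h * (p g * D1 Phi s) =
    - p z + ((Phi (s + h) - Phi s) * p (G (s + h) - g) +
      p g * (Phi (s + h) - Phi s - h * D1 Phi s)).
  by rewrite /z !pB pZ !pB; ring.
have -> : B * h ^+ 2 = D * (16 * M + 4 * M1) * `|h| ^+ 2 +
    (M1 * `|h| * (10 * D * `|h|) + cmod g * (M2 * h ^+ 2)).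
  by rewrite -[h ^+ 2]real_normK ?num_real// /B; ring.
rewrite (le_trans (ler_normD _ _))// lerD//.
  by rewrite normrN (le_trans (p_le _)).
rewrite (le_trans (ler_normD _ _))// lerD//.
  by rewrite normrM ler_pM// (le_trans (p_le _)).
by rewrite normrM ler_pM.
Qed.

End OneTest.

(* With G s and F s the values of v on the indicator of the half-line below s
   without and with the factor Phi, cut_increment yields (F - Phi G)' = - G Phi',
   so that v is the derivative of the function G on ]0, +oo[. *)
Lemma density_exists : exists G : R -> R[i]^o, [/\
  forall s, 0 < s -> {for s, continuous G},
  exists2 B, 0 <= B & forall s, 0 < s -> cmod (G s) <= B * (s + 2) ^+ L.+1 &
  forall a b Phi, 0 < a -> testfun a b Phi -> exists N : R -> R[i], [/\
    forall s, 0 < s -> is_derive s 1 (Re \o N) (Re (G s) * D1 Phi s),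
    forall s, 0 < s -> is_derive s 1 (Im \o N) (Im (G s) * D1 Phi s),
    forall s, 0 < s < a -> N s = 0 &
    forall s, 0 < s -> b < s -> N s = - ev v Phi]].
Proof.
have [G hG] := cutev_limit (@smooth_chi R) chi_out chi_norm.
exists G; split.
- move=> s s0; apply/cvgrPdist_le => e e0.
  have [r [r0 eE]] : exists r : R, 0 < r /\ e = r%:C.
    have : (0 : R[i]) < e by exact: e0.
    by case: (e) => x y; rewrite ltcE/= => /andP[/eqP -> x0]; exists x.
  pose D := 10 * (C * (s + 2) ^+ L).
  have D0 : 0 <= D by rewrite !mulr_ge0// exprn_ge0// addr_ge0// ltW.
  have D1 : 0 < D + 1 by rewrite ltr_wpDl.
  pose d := Num.min (Num.min (s / 4) 1) (r / (D + 1)).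
  have d0 : 0 < d.
    by rewrite !lt_min ltr01 andbT; apply/andP; split; rewrite divr_gt0.
  exists d => //= t; rewrite /ball_/= distrC !lt_min => /andP[/andP[ts t1] tr].
  rewrite eE cmod_le -cmodN opprB (le_trans (cut_lipschitz hG s0 ts t1))//.
  rewrite (@le_trans _ _ (D * (r / (D + 1))))// ?ler_wpM2l// 1?ltW//.
  by rewrite mulrA ltr_pdivrMr// [ltRHS]mulrDr [D * r]mulrC mulr1 ltrDl.
(* Growth comes from comparing the cut of width s / 2 at s with one fixed cut at 1: they differ on
   an interval of length at most s + 1, which raises the exponent to L + 1. *)
- pose E := cmod (cutev chi 1 2^-1); have E0 : 0 <= E by exact: cmod_ge0.
  exists (5 * C + E) => [|s s0]; first by rewrite addr_ge0// mulr_ge0.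
  have X2 : 2 <= s + 2 by rewrite lerDr ltW.
  have X1 : 1 <= s + 2 by lra.
  have XL1 : 1 <= (s + 2) ^+ L by rewrite exprn_ege1.
  have g1 := @hG s (s / 2) (s + 2).
  have {}g1 : cmod (cutev chi s (s / 2) - G s) <= 4 * (C * (s + 2) ^+ L * 1 * (s / 2)).
    by apply: g1 => //; [apply/andP; split|]; lra.
  have g2 : cmod (cutev chi s (s / 2) - cutev chi 1 2^-1) <=
      C * (s + 2) ^+ L * (1 * (s + 1 - Num.min (s / 2) 2^-1)).
    apply: cutev_diff => //; first exact: smooth_chi.
    - by rewrite divr_gt0.
    - by rewrite lt_min divr_gt0//= invr_gt0.
    - by rewrite ge_min; apply/orP; left; lra.
    - by rewrite ge_min; apply/orP; right; lra.
    - lra.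
    - lra.
    - lra.
  have m0 : 0 <= Num.min (s / 2) 2^-1 by rewrite le_min divr_ge0 ?ltW//= invr_gt0.
  have := telescope3 (G s) 0 (cutev chi s (s / 2)) (cutev chi 1 2^-1).
  rewrite !subr0 => ->.
  rewrite (le_trans (cmodNDD _ _ _))//.
  set p := (s + 2) ^+ L in XL1 g1 g2 *; rewrite exprSr -/p.
  have Cp : 0 <= C * p by rewrite mulr_ge0// (le_trans ler01).
  apply: (@le_trans _ _ (4 * (C * p * (s + 2)) + C * p * (s + 2) + E * (p * (s + 2)))).
    rewrite lerD//; last first.
      by rewrite ler_peMr// mulr_ege1.
    rewrite lerD//.
      by rewrite (le_trans g1)// mulr1 ler_wpM2l// ler_wpM2l//; lra.
    by rewrite (le_trans g2)// mul1r ler_wpM2l//; lra.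
  by rewrite le_eqVlt; apply/orP; left; apply/eqP; ring.
- move=> a b Phi a0 tP; have [M M0 PM] := testfun_bound tP.
  have P0 t : t <= -2 -> Phi t = 0.
    by move=> t2; apply: (testfun_out tP); rewrite negb_and -!ltNge; apply/orP; left; lra.
  have [F hF] := cutev_limit (testfun_smooth tP) P0 PM.
  exists (fun x => - (F x - (Phi x)%:C * G x)); split.
  + move=> s s0.
    have pB (z w : R[i]) : Re (z - w) = Re z - Re w by case: z w => ? ? [? ?].
    have pZ x (z : R[i]) : Re (x%:C * z) = x * Re z.
      by rewrite mulrC ReM_real mulrC.
    have := cut_derivative hG a0 tP PM hF (@Re_le_cmod R) pB pZ s0.
    congr (is_derive _ _ _ _); apply/funext => x /=.
    by rewrite -pZ -pB; case: (_ - _).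
  + move=> s s0.
    have pB (z w : R[i]) : Im (z - w) = Im z - Im w by case: z w => ? ? [? ?].
    have pZ x (z : R[i]) : Im (x%:C * z) = x * Im z.
      by rewrite mulrC ImM_real mulrC.
    have := cut_derivative hG a0 tP PM hF (@Im_le_cmod R) pB pZ s0.
    congr (is_derive _ _ _ _); apply/funext => x /=.
    by rewrite -pZ -pB; case: (_ - _).
  + move=> s sa; rewrite (cut_start tP PM hF sa) (testfun_out tP).
      by rewrite mul0r subrr oppr0.
    by case/andP: sa => _ sa; rewrite negb_and -!ltNge sa.
  + move=> s s0 bs; rewrite (cut_end tP PM hF s0 bs) (testfun_out tP).
      by rewrite mul0r subr0.
    by rewrite negb_and -!ltNge bs orbT.
Qed.

End ContinuousDensity.

(** * Continuous densities on ]0, oo[ *)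

Section PositiveHalfLine.
Context {R : realType}.
Implicit Types (u v : schwartz R -> R[i]^o) (g h N F : R -> R) (G : R -> R[i]^o).
Implicit Types (a b c d e r s x y : R) (U V : set R) (K k n m L : nat).
Local Notation mu := (@lebesgue_measure R).
Local Notation pos := (`]0%R, +oo[%classic : set R).

Definition ipos (g h : R -> R) : R := \int[mu]_(x in pos) (g x * h x).

Lemma pos_measurable g : (forall x, 0 < x -> {for x, continuous g}) -> measurable_fun pos g.
Proof.
move=> cg; apply: open_continuous_measurable_fun; first exact: interval_open.
by move=> x; rewrite inE/= in_itv/= andbT; exact: cg.
Qed.

Lemma pos_integrable g a b h : (forall x, 0 < x -> {for x, continuous g}) ->
  0 < a -> testfun a b h -> mu.-integrable pos (EFin \o (fun x => g x * h x)).
Proof.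
move=> cg a0 th; have [Mh Mh0 hM] := testfun_bound th.
have [Q hQ] : exists Q, forall x, 0 < x -> `|g x * h x| <= Q * (oneDsqr x)^-1.
  have [ab|ba] := leP a b; last first.
    exists 0 => x x0; rewrite (testfun_out th) ?mulr0 ?normr0 ?mul0r//.
    by apply/negP => /andP[ax xb]; move: (le_trans ax xb); rewrite leNgt ba.
  have [|c _ hc] := @EVT_max R (Num.norm \o g) _ _ ab.
    apply: continuous_in_subspaceT => x; rewrite inE/= in_itv/= => /andP[ax _].
    apply: (@continuous_comp _ _ _ g Num.norm); first by apply: cg; exact: lt_le_trans ax.
    exact: norm_continuous.
  exists (`|g c| * Mh * oneDsqr b) => x x0.
  have [xab|xo] := boolP (a <= x <= b); last first.
    rewrite (testfun_out th)// mulr0 normr0 !mulr_ge0 ?invr_ge0// (le_trans ler01)//.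
  apply: (@le_trans _ _ (`|g c| * Mh)).
    by rewrite normrM ler_pM//; apply: hc; rewrite in_itv.
  apply: oneDsqr_mono; first exact: mulr_ge0.
  by rewrite (ltW x0); case/andP: xab.
have [] // := @decay_integral R pos (fun x => g x * h x) Q.
- apply: measurable_funM; first exact: pos_measurable.
  apply: measurable_funTS; apply: continuous_measurable_fun.
  by apply: smooth_continuous; exact: testfun_smooth th.
- by move=> x /=; rewrite in_itv/= andbT; exact: hQ.
Qed.

Lemma ipos_lin g a b c f h : (forall x, 0 < x -> {for x, continuous g}) ->
  0 < a -> testfun a b f -> testfun a b h ->
  ipos g (fun x => c * f x + h x) = c * ipos g f + ipos g h.
Proof.
move=> cg a0 tf th; rewrite /ipos -RintegralZl//; last exact: pos_integrable tf.
rewrite -RintegralD//.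
- by congr Rintegral; apply/funext => x; ring.
- have := pos_integrable cg a0 (testfun_mull (smooth_cst c) tf).
  by apply: eq_integrable => // x _ /=; congr EFin; ring.
- exact: pos_integrable th.
Qed.

Lemma ipos_linl (g1 g2 : R -> R) a b c h : (forall x, 0 < x -> {for x, continuous g1}) ->
  (forall x, 0 < x -> {for x, continuous g2}) -> 0 < a -> testfun a b h ->
  ipos (fun x => c * g1 x + g2 x) h = c * ipos g1 h + ipos g2 h.
Proof.
move=> c1 c2 a0 th; rewrite /ipos -RintegralZl//; last exact: pos_integrable th.
rewrite -RintegralD//.
- by congr Rintegral; apply/funext => x; ring.
- have := pos_integrable c1 a0 (testfun_mull (smooth_cst c) th).
  by apply: eq_integrable => // x _ /=; congr EFin; ring.
- exact: pos_integrable th.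
Qed.

(** h vanishes outside [a, b], so the integral reduces to [a/2, b + 1]. The margins put the end
    points strictly outside the support, where N will be known. *)
Lemma ipos_FTC g a b h N : (forall x, 0 < x -> {for x, continuous g}) ->
  0 < a -> a <= b -> testfun a b h -> (forall s, 0 < s -> is_derive s 1 N (g s * h s)) ->
  ipos g h = N (b + 1) - N (a / 2).
Proof.
move=> cg a0 ab th dN.
have a2 : 0 < a / 2 by rewrite divr_gt0.
have ab2 : a / 2 < b + 1.
  rewrite (@lt_le_trans _ _ a)//; first by rewrite ltr_pdivrMr// ltr_pMr// ltr1n.
  by rewrite (le_trans ab)// lerDl.
have cN s : 0 < s -> {for s, continuous N}.
  move=> s0; apply: differentiable_continuous; apply/derivable1_diffP.
  by have [] := dN s s0.
have E : (\int[mu]_(x in `[(a / 2)%R, (b + 1)%R]) (g x * h x)%:E =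
    (N (b + 1))%:E - (N (a / 2))%:E)%E.
  apply: continuous_FTC2 => //.
  - apply: continuous_in_subspaceT => x; rewrite inE/= in_itv/= => /andP[ax _].
    have x0 : 0 < x by exact: lt_le_trans ax.
    apply: cvgM; first exact: cg.
    by apply: smooth_continuous; exact: testfun_smooth th.
  - split.
    + move=> x; rewrite in_itv/= => /andP[ax _].
      by have [] := dN x (lt_trans a2 ax).
    + by apply: cvg_at_right_filter; exact: cN.
    + by apply: cvg_at_left_filter; apply: cN; exact: lt_trans ab2.
  - move=> x; rewrite in_itv/= => /andP[ax _].
    by apply: is_derive1E; apply: dN; exact: lt_trans ax.
rewrite /ipos -[RHS]/(fine ((N (b + 1))%:E - (N (a / 2))%:E)%E) -E.
rewrite -/(Rintegral mu _ _) Rintegral_mkcond [RHS]Rintegral_mkcond.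
congr Rintegral; apply/funext => x; rewrite !patchE.
case: ifPn => xp; case: ifPn => xab //.
  rewrite (testfun_out th) ?mulr0//; apply: contra xab => /= /andP[ax xb].
  rewrite inE/= in_itv/=; apply/andP; split; lra.
exfalso; move: xp; rewrite notin_setE; apply.
by move: xab; rewrite inE/= !in_itv/= andbT => /andP[ax _]; exact: lt_le_trans ax.
Qed.

Lemma continuous_Re G x : {for x, continuous G} -> {for x, continuous (Re \o G)}.
Proof.
move=> /cvgrPdist_le cG; apply/cvgrPdist_le => e e0.
have eC : 0 < e%:C :> R[i] by rewrite ltcR.
apply: filterS (cG _ eC) => y; rewrite cmod_le; apply: le_trans.
rewrite /comp; move: (G x) (G y) => z w.
by have := Re_le_cmod (z - w); case: z w => ? ? [? ?].
Qed.

Lemma continuous_Im G x : {for x, continuous G} -> {for x, continuous (Im \o G)}.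
Proof.
move=> /cvgrPdist_le cG; apply/cvgrPdist_le => e e0.
have eC : 0 < e%:C :> R[i] by rewrite ltcR.
apply: filterS (cG _ eC) => y; rewrite cmod_le; apply: le_trans.
rewrite /comp; move: (G x) (G y) => z w.
by have := Im_le_cmod (z - w); case: z w => ? ? [? ?].
Qed.

Lemma pos_locally_integrable g : (forall x, 0 < x -> {for x, continuous g}) ->
  locally_integrable pos g.
Proof.
move=> cg; split; [exact: pos_measurable|exact: interval_open|move=> D Dpos cD].
have : mu.-integrable D (EFin \o g).
  apply: continuous_compact_integrable => //.
  apply: continuous_in_subspaceT => x; rewrite inE => /Dpos /=.
  by rewrite in_itv/= andbT; exact: cg.
by move=> /integrableP[].
Qed.

(** The product of G with a complex test function gives four real integrals, so real test functions
    on [a, b] with a > 0 suffice. *)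
Lemma regular_posP G v : (forall x, 0 < x -> {for x, continuous G}) -> linear v ->
  (forall a b h, 0 < a -> a <= b -> testfun a b h ->
    ev v h = ipos (Re \o G) h +i* ipos (Im \o G) h) -> regular_on pos G v.
Proof.
move=> cG lv H.
have cR x : 0 < x -> {for x, continuous (Re \o G : R -> R)}.
  by move=> x0; apply: continuous_Re; exact: cG.
have cI x : 0 < x -> {for x, continuous (Im \o G : R -> R)}.
  by move=> x0; apply: continuous_Im; exact: cG.
split; first by split; exact: pos_locally_integrable.
move=> phi cphi sphi; have [->|[a [b [pa pb tr ti]]]] := tsupp_testfun cphi.
  rewrite functional0// /cintegral.
  have E (p : R[i] -> R) : p 0 = 0 ->
      \int[mu]_(x in pos) p ((G * ((0 : schwartz R) : R -> R[i]^o)) x) = 0.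
    move=> p0; rewrite (@eq_Rintegral _ _ _ mu _ (cst 0)) ?Rintegral_cst ?mul0r//.
    by move=> x _; rewrite /= -[LHS]/(p (G x * 0)) mulr0.
  by rewrite !E.
have a0 : 0 < a by have := sphi a pa; rewrite /= in_itv/= andbT.
pose b' := Num.max a b.
have ab' : a <= b' by rewrite le_max lexx.
have bb' : b <= b' by rewrite le_max lexx orbT.
have {}tr := testfunW (lexx a) bb' tr; have {}ti := testfunW (lexx a) bb' ti.
rewrite ev_split// (H _ _ _ a0 ab' ti) (H _ _ _ a0 ab' tr) /cintegral.
have -> : \int[mu]_(x in pos) Re ((G * (phi : R -> R[i]^o)) x) =
    -1 * ipos (Im \o G) (im phi) + ipos (Re \o G) (re phi).
  rewrite /ipos -RintegralZl//; last exact: pos_integrable ti.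
  rewrite -RintegralD//; last exact: pos_integrable tr.
    congr Rintegral; apply/funext => x; rewrite /= /re /im -[LHS]/(Re (G x * phi x)).
    by case: (G x) (schwartz_fun phi x) => ? ? [? ?] /=; ring.
  have := pos_integrable cI a0 (testfun_mull (smooth_cst (-1)) ti).
  by apply: eq_integrable => // x _ /=; congr EFin; ring.
have -> : \int[mu]_(x in pos) Im ((G * (phi : R -> R[i]^o)) x) =
    ipos (Re \o G) (im phi) + ipos (Im \o G) (re phi).
  rewrite /ipos -RintegralD//; [|exact: pos_integrable ti|exact: pos_integrable tr].
  congr Rintegral; apply/funext => x; rewrite /= /re /im -[LHS]/(Im (G x * phi x)).
  by case: (G x) (schwartz_fun phi x) => ? ? [? ?] /=; ring.
move: (ipos _ _) (ipos _ _) (ipos _ _) (ipos _ _) => p q p' q'.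
by apply/eqP; rewrite eq_complex/=; apply/andP; split; apply/eqP; ring.
Qed.

Lemma regular_onS U V G v : regular_on U G v -> measurable U -> open V -> measurable V -> V `<=` U ->
  regular_on V G v.
Proof.
move=> [[[mr _ ir] [mi _ ii]] reg] mU oV mV VU; split.
  split; split => //; do ?exact: (measurable_funS mU VU).
  - by move=> D DV; apply: ir; exact: subset_trans VU.
  - by move=> D DV; apply: ii; exact: subset_trans VU.
move=> phi cphi sphi; rewrite reg//; last exact: subset_trans VU.
have E (p : R[i] -> R) : p 0 = 0 ->
    \int[mu]_(x in U) p ((G * (phi : R -> R[i]^o)) x) =
    \int[mu]_(x in V) p ((G * (phi : R -> R[i]^o)) x).
  move=> p0; rewrite Rintegral_mkcond [RHS]Rintegral_mkcond.
  congr Rintegral; apply/funext => x; rewrite !patchE.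
  case: ifPn => xU; case: ifPn => xV //.
    have [] := @tsupp_out _ phi x; first by move=> /sphi Vx; move: xV; rewrite notin_setE.
    rewrite /re /im -[X in _ -> _ -> p X = _]/(G x * phi x).
    by case: (schwartz_fun phi x) => ? ? /= -> ->; rewrite mulr0 p0.
  by move: xU; rewrite notin_setE => -[]; apply: VU; rewrite inE in xV.
by rewrite /cintegral !E.
Qed.

(** On ]0, oo[ both G and the primitive of v have derivative v, so they differ by a constant. As
    [omega] has integral 1, testing against it gives the constant [kr +i* ki]. *)
Lemma dist_prim_regular v L C : tempered_half v -> 0 <= C -> length_bound v L C ->
  exists G, [/\ forall s, 0 < s -> {for s, continuous G}, regular_on pos G (dist_prim v) &
    exists2 B, 0 <= B & forall s, 0 < s -> cmod (G s) <= B * (s + 2) ^+ L.+1].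
Proof.
move=> hv C0 vB; have [G [cG [B B0 GB] GN]] := density_exists hv C0 vB.
set w := dist_prim v; have hw : tempered_half w by exact: dist_prim_half.
have [[lw _] _] := hw.
have cR x : 0 < x -> {for x, continuous (Re \o G : R -> R)}.
  by move=> x0; apply: continuous_Re; exact: cG.
have cI x : 0 < x -> {for x, continuous (Im \o G : R -> R)}.
  by move=> x0; apply: continuous_Im; exact: cG.
have c1 x : 0 < x -> {for x, continuous (cst 1 : R -> R)} by move=> _; exact: cvg_cst.
pose kr := Re (ev w omega) - ipos (Re \o G) omega.
pose ki := Im (ev w omega) - ipos (Im \o G) omega.
have cG' s : 0 < s -> {for s, continuous (fun x => G x + (kr +i* ki) : R[i]^o)}.
  by move=> s0; apply: cvgD; [exact: cG|exact: cvg_cst].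
exists (fun x => G x + (kr +i* ki)); split => //; last first.
  exists (B + cmod (kr +i* ki)) => [|s s0]; first by rewrite addr_ge0// cmod_ge0.
  rewrite (le_trans (cmodD _ _))// mulrDl lerD//; first exact: GB.
  by rewrite ler_peMr ?cmod_ge0// exprn_ege1//; lra.
apply: regular_posP => // a b h a0 ab th.
have [M _ hM] := testfun_bound th.
have [F [c [psi [[sF dF F0 Fc] tpsi hE _ _]]]] := omega_decomposition a0 ab th hM.
set a' := Num.min a 1 in tpsi; set b' := Num.max b 2 in tpsi.
have a'0 : 0 < a' by rewrite lt_min a0/=.
have a'b' : a' <= b' by rewrite le_max ge_min ab.
have tom : testfun a' b' (@omega R).
  by apply: testfunW testfun_omega; rewrite ?ge_min ?le_max lexx orbT.
have tD := testfun_derive tpsi.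
have Ec : ipos (cst 1) h = c.
  have dF' s : 0 < s -> is_derive s 1 F (cst 1 s * h s).
    by move=> _; rewrite mul1r -dF; exact: smooth_is_derive.
  by rewrite (ipos_FTC c1 a0 ab th dF') Fc ?F0 ?subr0//; lra.
have Ew : ev w h = c%:C * ev w omega - ev v psi.
  rewrite {1}hE ev_lin//; last 2 first.
  - exact: testfun_rschwartz tom.
  - exact: testfun_rschwartz tD.
  congr (_ + _); have := ev_derive lw (testfun_rschwartz tpsi).
  by rewrite dist_primK// => ->; rewrite opprK.
have [N [NR NI N0 N1]] := GN _ _ _ a'0 tpsi.
have Na : N (a' / 2) = 0 by apply: N0; lra.
have Nb : N (b' + 1) = - ev v psi by apply: N1; lra.
have ER : ipos (Re \o G) h = c * ipos (Re \o G) omega - Re (ev v psi).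
  rewrite {1}hE (ipos_lin _ cR a'0 tom tD) (ipos_FTC cR a'0 a'b' tD NR)/= Na Nb.
  by case: (ev v psi) => ? ? /=; rewrite subr0.
have EI : ipos (Im \o G) h = c * ipos (Im \o G) omega - Im (ev v psi).
  rewrite {1}hE (ipos_lin _ cI a'0 tom tD) (ipos_FTC cI a'0 a'b' tD NI)/= Na Nb.
  by case: (ev v psi) => ? ? /=; rewrite subr0.
have -> : Re \o (fun x => G x + (kr +i* ki) : R[i]^o) = (fun x => kr * cst 1 x + (Re \o G) x).
  by apply/funext => x; rewrite /=; case: (G x) => ? ? /=; ring.
have -> : Im \o (fun x => G x + (kr +i* ki) : R[i]^o) = (fun x => ki * cst 1 x + (Im \o G) x).
  by apply/funext => x; rewrite /=; case: (G x) => ? ? /=; ring.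
rewrite (ipos_linl _ c1 cR a0 th) (ipos_linl _ c1 cI a0 th) Ec ER EI Ew /kr /ki.
move: (ipos _ _) (ipos _ _) (ev w omega) (ev v psi) => p q [x y] [z t].
by apply/eqP; rewrite eq_complex/=; apply/andP; split; apply/eqP; ring.
Qed.

Lemma dominated_regular K : exists L, forall u, tempered_half u ->
  dominated (@schwartz_half R) (sbound K) u ->
  exists G, [/\ forall s, 0 < s -> {for s, continuous G},
    regular_on pos G (primitive K.+2 u) &
    exists2 B, 0 <= B & forall s, 0 < s -> cmod (G s) <= B * (s + 2) ^+ L].
Proof.
have [L hL] := @order_bound0 R K (K + K)%N.
exists L.+1 => u hu du; rewrite primitiveE//= .
have hw := iter_dist_prim_half K hu; have [[lw _] _] := hw.
have [C C0 hC] := hL _ lw (dominated_order_bound hu du).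
have [C' C'0 hC'] := order_length_bound hw C0 hC.
exact: dist_prim_regular (dist_prim_half hw) C'0 hC'.
Qed.

(** For x >= 1, (x + 2) ^ L <= (3 x) ^ L and alpha >= L; for x <= 1, (x + 2) ^ L <= 3 ^ L and x ^ (m
    - alpha) >= 1 because alpha >= m. So P = 0 works at both ends. *)
Lemma cesaro_regular L m u G : (forall s, 0 < s -> {for s, continuous G}) ->
  regular_on pos G (primitive m u) ->
  (exists2 B, 0 <= B & forall s, 0 < s -> cmod (G s) <= B * (s + 2) ^+ L) ->
  let alpha := (L + m)%:R + 2^-1 in
  [/\ cesaro_pinfty alpha m u, continuous_on_pos (primitive m u) & cesaro_zero alpha m u].
Proof.
move=> cG rG [B B0 GB] alpha.
have mpos : measurable pos by exact: measurable_itv.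
have a0 : 0 <= alpha by rewrite /alpha addr_ge0// invr_ge0.
split; last 2 first.
- by exists G.
- exists 1, G, 0, (B * 3 ^+ L); split => //; first 2 last.
  + near=> x.
    have x0 : 0 < x by near: x; exact: nbhs_right_gt.
    have x1 : x <= 1 by near: x; exact: nbhs_right_le.
    rewrite horner0 subr0 cmod_le (le_trans (GB _ x0))// -mulrA ler_wpM2l//.
    rewrite -[leLHS]mulr1 ler_pM//.
    * by rewrite exprn_ge0//; lra.
    * by rewrite lerXn2r ?nnegrE//; lra.
    * rewrite -[leLHS](powRr0 x) ger_powR//; first by rewrite x0.
      have L0 : 0 <= L%:R :> R by [].
      by rewrite /alpha natrD; lra.
  + apply: regular_onS rG _ _ _ _ => //.
    * by move=> x /=; rewrite !in_itv/= => /andP[->].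
  + by rewrite size_poly0.
- exists 1, G, 0, (B * 3 ^+ L); split => //.
  + apply: regular_onS rG _ _ _ _ => //.
    by move=> x /=; rewrite !in_itv/= !andbT; exact: lt_trans.
  + by rewrite size_poly0.
  + near=> x.
    have x1 : 1 <= x by near: x; exact: nbhs_pinfty_ge.
    have x0 : 0 < x by lra.
    rewrite horner0 subr0 cmod_le (le_trans (GB _ x0))// -mulrA ler_wpM2l//.
    apply: (@le_trans _ _ (3 ^+ L * x ^+ L)).
      by rewrite -exprMn lerXn2r ?nnegrE//; lra.
    rewrite ler_wpM2l ?exprn_ge0// -powR_mulrn ?(ltW x0)// ler_powR//.
    have m0 : 0 <= m%:R :> R by [].
    by rewrite /alpha natrD; lra.
Unshelve. all: by end_near.
Qed.

Lemma halfint_notint n : (n%:R + 2^-1 : R) \isn't a Num.int.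
Proof.
rewrite rpredDl ?natr_int//; apply/negP => /norm_intr_ge1.
rewrite invr_neq0// => /(_ isT); rewrite ger0_norm// invf_ge1//; lra.
Qed.

End PositiveHalfLine.

(** * The equivalence *)

Section Combinations.
Context {R : realType}.
Implicit Types (f : nat -> schwartz R -> R[i]^o) (b : nat -> R[i]).

Definition comb f b N : schwartz R -> R[i]^o := \sum_(n < N.+1) b n *: f n.

Lemma combE f b N phi :
  comb f b N phi = b N * f N phi + \sum_(n < N) b n * f n phi.
Proof.
rewrite /comb big_ord_recr addrC; congr (_ + _).
elim: N => [|N IHN]; first by rewrite !big_ord0.
by rewrite !big_ord_recr/= -IHN.
Qed.

Lemma combS f b N : b N.+1 = 0 -> comb f b N.+1 = comb f b N.
Proof. by move=> bN; rewrite /comb big_ord_recr/= bN scale0r addr0. Qed.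

Lemma comb_sub f b n phi :
  comb f (fun i => if i == n then 1 else - b i) n phi =
  f n phi - \sum_(i < n) b i * f i phi.
Proof.
rewrite combE eqxx mul1r -sumrN; congr (_ + _); apply: eq_bigr => i _.
by rewrite (ltn_eqF (ltn_ord i)) mulNr.
Qed.

Lemma comb_top f b K N : dominated (@schwartz_half R) (sbound K) (comb f b N) ->
  b N != 0 -> top f K N.
Proof.
move=> [C [C0 hC]] bN; exists (fun i => - ((b N)^-1 * b i)).
exists (cmod (b N)^-1 * C); split=> [|phi r hphi pr]; first by rewrite mulr_ge0// cmod_ge0.
have -> : f N phi - \sum_(i < N) - ((b N)^-1 * b i) * f i phi = (b N)^-1 * comb f b N phi.
  rewrite combE mulrDr mulKf// mulr_sumr -sumrN; congr (_ + _).
  by apply: eq_bigr => i _; rewrite mulNr opprK mulrA.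
by rewrite cmodM -mulrA ler_wpM2l ?cmod_ge0// hC.
Qed.

(** A dominated combination with non-zero leading coefficient would make its last f a top. So the
    leading coefficient vanishes, the combination is unchanged when shortened, and the argument
    descends from N to nu. *)
Lemma dominated_comb_eq0 f b K nu N :
  (forall n, (nu <= n)%N -> ~ top f K n) ->
  dominated (@schwartz_half R) (sbound K) (comb f b N) ->
  forall n, (nu <= n <= N)%N -> b n = 0.
Proof.
move=> nt; elim: N => [|N IHN] dN n /andP[nun nN].
  apply/eqP/negPn/negP => bn; move: nN; rewrite leqn0 => /eqP n0.
  by apply: (nt n nun); rewrite n0; apply: comb_top dN _; rewrite -n0.
have bN : b N.+1 = 0.
  apply/eqP/negPn/negP => bN.
  by apply: (nt N.+1); [exact: leq_trans nN|exact: comb_top dN bN].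
move: nN; rewrite leq_eqVlt ltnS => /predU1P[->//|nN].
by apply: IHN; rewrite ?nun// -(combS f bN).
Qed.

Lemma comb_half f b N : (forall n, tempered_half (f n)) -> tempered_half (comb f b N).
Proof. exact: tempered_half_sum. Qed.

Lemma primitive_comb m f b N : (forall n, tempered_half (f n)) ->
  primitive m (comb f b N) = \sum_(n < N.+1) b n *: primitive m (f n).
Proof.
move=> hf; rewrite primitiveE; last exact: comb_half.
rewrite iter_dist_prim_sum//; apply: eq_bigr => n _.
by rewrite primitiveE.
Qed.

Lemma moments_null_free f : (forall n, tempered_half (f n)) ->
  (forall a : nat -> R[i], exists phi, schwartz_half phi /\ forall n, f n phi = a n) ->
  null_free f.
Proof.
move=> hf sol N b [_ null] n nN.
have [phi [hphi fphi]] := sol (fun i => (i == n)%:R).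
have := null phi hphi; rewrite -/(comb f b N).
have -> : comb f b N phi = \sum_(i < N.+1) b i * f i phi by rewrite combE big_ord_recr/= addrC.
rewrite (bigD1 (Ordinal (nN : (n < N.+1)%N)))//= fphi eqxx mulr1 big1 ?addr0// => i.
by rewrite fphi -val_eqE/= => /negPf ->; rewrite mulr0.
Qed.

Lemma moments_cesaro_admissible f : (forall n, tempered_half (f n)) ->
  (forall a : nat -> R[i], exists phi, schwartz_half phi /\ forall n, f n phi = a n) ->
  cesaro_admissible f.
Proof.
move=> hf sol; have [_ nt] := moments_not_top sol.
exists id; split=> // j alpha _ _.
have [K hK] := cesaro_testfun_bound alpha j; have [nu hnu] := nt K.
exists nu => N b _ cinf cpos czero; rewrite -primitive_comb// in cpos.
have hc := comb_half b N hf; have [C C0 hC] := hK _ hc cinf cpos czero.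
have [tc _] := hc.
exact: dominated_comb_eq0 hnu (dominated_testfun tc C0 hC).
Qed.

Lemma null_free_independent f n : (forall n, tempered_half (f n)) -> null_free f ->
  ~ dependent f n.
Proof.
move=> hf nf [b hb]; pose b' i := if i == n then 1 else - b i.
have /(_ n (leqnn n)) : forall i, (i <= n)%N -> b' i = 0.
  apply: nf; split; first exact: comb_half.
  by move=> phi hphi; rewrite -/(comb f b' n) comb_sub hb// subrr.
by rewrite /b' eqxx => /eqP; rewrite oner_eq0.
Qed.

(** The sequence m is given and only known to increase, so m (K + 2) >= K + 2 is written K' + 2 with
    K' >= K, and a top for K is used as a top for K'. Its dominated combination has leading
    coefficient 1 and satisfies the three Cesaro conditions, so n < nu. *)
Lemma cesaro_admissible_not_top f K : (forall n, tempered_half (f n)) ->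
  cesaro_admissible f -> exists nu, forall n, (nu <= n)%N -> ~ top f K n.
Proof.
move=> hf [m [mS adm]].
have mge j : (j <= m j)%N.
  by elim: j => // j IHj; exact: leq_ltn_trans IHj (mS _ _ _).
have [K' mK] : exists K', m K.+2 = K'.+2.
  by have := mge K.+2; case: (m K.+2) => [|[|K']]// _; exists K'.
have KK' : (K <= K')%N by have := mge K.+2; rewrite mK !ltnS.
have [L hL] := @dominated_regular R K'.
pose alpha : R := (L + K'.+2)%:R + 2^-1.
have [||nu hnu] := adm K.+2 alpha; [by rewrite ltr_wpDl// invr_gt0|exact: halfint_notint|].
exists nu => n nun /(topW KK')[b db]; pose b' i := if i == n then 1 else - b i.
have hc := comb_half b' n hf.
have dc : dominated (@schwartz_half R) (sbound K') (comb f b' n).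
  have [C [C0 hC]] := db; exists C; split=> // phi r hphi pr.
  by rewrite comb_sub; exact: hC.
have [G [cG rG GB]] := hL _ hc dc.
have [cinf cpos czero] := cesaro_regular cG rG GB.
rewrite primitive_comb// in cpos.
have : b' n = 0 by apply: (hnu n b') => //; rewrite ?mK// nun leqnn.
by rewrite /b' eqxx => /eqP; rewrite oner_eq0.
Qed.

End Combinations.

Theorem theorem3p1 (R : realType) (f : nat -> schwartz R -> (R[i])^o)
    (hf : forall n : nat, tempered_half (f n)) :
  (forall a : nat -> R[i], exists phi : schwartz R,
     schwartz_half phi /\ forall n : nat, f n phi = a n) <->
  (null_free f /\ cesaro_admissible f).
Proof.
split=> [sol|[nf adm]].
  by split; [exact: moments_null_free|exact: moments_cesaro_admissible].
apply: not_top_moments => [n|n|K].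
- by have [] := hf n.
- exact: null_free_independent.
- exact: cesaro_admissible_not_top.
Qed.
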